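(* Let $v:\mathbb{T}\to\mathbb{R}$ be a real analytic function, $a:\mathbb{T}\to\mathbb{C}$ a complex analytic function that is not identically zero, and $\lambda_a,\lambda_v>0$. There exist $\lambda_0=\lambda_0(v,\lambda_a,a)$ and $c_{v,a}=c_{v,a}(v,a)$ such that for any $\delta>0$, irrational $\omega$ and $E\in\mathscr{E}$: if $\beta(\omega)<c_{v,a}\min(\delta,|D|)$ and $\lambda_v>\lambda_0$, then $$\operatorname{mes}\{x\in\mathbb{T}:|u_n(x,E,\omega)-L_n(E,\omega)|>\delta\}<\exp(-c_1\delta^2n)+\exp(-c_2\delta n)\qquad\text{for all }n\ge n_1,$$ where $n_1=n_1(\lambda_a,a,\lambda_v,v)$, $c_1=c_1(\lambda_a,a,\lambda_v,v)$ and $c_2=c_2(\lambda_a,a,\lambda_v,v)$ (the constants $c_{v,a},c_1,c_2$ being positive).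
   Context: $\mathbb{T}=\mathbb{R}/\mathbb{Z}$, $\operatorname{mes}$ is Lebesgue measure. For irrational $\omega$ and $E\in\mathbb{R}$ the Jacobi cocycle matrix is $$M(x,E,\omega)=\frac{1}{\lambda_aa(x+\omega)}\begin{pmatrix}\lambda_vv(x)-E&-\lambda_a\overline{a(x)}\\ \lambda_aa(x+\omega)&0\end{pmatrix},$$ defined for almost every $x$; $M_n(x,E,\omega)=\prod_{k=n}^1M(x+k\omega,E,\omega)$ (ordered product, index decreasing from left to right), $u_n(x,E,\omega)=\frac1n\log\|M_n(x,E,\omega)\|$, $L_n(E,\omega)=\int_{\mathbb{T}}u_n(x,E,\omega)\,dx$. $D=\int_{\mathbb{T}}\log|\lambda_aa(x)|\,dx$, and $\mathscr{E}=[-2\lambda_a\|a\|_{L^\infty(\mathbb{T})}-\lambda_v\|v\|_{L^\infty(\mathbb{T})},\,2\lambda_a\|a\|_{L^\infty(\mathbb{T})}+\lambda_v\|v\|_{L^\infty(\mathbb{T})}]$. For irrational $\omega$ with continued fraction approximants $p_s/q_s$, $\beta(\omega)$ is the least constant such that $\log q_{s+1}\le\beta(\omega)q_s$ for all $s\ge0$ ($\infty$ if there is none). *)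

(* Defs.v *)
From HB Require Import structures.
From mathcomp Require Import all_boot all_order all_algebra.
From mathcomp Require Import all_classical all_reals all_analysis.
From mathcomp Require Import complex.
Set Implicit Arguments.
Unset Strict Implicit.
Unset Printing Implicit Defensive.
Import Order.TTheory GRing.Theory Num.Theory.
Import numFieldNormedType.Exports.
Import Normc.
Local Open Scope classical_set_scope.
Local Open Scope ring_scope.
Local Open Scope complex_scope.

(** Functions on the circle [R/Z] are encoded as 1-periodic functions on [R];
    [circle_measure] is Lebesgue measure restricted to the fundamental domain
    [0, 1), so that measures, integrals and essential suprema over the circle
    are those with respect to [circle_measure]. *)
Definition circle_measure (R : realType)
    : {measure set (measurableTypeR R) -> \bar R} :=
  mrestr (@lebesgue_measure R) (measurable_itv (`[0, 1[ : interval R)).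
Arguments circle_measure : clear implicits.

Definition periodic1 (R : realType) (K : Type) (f : R -> K) : Prop :=
  forall x, f (x + 1) = f x.

(** [K] is [R] or [R[i]], and [iota] the inclusion of [R] into [K]. *)
Definition analytic (R : realType) (K : numFieldType) (iota : R -> K)
    (f : R -> K) : Prop :=
  forall x0 : R, exists (c : nat -> K) (r : R), 0 < r /\
    forall x : R, `|x - x0| < r ->
      series (fun k => c k * iota (x - x0) ^+ k) @ \oo --> f x.

(** Euclidean norm on [C^m]. *)
Definition vnorm (R : realType) (m : nat) (w : 'cV[R[i]]_m) : R :=
  Num.sqrt (\sum_(i < m) normc (w i 0) ^+ 2).

Definition opnorm (R : realType) (m : nat) (A : 'M[R[i]]_m) : R :=
  sup [set vnorm (A *m w) | w in [set w | vnorm w <= 1]].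

Section Jacobi.
Variables (R : realType) (v : R -> R) (a : R -> R[i]) (la lv : R).

(** At the (measure zero) set of [x] with [a (x + omega) = 0], where the
    cocycle is undefined, the convention [0^-1 = 0] makes this matrix zero. *)
Definition jacobi_mx (E omega x : R) : 'M[R[i]]_2 :=
  (la%:C * a (x + omega))^-1 *:
  \matrix_(i, j)
    (if i == 0 then
       if j == 0 then (lv * v x - E)%:C else - (la%:C * (a x)^*)
     else
       if j == 0 then la%:C * a (x + omega) else 0).

(** [M_n]: the index [k] runs through [n, n-1, ..., 1] from left to right. *)
Definition jacobi_mxn (n : nat) (E omega x : R) : 'M[R[i]]_2 :=
  \prod_(k <- rev (iota 1 n)) jacobi_mx E omega (x + k%:R * omega).

Definition jacobi_u (n : nat) (E omega x : R) : R :=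
  n%:R^-1 * ln (opnorm (jacobi_mxn n E omega x)).

Definition jacobi_L (n : nat) (E omega : R) : R :=
  \int[circle_measure R]_x jacobi_u n E omega x.

Definition jacobi_D : R :=
  \int[circle_measure R]_x ln (normc (la%:C * a x)).

Definition energy_radius : R :=
  2 * la * fine ('N[circle_measure R]_+oo[EFin \o (fun x => normc (a x))])
  + lv * fine ('N[circle_measure R]_+oo[EFin \o v]).

Definition energy_itv : set R := `[- energy_radius, energy_radius]%classic.

End Jacobi.

Section ContinuedFraction.
Variables (R : realType) (omega : R).

(** Complete quotients: [omega = [a_0; a_1, ..., a_(s-1), cf_quot s]] with
    [a_k = cf_digit k]. *)
Fixpoint cf_quot (s : nat) : R :=
  if s is s'.+1 then (cf_quot s' - (Num.floor (cf_quot s'))%:~R)^-1 else omega.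

Definition cf_digit (s : nat) : int := Num.floor (cf_quot s).

(** [(q_s, q_(s-1))], with [q_0 = 1], [q_(-1) = 0]. *)
Fixpoint cf_qpair (s : nat) : int * int :=
  if s is s'.+1 then
    let: (q, q') := cf_qpair s' in (cf_digit s * q + q', q)
  else (1, 0).

Definition cf_q (s : nat) : int := (cf_qpair s).1.

Definition beta : \bar R :=
  ereal_inf [set b%:E | b in
    [set b : R | forall s, ln (cf_q s.+1)%:~R <= b * (cf_q s)%:~R]].

End ContinuedFraction.

(* Main.v *)
Require Import Defs.
From mathcomp Require Import all_boot all_order all_algebra.
From mathcomp Require Import all_classical all_reals all_analysis.
From mathcomp Require Import measurable_realfun ess_sup_inf complex ring lra zify.
Import Order.TTheory GRing.Theory Num.Theory.
Import numFieldNormedType.Exports.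
Import Normc.
Set Implicit Arguments.
Unset Strict Implicit.
Unset Printing Implicit Defensive.
Local Open Scope classical_set_scope.
Local Open Scope ring_scope.
Local Open Scope complex_scope.

(** Since [omega] has a convergent denominator [q_1] or [q_2] that is at least
    [2], [beta omega >= ln 2] always, and the assumption on [beta omega] makes
    [delta] larger than a multiple of [1 + beta omega] with a factor as large as
    wanted, depending on [v] and [a] only. It thus suffices to prove that, for
    some constant [m], the set where [|u_n - m| > D t] has measure at most
    [2 exp (- c t n)] for all [t >= T (1 + beta)] ([deviation_tails]): integrating
    these tails shows that [L_n] is itself close to [m] ([mean_near_center]).

    The tails rest on one estimate, [small_recurrence]. Let [F] be periodic and
    analytic near the real line, bounded by [1] there and at least [exp (- A n)]
    in modulus at [x + z] for all real [x] and some complex [z]. Then the set of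
    [x] such that [|F (x + k omega)| <= exp (- t n)] for all [k <= N] has measure
    at most [exp (- c t N)], where [N] may be any fixed fraction of [n] and [c]
    does not depend on this fraction. Indeed a larger set would contain a
    cluster of many well separated points in a tiny interval. Interpolate [F] at
    the translates of the cluster by [k omega], [k <= N]: for a number of nodes
    of order [n], the remainder is below [exp (- A n)] because [F] is analytic
    ([interpolation_bound]), and the products of the distances between nodes are
    at least [exp (- C (1 + beta) n)] because
    [prod_(k <= N) ||k omega|| >= exp (- C (1 + beta) N)] ([prod_circle_dist],
    from the continued fraction of [omega]). So [F] would be too small at
    [x + z]. The analyticity of [F] enters through polynomial
    approximations on discs ([poly_approx]).

    Applied to the product of the [a (x + k omega)], this bounds the denominators
    and the determinants of the cocycle ([cocycle_denominator_tail]). For a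
    nonconstant [v], every energy is avoided by [v] on some horizontal line close
    to the real one, with a margin that is uniform by compactness
    ([uniform_approx_energy]). For large [lambda_v / lambda_a] the cocycle is
    uniformly hyperbolic on that line, so that the top left entry of [M_n] is of
    size [(lambda_v / lambda_a) ^ n] there up to a factor [exp (- C n)] with [C]
    depending on [v] and [a] only, which is also the size of the upper bound on
    the real line; [small_recurrence] and the near invariance of [u_n] under the
    rotation give the tails ([tail_hyperbolic]). For constant [v] the cocycle is
    either uniformly hyperbolic or bounded ([tail_constant]). *)

(** * Continued fractions and best approximation *)

Section ContinuedFractions.
Variables (R : realType) (omega : R).
Hypothesis omega_irr : irrational omega.

(** Numerators of the convergents, as pairs [(p_s, p_(s-1))]. *)
Fixpoint cf_ppair (s : nat) : int * int :=
  if s is s'.+1 then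
    let: (p, p') := cf_ppair s' in (cf_digit omega s * p + p', p)
  else (cf_digit omega 0, 1).

Lemma irrational_sub_int (x : R) (k : int) :
  irrational x -> irrational (x - k%:~R).
Proof.
move=> xi [r _ rE]; apply: xi; exists (r + k%:~R) => //.
by rewrite rmorphD/= ratr_int rE subrK.
Qed.

Lemma irrational_inv (x : R) : irrational x -> irrational x^-1.
Proof.
move=> xi [r _ rE]; apply: xi; exists r^-1 => //.
by rewrite fmorphV/= rE invrK.
Qed.

Lemma cf_quot_irrational s : irrational (cf_quot omega s).
Proof.
by elim: s => [//|s IH]; apply: irrational_inv; exact: irrational_sub_int.
Qed.

Lemma cf_frac_itv s :
  0 < cf_quot omega s - (cf_digit omega s)%:~R < 1.
Proof.
have /andP[h1 h2] := floor_itv (cf_quot omega s).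
rewrite subr_gt0 lt_neqAle h1 andbT /cf_digit.
apply/andP; split; last by rewrite intrD in h2; lra.
apply/eqP => e; apply: (@cf_quot_irrational s).
by exists (Num.floor (cf_quot omega s))%:~R => //; rewrite ratr_int e.
Qed.

Lemma cf_quot_gt1 s : 1 < cf_quot omega s.+1.
Proof.
have /andP[h1 h2] := cf_frac_itv s.
by rewrite /= -/(cf_digit omega s) invf_cp1.
Qed.

Lemma cf_digit_ge1 s : 1 <= cf_digit omega s.+1.
Proof. by rewrite /cf_digit floor_ge_int; exact/ltW/cf_quot_gt1. Qed.

Lemma cf_qS s : cf_q omega s.+2 =
  cf_digit omega s.+2 * cf_q omega s.+1 + cf_q omega s.
Proof. by rewrite /cf_q /=; case: (cf_qpair omega s). Qed.

Lemma cf_q1 : cf_q omega 1 = cf_digit omega 1.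
Proof. by rewrite /cf_q /= mulr1 addr0. Qed.

Definition cf_p s : int := (cf_ppair s).1.

Lemma cf_pS s : cf_p s.+2 = cf_digit omega s.+2 * cf_p s.+1 + cf_p s.
Proof. by rewrite /cf_p /=; case: (cf_ppair s). Qed.

Lemma cf_p1 : cf_p 1 = cf_digit omega 1 * cf_digit omega 0 + 1.
Proof. by []. Qed.

Lemma cf_q_mono s : 1 <= cf_q omega s <= cf_q omega s.+1.
Proof.
elim: s => [|s /andP[h1 h2]].
  by rewrite cf_q1 cf_digit_ge1.
rewrite cf_qS; have := cf_digit_ge1 s.+1; nia.
Qed.

Lemma cf_q_ge s : s%:Z <= cf_q omega s.
Proof.
suff: s%:Z <= cf_q omega s /\ s.+1%:Z <= cf_q omega s.+1 by case.
elim: s => [|s [h1 h2]]; first by rewrite cf_q1 cf_digit_ge1.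
split=> //; rewrite cf_qS; have := cf_digit_ge1 s.+1.
have := cf_q_mono s; nia.
Qed.

Lemma cf_det s :
  cf_q omega s.+1 * cf_p s - cf_p s.+1 * cf_q omega s = (-1) ^+ s.+1.
Proof.
elim: s => [|s IH]; first by rewrite cf_q1 cf_p1 /cf_p /cf_q /=; ring.
by rewrite cf_qS cf_pS (exprS _ s.+1) -IH; ring.
Qed.

(** [cf_err s] is the absolute value of [q_s * omega - p_s], the sign of which
    is [(-1) ^+ s]. *)
Fixpoint cf_err (s : nat) : R :=
  if s is s'.+1 then cf_err s' / cf_quot omega s.+1
  else (cf_quot omega 1)^-1.

Lemma cf_quot_gt0 s : 0 < cf_quot omega s.+1.
Proof. exact: lt_trans (cf_quot_gt1 s). Qed.

Lemma cf_err_gt0 s : 0 < cf_err s.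
Proof.
elim: s => [|s IH] /=; first by rewrite invr_gt0; exact: (cf_quot_gt0 0).
by rewrite divr_gt0//; exact: (cf_quot_gt0 s.+1).
Qed.

Lemma cf_quotE s :
  cf_quot omega s = (cf_digit omega s)%:~R + (cf_quot omega s.+1)^-1.
Proof. by rewrite /= invrK addrC subrK. Qed.

Lemma cf_errE s :
  (cf_q omega s)%:~R * omega - (cf_p s)%:~R = (-1) ^+ s * cf_err s.
Proof.
suff: (cf_q omega s)%:~R * omega - (cf_p s)%:~R = (-1) ^+ s * cf_err s /\
      (cf_q omega s.+1)%:~R * omega - (cf_p s.+1)%:~R
        = (-1) ^+ s.+1 * cf_err s.+1 by case.
have nz s' : cf_quot omega s'.+1 != 0 by rewrite gt_eqF// cf_quot_gt0.
elim: s => [|s [IH1 IH2]].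
  have e0 : omega = (cf_digit omega 0)%:~R + (cf_quot omega 1)^-1.
    exact: (cf_quotE 0).
  have e1 := cf_quotE 1.
  have n1 := nz 0%N; have n2 := nz 1%N.
  have d0 : omega - (cf_digit omega 0)%:~R = (cf_quot omega 1)^-1.
    by rewrite {1}e0 addrC addKr.
  split.
    by rewrite (_ : cf_err 0 = (cf_quot omega 1)^-1)// -d0 expr0 !mul1r.
  rewrite cf_q1 cf_p1 intrD intrM.
  rewrite (_ : cf_err 1 = (cf_quot omega 1)^-1 / cf_quot omega 2)//.
  have -> : (cf_digit omega 1)%:~R * omega -
    ((cf_digit omega 1)%:~R * (cf_digit omega 0)%:~R + 1%:~R) =
    (cf_digit omega 1)%:~R * (omega - (cf_digit omega 0)%:~R) - 1 by ring.
  have -> : (cf_digit omega 1)%:~R = cf_quot omega 1 - (cf_quot omega 2)^-1.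
    by rewrite {1}e1 addrK.
  rewrite d0; move: n1 n2; set u := cf_quot omega 1; set w := cf_quot omega 2.
  by move=> n1 n2; field; rewrite n1 n2.
split=> //.
have -> : (cf_q omega s.+2)%:~R * omega - (cf_p s.+2)%:~R =
   (cf_digit omega s.+2)%:~R * ((cf_q omega s.+1)%:~R * omega - (cf_p s.+1)%:~R)
   + ((cf_q omega s)%:~R * omega - (cf_p s)%:~R).
  by rewrite cf_qS cf_pS !intrD !intrM; ring.
rewrite IH1 IH2.
have -> : (cf_digit omega s.+2)%:~R
          = cf_quot omega s.+2 - (cf_quot omega s.+3)^-1.
  by rewrite (cf_quotE s.+2) addrK.
have n2 := nz s.+1; have n3 := nz s.+2.
rewrite (_ : cf_err s.+2 = cf_err s.+1 / cf_quot omega s.+3)//.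
rewrite (_ : cf_err s.+1 = cf_err s / cf_quot omega s.+2)// !exprS.
move: n2 n3; set u := cf_quot omega s.+2; set w := cf_quot omega s.+3.
by move=> n2 n3; field; rewrite n2 n3.
Qed.

Lemma cf_err_lower s : 1 <= 2 * (cf_q omega s.+1)%:~R * cf_err s.
Proof.
have E0 := cf_errE s; have E1 := cf_errE s.+1.
have D := cf_det s.
have: ((cf_q omega s.+1 * cf_p s - cf_p s.+1 * cf_q omega s)%:~R : R)
   = (-1) ^+ s.+1 by rewrite D rmorphXn/= rmorphN1.
rewrite intrD intrN !intrM => D'.
have sq : ((-1) ^+ s : R) * (-1) ^+ s = 1 by rewrite -expr2 sqrr_sign.
have key : (cf_q omega s.+1)%:~R * cf_err s + (cf_q omega s)%:~R * cf_err s.+1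
     = 1 :> R.
  have -> : cf_err s = (-1) ^+ s * ((cf_q omega s)%:~R * omega - (cf_p s)%:~R).
    by rewrite E0 mulrA sq mul1r.
  have -> : cf_err s.+1 = - ((-1) ^+ s *
       ((cf_q omega s.+1)%:~R * omega - (cf_p s.+1)%:~R)).
    by rewrite E1 exprS mulN1r mulNr mulrN opprK mulrA sq mul1r.
  transitivity (- ((-1) ^+ s * ((cf_q omega s.+1)%:~R * (cf_p s)%:~R
       - (cf_p s.+1)%:~R * (cf_q omega s)%:~R)) : R); first by ring.
  by rewrite D' exprS mulN1r mulrN opprK sq.
have /andP[q1 q2] := cf_q_mono s.
have q2' : ((cf_q omega s)%:~R <= (cf_q omega s.+1)%:~R :> R) by rewrite ler_int.
have q1' : (1 <= (cf_q omega s)%:~R :> R) by rewrite ler1z.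
have le : cf_err s.+1 <= cf_err s.
  rewrite (_ : cf_err s.+1 = cf_err s / cf_quot omega s.+2)//.
  rewrite ler_pdivrMr ?cf_quot_gt0// ler_peMr ?(ltW (cf_err_gt0 _))//.
  exact/ltW/cf_quot_gt1.
have e0 := ltW (cf_err_gt0 s); have e1 := ltW (cf_err_gt0 s.+1).
have h : (cf_q omega s)%:~R * cf_err s.+1 <= (cf_q omega s.+1)%:~R * cf_err s.
  by apply: ler_pM => //; lra.
lra.
Qed.

(** Best approximation: in the basis of two consecutive convergents, the
    coordinates of [(m, p)] have opposite signs while the errors of the
    convergents alternate in sign, so the two contributions add up. *)
Lemma cf_best (s : nat) (m p : int) : 0 < m < cf_q omega s.+1 ->
  1 <= 2 * (cf_q omega s.+1)%:~R * `|m%:~R * omega - p%:~R|.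
Proof.
move=> /andP[m0 mq].
have /andP[q1 q2] := cf_q_mono s.
suff h : cf_err s <= `|m%:~R * omega - p%:~R|.
  apply: le_trans (cf_err_lower s) _; rewrite ler_wpM2l// mulr_ge0// ler0z.
  by apply: le_trans q2; apply: le_trans q1.
pose d : int := (-1) ^+ s.+1.
have dd : d * d = 1 by rewrite /d -expr2 sqrr_sign.
have D := cf_det s.
pose al : int := d * (cf_q omega s.+1 * p - m * cf_p s.+1).
pose ga : int := d * (m * cf_p s - p * cf_q omega s).
have me : m = al * cf_q omega s + ga * cf_q omega s.+1.
  transitivity (d * (m * (cf_q omega s.+1 * cf_p s
       - cf_p s.+1 * cf_q omega s))); last by rewrite /al /ga; ring.
  by rewrite D -/d mulrCA dd mulr1.
have pe : p = al * cf_p s + ga * cf_p s.+1.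
  transitivity (d * (p * (cf_q omega s.+1 * cf_p s
       - cf_p s.+1 * cf_q omega s))); last by rewrite /al /ga; ring.
  by rewrite D -/d mulrCA dd mulr1.
clearbody al ga d.
have -> : m%:~R * omega - p%:~R =
   (-1) ^+ s * (al%:~R * cf_err s - ga%:~R * cf_err s.+1).
  rewrite {1}me {1}pe !intrD !intrM.
  transitivity (al%:~R * ((cf_q omega s)%:~R * omega - (cf_p s)%:~R) +
     ga%:~R * ((cf_q omega s.+1)%:~R * omega - (cf_p s.+1)%:~R)); first by ring.
  by rewrite !cf_errE exprS; move: ((-1) ^+ s) => e; ring.
rewrite normrM normrX normrN1 expr1n mul1r.
have t0 := cf_err_gt0 s; have t1 := cf_err_gt0 s.+1.
have [al0|al0|al0] := ltgtP al 0.
- have ga0 : 0 <= ga by nia.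
  have al1 : al%:~R <= -1 :> R by rewrite -(intrN R 1) ler_int; lia.
  have ga1 : 0 <= ga%:~R :> R by rewrite ler0z.
  have ? : 0 <= ga%:~R * cf_err s.+1 by rewrite mulr_ge0// ltW.
  have ? : al%:~R * cf_err s <= - cf_err s by nra.
  rewrite ler0_norm; lra.
- have ga0 : ga <= 0 by nia.
  have al1 : 1 <= al%:~R :> R by rewrite ler1z; lia.
  have ga1 : ga%:~R <= 0 :> R by rewrite lerz0.
  have ? : ga%:~R * cf_err s.+1 <= 0 by rewrite mulr_le0_ge0// ltW.
  have ? : cf_err s <= al%:~R * cf_err s by nra.
  rewrite ger0_norm; lra.
- exfalso; rewrite al0 mul0r add0r in me.
  have Q0 : 0 < cf_q omega s.+1 by lia.
  move: m0; rewrite me pmulr_lgt0// => ga0.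
  by move: mq; rewrite me -[ltRHS]mul1r ltr_pM2r//; lia.
Qed.

(** One of [q_1], [q_2] is at least [2], so that [beta omega >= ln 2] for every
    [omega]: the assumption [beta omega < c_va * delta] forces [delta] to exceed
    [ln 2 / c_va], and only large deviations are at stake. *)
Lemma beta_cf_q (c : R) : (beta omega < c%:E)%E ->
  exists b : R, [/\ ln 2 <= b, b < c &
    forall s, ln (cf_q omega s.+1)%:~R <= b * (cf_q omega s)%:~R].
Proof.
move=> /ereal_inf_lt[_ [b hb <-]]; rewrite lte_fin => bc.
exists b; split=> //.
have h0 := hb 0; have h1 := hb 1.
rewrite [cf_q omega 0]/= mulr1 in h0.
have /andP[q0 q1] := cf_q_mono 1.
have ln2 s : 2 <= cf_q omega s -> ln 2 <= ln ((cf_q omega s)%:~R : R).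
  move=> h; have h' : (2 : R) <= (cf_q omega s)%:~R.
    by rewrite (_ : 2 = 2%:~R)// ler_int.
  by rewrite ler_ln ?posrE//; apply: lt_le_trans h'.
have [e|ne] := eqVneq (cf_q omega 1) 1.
  by rewrite e mulr1 in h1; apply: le_trans h1; apply/ln2/(cf_q_ge 2).
apply: le_trans h0; apply: ln2.
by move: q0 ne; move: (cf_q omega 1) => k; lia.
Qed.

End ContinuedFractions.

(** * Products of distances along the orbit of 0 *)

(** Distance to the nearest integer. *)
Definition circle_dist (R : realType) (x : R) : R :=
  `|x - (Num.floor (x + 2^-1))%:~R|.

Lemma nearest_itv (R : realType) (x : R) :
  - 2^-1 <= x - (Num.floor (x + 2^-1))%:~R < 2^-1.
Proof.
have /andP[h1 h2] := floor_itv (x + 2^-1); rewrite intrD in h2.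
by apply/andP; split; lra.
Qed.

Lemma circle_dist_le (R : realType) (x : R) (k : int) :
  circle_dist x <= `|x - k%:~R|.
Proof.
rewrite /circle_dist; have := nearest_itv x.
set j := Num.floor _ => /andP[h1 h2].
have h : `|x - j%:~R| <= 2^-1 by rewrite ler_norml; apply/andP; split; lra.
have [->//|ne] := eqVneq k j.
have : 1 <= `|(j - k)%:~R : R|.
  by rewrite -intr_norm ler1z; move: ne; lia.
rewrite intrB => h3.
have -> : x - k%:~R = (x - j%:~R) + (j%:~R - k%:~R) by ring.
have := lerB_normD (j%:~R - k%:~R) (x - j%:~R).
rewrite [_ + (x - j%:~R)]addrC; lra.
Qed.

(** Values in [0, 1] taken at distinct places: the missing factors only decrease
    the full product. *)
Lemma prod_le_inj (R : realType) (I J : finType) (A : {pred I}) (h : I -> J)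
    (g : J -> R) :
  {in A &, injective h} -> (forall j, 0 <= g j <= 1) ->
  \prod_j g j <= \prod_(i in A) g (h i).
Proof.
move=> hi g01.
rewrite -[leRHS](big_imset (fun j => g j) hi).
rewrite [leLHS](bigID (mem (imset h (mem A))))/= -[leRHS]mulr1.
apply: ler_pM.
- by apply: prodr_ge0 => j _; case/andP: (g01 j).
- by apply: prodr_ge0 => j _; case/andP: (g01 j).
- by [].
- by apply: Num.Theory.prodr_ile1.
Qed.

Lemma fact_lower (R : realType) (n : nat) :
  n%:R ^+ n <= n`!%:R * expR n%:R :> R.
Proof.
elim: n => [|n IH]; first by rewrite expr0 fact0 mul1r expR0.
rewrite factS natrM exprS -mulrA ler_wpM2l//.
have [->|n0] := posnP n; first by rewrite expr0 fact0 mul1r -expR0 ler_expR.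
apply: (@le_trans _ _ (n%:R ^+ n * expR 1)); last first.
  by rewrite -(natr1 n) expRD mulrA ler_pM2r ?expR_gt0.
have n0' : 0 < n%:R :> R by rewrite ltr0n.
have -> : n.+1%:R = n%:R * (1 + n%:R^-1) :> R.
  by rewrite mulrDr mulr1 divff ?gt_eqF// natr1.
rewrite exprMn ler_wpM2l ?exprn_ge0//.
apply: (@le_trans _ _ (expR n%:R^-1 ^+ n)).
  by rewrite lerXn2r ?nnegrE ?expR_ge0 ?addr_ge0 ?invr_ge0// expR_ge1Dx.
by rewrite -expRM_natl divff// gt_eqF.
Qed.

Lemma expR1_le4 (R : realType) : expR 1 <= 4 :> R.
Proof.
have h : 2^-1 <= expR (- 2^-1) :> R by have := expR_ge1Dx (- 2^-1 : R); lra.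
have h' : expR (2^-1) <= 2 :> R.
  by rewrite -[leLHS]invrK -expRN -[leRHS]invrK lef_pV2 ?posrE ?expR_gt0 ?invr_gt0.
have -> : (1 : R) = 2^-1 + 2^-1 by lra.
by rewrite expRD; have := expR_ge0 (2^-1 : R); nra.
Qed.

Lemma fact_ratio_lower (R : realType) (q : nat) : (0 < q)%N ->
  8^-1 ^+ q <= q`!%:R / (2 * q%:R) ^+ q :> R.
Proof.
move=> q0; have q0' : 0 < q%:R :> R by rewrite ltr0n.
rewrite ler_pdivlMr ?exprn_gt0 ?mulr_gt0// -exprMn.
have -> : 8^-1 * (2 * q%:R) = q%:R * 4^-1 :> R by field.
rewrite exprMn exprVn ler_pdivrMr ?exprn_gt0//.
apply: le_trans (fact_lower R q) _; rewrite ler_wpM2l//.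
rewrite -[q%:R]mulr1 expRM_natl lerXn2r ?nnegrE ?expR_ge0//.
exact: expR1_le4.
Qed.

Section Blocks.
Variables (R : realType) (omega : R).
Let y (m : nat) : R :=
  m%:R * omega - (Num.floor (m%:R * omega + 2^-1))%:~R.

(** The points [m omega] with [m] in a block of length [q] are
    [1/(2q)]-separated on the circle, so at most one of them on either side of
    [0] lies at a distance between [j/(2q)] and [(j+1)/(2q)] from [0]. *)
Lemma prod_block (q c r : nat) (tau : R) : (0 < q)%N -> (r <= q)%N ->
  0 < tau <= 1 ->
  (forall (m : nat) (k : int), (0 < m < q)%N ->
     1 <= 2 * q%:R * `|m%:R * omega - k%:~R|) ->
  (forall i : 'I_r, tau <= circle_dist ((c + i)%:R * omega)) ->
  (tau * 8^-1 ^+ q) ^+ 2 <= \prod_(i < r) circle_dist ((c + i)%:R * omega).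
Proof.
case: q => // q _ rq /andP[t0 t1] sep low.
have q0 : 0 < q.+1%:R :> R by rewrite ltr0n.
pose z (i : 'I_r) := Num.floor (2 * q.+1%:R * y (c + i)).
have zitv i : (z i)%:~R <= 2 * q.+1%:R * y (c + i) < (z i)%:~R + 1.
  by have := floor_itv (2 * q.+1%:R * y (c + i)); rewrite intrD.
have yitv i : - q.+1%:R <= 2 * q.+1%:R * y (c + i) < q.+1%:R.
  have /andP[h1 h2] := nearest_itv ((c + i)%:R * omega).
  by apply/andP; rewrite -/(y _) in h1 h2 *; split; nra.
have zinj i j : z i = z j -> i = j.
  move=> e; apply/eqP; apply: contraT => ne.
  wlog lt : i j e ne / (j < i)%N.
    move=> W; have [?|?|/val_inj ?] := ltngtP i j.
    - by apply: (W j i) => //; rewrite eq_sym.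
    - exact: (W i j).
    - by subst; rewrite eqxx in ne.
  have h : `|2 * q.+1%:R * y (c + i) - 2 * q.+1%:R * y (c + j)| < 1.
    have := zitv i; have := zitv j; rewrite e => /andP[? ?] /andP[? ?].
    by rewrite ltr_norml; apply/andP; split; lra.
  move: h; rewrite -mulrBr normrM ger0_norm; last by rewrite mulr_ge0.
  pose k := Num.floor ((c + i)%:R * omega + 2^-1)
            - Num.floor ((c + j)%:R * omega + 2^-1).
  have -> : y (c + i) - y (c + j) = (i - j)%:R * omega - k%:~R.
    by rewrite /y /k intrB natrB 1?ltnW// !natrD; ring.
  rewrite ltNge sep//; apply/andP; split; first by rewrite subn_gt0.
  have := ltn_ord i; lia.
pose g (j : 'I_q.+1) : R := if (j : nat) == 0%N then tau else j%:R / (2 * q.+1%:R).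
have g01 j : 0 <= g j <= 1.
  rewrite /g; case: ifP => _; first by rewrite ltW.
  rewrite divr_ge0 ?mulr_ge0//= ler_pdivrMr ?mulr_gt0// mul1r.
  have : j%:R <= q.+1%:R :> R by rewrite ler_nat ltnW.
  lra.
have gprod : tau * 8^-1 ^+ q.+1 <= \prod_j g j.
  rewrite big_ord_recl /g eqxx ler_pM2l//.
  apply: le_trans (@fact_ratio_lower R q.+1 isT) _.
  under eq_bigr do rewrite lift0 /=.
  rewrite big_split/= prodr_const card_ord.
  have -> : \prod_(i < q) i.+1%:R = q`!%:R :> R.
    elim: (q) => [|n IH]; first by rewrite big_ord0.
    by rewrite big_ord_recr/= IH factS mulnC natrM.
  rewrite factS natrM exprS invfM -exprVn mulrACA ler_piMl//.
  by rewrite ler_pdivrMr ?mulr_gt0// mul1r; lra.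
have dE i : circle_dist ((c + i)%:R * omega) = `|y (c + i)| by [].
rewrite expr2 (bigID (fun i : 'I_r => 0 <= y (c + i)))/=.
have X0 : 0 <= tau * 8^-1 ^+ q.+1 by rewrite mulr_ge0 ?exprn_ge0// ltW.
apply: ler_pM => //; apply: (le_trans gprod).
- pose h (i : 'I_r) : 'I_q.+1 := inord (absz (z i)).
  pose A := [pred i : 'I_r | 0 <= y (c + i)].
  have zA i : i \in A -> 0 <= z i < q.+1.
    rewrite inE => yi; rewrite floor_ge0 mulr_ge0 ?mulr_ge0//=.
    have /andP[_ h1] := yitv i; have /andP[h2 _] := zitv i.
    have : (z i)%:~R < (q.+1%:Z)%:~R :> R by apply: le_lt_trans h1.
    by rewrite ltr_int.
  have hz i : i \in A -> Posz (h i) = z i.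
    by move=> /zA/andP[h1 h2]; rewrite /h inordK; lia.
  apply: (@le_trans _ _ (\prod_(i in A) g (h i))).
    apply: prod_le_inj => // i j iA jA e; apply: zinj.
    by rewrite -!hz// e.
  apply: ler_prod => i iA; case/andP: (g01 (h i)) => -> _ /=.
  rewrite /g; case: ifP => [_|_]; first exact: low.
  rewrite dE ger0_norm// ler_pdivrMr ?mulr_gt0// mulrC.
  have /andP[+ _] := zitv i; rewrite -hz//.
- pose h (i : 'I_r) : 'I_q.+1 := inord (absz (z i + 1)).
  pose A := [pred i : 'I_r | ~~ (0 <= y (c + i))].
  have zA i : i \in A -> - q.+1%:Z <= z i < 0.
    rewrite inE -ltNge => yi; apply/andP; split.
      rewrite floor_ge_int intrN; by case/andP: (yitv i).
    rewrite -(ltr_int R); have /andP[h2 _] := zitv i.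
    by apply: le_lt_trans h2 _; rewrite nmulr_llt0// mulr_gt0.
  have hz i : i \in A -> Posz (h i) = - (z i + 1).
    by move=> /zA/andP[h1 h2]; rewrite /h inordK; lia.
  apply: (@le_trans _ _ (\prod_(i in A) g (h i))).
    apply: prod_le_inj => // i j iA jA e; apply: zinj.
    by apply: (addIr 1); apply: oppr_inj; rewrite -!hz// e.
  apply: ler_prod => i iA; case/andP: (g01 (h i)) => -> _ /=.
  rewrite /g; case: ifP => [_|_]; first exact: low.
  have yi : y (c + i) < 0 by move: iA; rewrite inE -ltNge.
  rewrite dE ltr0_norm// ler_pdivrMr ?mulr_gt0//.
  have /andP[_ h2] := zitv i.
  have : (h i)%:R = - ((z i)%:~R + 1) :> R.
    by rewrite -[LHS]/((Posz (h i))%:~R) hz// intrN intrD.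
  lra.
Qed.

Lemma prod_blocks (d : nat -> R) (q N : nat) (X : R) :
  0 <= X <= 1 ->
  (forall c r, (r <= q)%N -> (c + r <= N)%N ->
     X <= \prod_(i < r) d (c + i)%N) ->
  forall B n, (n <= N)%N -> (n <= B * q)%N -> X ^+ B <= \prod_(i < n) d i.
Proof.
move=> /andP[X0 X1] H; elim=> [|B IH] n nN.
  by rewrite mul0n leqn0 => /eqP ->; rewrite big_ord0.
have [nB _|nB] := leqP n (B * q)%N.
  by apply: le_trans (IH n nN nB); rewrite ler_wiXn2l// X0.
rewrite mulSn => nq.
have -> : n = (B * q + (n - B * q))%N by rewrite subnKC// ltnW.
rewrite big_split_ord/= exprSr.
apply: ler_pM => //; first by rewrite exprn_ge0.
  by apply: IH => //; lia.
by apply: H; lia.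
Qed.

End Blocks.

(** If [q_s <= N < q_(s+1)], each of the at most [2 N / q_s] blocks of length
    [q_s] loses a factor [exp (- 2 ln q_(s+1))], which the hypothesis bounds by
    [exp (- 2 b q_s)]: the total loss is exponential in [N]. *)
Lemma prod_circle_dist (R : realType) (omega b : R) (N : nat) :
  irrational omega -> ln 2 <= b ->
  (forall s, ln (cf_q omega s.+1)%:~R <= b * (cf_q omega s)%:~R) ->
  expR (- (20 * b) * N%:R) <= \prod_(i < N) circle_dist (i.+1%:R * omega).
Proof.
move=> oi b2 hb.
have [->|N0] := posnP N; first by rewrite big_ord0 mulr0 expR0.
have [t] := @ex_minnP (fun t => N%:Z < cf_q omega t)
  (ex_intro _ N.+1 (cf_q_ge oi N.+1)).
case: t => [|s] Nt tmin.
  by move: Nt; rewrite [cf_q _ _]/= ltz_nat ltnS leqn0 => /eqP e; rewrite e in N0.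
have qN : cf_q omega s <= N%:Z.
  by rewrite leNgt; apply/negP => /tmin; rewrite ltnn.
have /andP[q1 q2] := cf_q_mono oi s.
set q := `|cf_q omega s|%N.
have qE : cf_q omega s = q%:Z by rewrite /q; lia.
have qR : (cf_q omega s)%:~R = q%:R :> R by rewrite qE.
have q0 : (0 < q)%N by rewrite /q; lia.
have b0 : 0 < b by apply: lt_le_trans b2; rewrite ln_gt0// ltr1n.
set Q : R := (cf_q omega s.+1)%:~R.
have Q1 : 1 <= Q by rewrite ler1z; lia.
have QQ : Q <= expR (b * q%:R).
  by rewrite -[Q]lnK ?posrE ?(lt_le_trans _ Q1)// ler_expR -qR; exact: hb.
pose tau := (2 * Q)^-1.
have tau01 : 0 < tau <= 1.
  by rewrite invr_gt0 mulr_gt0 ?(lt_le_trans _ Q1)//= invf_le1 ?mulr_gt0//; lra.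
have X01 : 0 <= (tau * 8^-1 ^+ q) ^+ 2 <= 1.
  rewrite sqr_ge0/= expr_le1//; last by case/andP: tau01 => *; rewrite mulr_ge0 ?exprn_ge0// ltW.
  case/andP: tau01 => /ltW ? ?; rewrite mulr_ile1// ?exprn_ge0//.
  by rewrite exprn_ile1//; lra.
have lowm (m : nat) : (0 < m <= N)%N -> tau <= circle_dist (m%:R * omega).
  move=> /andP[m0 mN]; have hm : 0 < m%:Z < cf_q omega s.+1 by lia.
  have := cf_best oi (Num.floor (m%:R * omega + 2^-1)) hm.
  rewrite -/Q -/(circle_dist _) => h.
  by rewrite /tau -[(2 * Q)^-1]mul1r ler_pdivrMr ?mulr_gt0 ?(lt_le_trans _ Q1)// mulrC.
have sep (m : nat) (k : int) : (0 < m < q)%N ->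
    1 <= 2 * q%:R * `|m%:R * omega - k%:~R|.
  move=> /andP[m0 mq]; rewrite -qR.
  have [e|e] := posnP s; first by move: m0 mq; rewrite /q e; case: (m).
  have := @cf_best R omega oi s.-1 m k; rewrite prednK//; apply.
  by rewrite qE; lia.
have block c r : (r <= q)%N -> (c + r <= N)%N ->
    (tau * 8^-1 ^+ q) ^+ 2 <= \prod_(i < r) circle_dist ((c + i).+1%:R * omega).
  move=> rq crN.
  apply: le_trans (@prod_block R omega q c.+1 r tau q0 rq tau01 sep _) _.
    by move=> i; apply: lowm; have := ltn_ord i; lia.
  by under eq_bigr do rewrite addSn.
pose B := (N %/ q).+1.
have NB : (N <= B * q)%N by rewrite ltnW// ltn_ceil.
have := @prod_blocks R (fun i => circle_dist (i.+1%:R * omega)) q N _ X01 block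
  B N (leqnn N) NB.
apply: le_trans.
have BN : (B * q <= 2 * N)%N.
  have : (q <= N)%N by lia.
  have := leq_trunc_div N q; rewrite /B mulSn; lia.
apply: (@le_trans _ _ ((expR (- (10 * b * q%:R))) ^+ B)).
  rewrite -expRM_natl ler_expR.
  have : (B * q)%:R <= (2 * N)%:R :> R by rewrite ler_nat.
  rewrite !natrM; nra.
rewrite lerXn2r ?nnegrE ?expR_ge0//; first by case/andP: X01.
have half : 2^-1 = expR (- ln 2) :> R by rewrite expRN lnK// posrE.
have e8 : 8^-1 = expR (- (3 * ln 2)) :> R.
  have -> : 8^-1 = 2^-1 ^+ 3 :> R by field.
  by rewrite half -expRM_natl; congr expR; ring.
have tl : expR (- ln 2 - b * q%:R) <= tau.
  rewrite /tau invfM expRD -half ler_wpM2l// expRN lef_pV2 ?posrE ?expR_gt0//.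
  exact: lt_le_trans Q1.
apply: (@le_trans _ _ ((expR (- ln 2 - b * q%:R) * 8^-1 ^+ q) ^+ 2)); last first.
  rewrite lerXn2r ?nnegrE ?mulr_ge0 ?expR_ge0 ?exprn_ge0//; last by rewrite ler_wpM2r ?exprn_ge0.
  by case/andP: tau01 => /ltW.
rewrite e8 -expRM_natl -expRD -expRM_natl ler_expR.
have : 1 <= q%:R :> R by rewrite ler1n.
have : 0 < ln 2 :> R by rewrite ln_gt0// ltr1n.
nra.
Qed.

(** * Coefficient norms of polynomials and interpolation *)

Section NormC.
Variable R : realType.
Implicit Types z w : R[i].

Lemma normc_ge0 z : 0 <= normc z.
Proof. by case: z => x y; exact: sqrtr_ge0. Qed.

Lemma normr_normc z : `|z| = (normc z)%:C.
Proof. by rewrite normc_def; case: z. Qed.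

Lemma normcB z w : normc (z - w) = normc (w - z).
Proof. by rewrite -normcN opprB. Qed.

Lemma normc_real (x : R) : normc x%:C = `|x|.
Proof. by rewrite /normc/= expr0n addr0 sqrtr_sqr. Qed.

Lemma normc_conj z : normc (conjc z) = normc z.
Proof. by case: z => x y; rewrite /normc/= sqrrN. Qed.

Lemma normc_eq0 z : (normc z == 0) = (z == 0).
Proof. by apply/eqP/eqP => [/eq0_normc//|->]; rewrite normc0. Qed.

Lemma normcX z n : normc (z ^+ n) = normc z ^+ n.
Proof. by elim: n => [|n IH]; rewrite ?normc1// !exprS normcM IH. Qed.

Lemma normc_prod (I : Type) (s : seq I) (P : pred I) (F : I -> R[i]) :
  normc (\prod_(i <- s | P i) F i) = \prod_(i <- s | P i) normc (F i).
Proof. by apply: (big_morph (@normc R)); [exact: normcM|exact: normc1]. Qed.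

Lemma normc_sum (I : Type) (s : seq I) (P : pred I) (F : I -> R[i]) :
  normc (\sum_(i <- s | P i) F i) <= \sum_(i <- s | P i) normc (F i).
Proof.
elim/big_ind2: _ => [|a b c d h1 h2|//]; first by rewrite normc0.
by apply: le_trans (le_normcD _ _) _; exact: lerD.
Qed.

Lemma normcB_lower z w : normc z - normc w <= normc (z + w).
Proof.
rewrite lerBlDr -{1}[z](addrK w).
by apply: le_trans (le_normcD _ _) _; rewrite normcN.
Qed.

End NormC.

Section CoefNorm.
Variable R : realType.
Implicit Types (rho : R) (p q : {poly R[i]}).

(** The weighted [l^1] norm of the coefficients dominates the sup norm on the
    disc of radius [rho], is submultiplicative, and is well behaved under
    recentring and under division by [X - x]. *)
Definition coef_norm rho p : R := \sum_(i < size p) normc p`_i * rho ^+ i.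

Lemma coef_normE n rho p : (size p <= n)%N ->
  coef_norm rho p = \sum_(i < n) normc p`_i * rho ^+ i.
Proof.
move=> pn; rewrite /coef_norm (big_ord_widen_cond _ xpredT
  (fun i => normc p`_i * rho ^+ i) pn) big_mkcond/=.
apply: eq_bigr => i _; case: ifPn => //; rewrite -leqNgt => h.
by rewrite nth_default// normc0 mul0r.
Qed.

Lemma coef_norm_ge0 rho p : 0 <= rho -> 0 <= coef_norm rho p.
Proof.
by move=> r0; apply: sumr_ge0 => i _; rewrite mulr_ge0 ?normc_ge0 ?exprn_ge0.
Qed.

Lemma coef_norm0 rho : coef_norm rho 0 = 0.
Proof. by rewrite /coef_norm size_poly0 big_ord0. Qed.

Lemma coef_norm_cons rho p c :
  coef_norm rho (p * 'X + c%:P) = coef_norm rho p * rho + normc c.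
Proof.
rewrite (@coef_normE (size p).+1); last first.
  apply: leq_trans (size_polyD _ _) _; rewrite geq_max; apply/andP; split.
    apply: leq_trans (size_polyMleq _ _) _.
    by rewrite size_polyX addn2.
  by rewrite size_polyC; case: (c == 0).
rewrite big_ord_recl/= coefD coefMX coefC/= add0r expr0 mulr1 addrC.
congr (_ + _); rewrite /coef_norm mulr_suml; apply: eq_bigr => i _.
by rewrite coefD coefMX coefC /= addr0 exprSr mulrA.
Qed.

Lemma coef_normC rho c : coef_norm rho c%:P = normc c.
Proof.
have := coef_norm_cons rho 0 c.
by rewrite mul0r add0r coef_norm0 mul0r add0r.
Qed.

Lemma coef_normD rho p q : 0 <= rho ->
  coef_norm rho (p + q) <= coef_norm rho p + coef_norm rho q.
Proof.
move=> r0; pose n := maxn (size p) (size q).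
rewrite (@coef_normE n) ?size_polyD// (@coef_normE n rho p) ?leq_maxl//.
rewrite (@coef_normE n rho q) ?leq_maxr// -big_split/=; apply: ler_sum => i _.
by rewrite coefD -mulrDl ler_wpM2r ?exprn_ge0// le_normcD.
Qed.

Lemma coef_normZ rho c p : coef_norm rho (c *: p) = normc c * coef_norm rho p.
Proof.
rewrite (@coef_normE (size p)) ?size_scale_leq// /coef_norm mulr_sumr.
by apply: eq_bigr => i _; rewrite coefZ normcM mulrA.
Qed.

Lemma coef_normMX rho p : coef_norm rho (p * 'X) = coef_norm rho p * rho.
Proof. by have := coef_norm_cons rho p 0; rewrite !addr0 normc0 addr0. Qed.

Lemma coef_normM rho p q : 0 <= rho ->
  coef_norm rho (p * q) <= coef_norm rho p * coef_norm rho q.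
Proof.
move=> r0; elim/poly_ind: p => [|p c IH].
  by rewrite mul0r coef_norm0 mul0r.
rewrite coef_norm_cons mulrDl -mulrA ['X * q]mulrC mulrA mul_polyC.
apply: le_trans (coef_normD _ _ r0) _.
rewrite coef_normMX coef_normZ mulrDl lerD2r mulrAC ler_wpM2r//.
Qed.

Lemma horner_le_coef_norm rho p x : normc x <= rho ->
  normc p.[x] <= coef_norm rho p.
Proof.
move=> xr; elim/poly_ind: p => [|p c IH].
  by rewrite horner0 normc0 coef_norm0.
rewrite coef_norm_cons hornerD hornerMX hornerC.
apply: le_trans (le_normcD _ _) _; rewrite normcM lerD2r.
by apply: ler_pM => //; exact: normc_ge0.
Qed.

Lemma coef_norm_mono r rho p : 0 <= r <= rho ->
  coef_norm r p <= coef_norm rho p.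
Proof.
move=> /andP[r0 rr]; apply: ler_sum => i _; rewrite ler_wpM2l ?normc_ge0//.
by rewrite lerXn2r ?nnegrE// (le_trans r0).
Qed.

Lemma coef_norm_shift rho p h : 0 <= rho ->
  coef_norm rho (p \Po ('X + h%:P)) <= coef_norm (rho + normc h) p.
Proof.
move=> r0; elim/poly_ind: p => [|p c IH].
  by rewrite comp_poly0 !coef_norm0.
rewrite comp_polyD comp_polyM comp_polyX comp_polyC coef_norm_cons.
apply: le_trans (coef_normD _ _ r0) _; rewrite coef_normC lerD2r.
apply: le_trans (coef_normM _ _ r0) _.
have -> : coef_norm rho ('X + h%:P) = rho + normc h.
  by have := coef_norm_cons rho 1 h; rewrite -polyC1 coef_normC normc1 !mul1r.
by rewrite ler_wpM2r// addr_ge0 ?normc_ge0.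
Qed.

Lemma coef_norm_conj rho p : coef_norm rho (map_poly conjc p) = coef_norm rho p.
Proof.
rewrite (@coef_normE (size p)) ?size_poly//; apply: eq_bigr => i _.
by rewrite coef_map/= normc_conj.
Qed.

(** Writing [p = p' X + c], the quotient of [p] by [X - x] is [X] times that of
    [p'], plus [p'(x)]; the term [coef_norm r p] on the right absorbs the
    latter in the induction. *)
Lemma coef_norm_div r rho p x : normc x <= r -> r <= rho ->
  exists q, p = q * ('X - x%:P) + (p.[x])%:P /\
    (rho - r) * coef_norm rho q <= coef_norm rho p - coef_norm r p.
Proof.
move=> xr rr; elim/poly_ind: p => [|p c [q [pE IH]]].
  by exists 0; rewrite mul0r add0r horner0 !coef_norm0 mulr0 subr0.
exists (q * 'X + (p.[x])%:P); split.
  rewrite hornerD hornerMX hornerC {1}pE polyCD polyCM; ring.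
rewrite !coef_norm_cons.
have h1 := horner_le_coef_norm p xr.
have x0 := normc_ge0 x.
have : (rho - r) * (coef_norm rho q * rho + normc p.[x]) <=
   rho * (coef_norm rho p - coef_norm r p) + (rho - r) * coef_norm r p.
  rewrite mulrDr lerD//; last by rewrite ler_wpM2l// subr_ge0.
  by rewrite mulrA mulrC ler_wpM2l//; lra.
move=> /le_trans; apply; rewrite le_eqVlt; apply/orP; left; apply/eqP; ring.
Qed.

Lemma coef_norm_div_seq r rho p (s : seq R[i]) : 0 <= r -> r < rho ->
  (forall x, x \in s -> normc x <= r) ->
  exists q u, [/\ p = q * \prod_(x <- s) ('X - x%:P) + u,
    (size u <= size s)%N &
    (rho - r) ^+ size s * coef_norm rho q <= coef_norm rho p].
Proof.
move=> r0 rr; elim: s => [|x s IH] hs.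
  exists p, 0; split; first by rewrite big_nil mulr1 addr0.
    by rewrite size_poly0.
  by rewrite expr0 mul1r.
have [|q [u [pE us qn]]] := IH; first by move=> y ys; rewrite hs// inE ys orbT.
have [|q' [qE qn']] := @coef_norm_div r rho q x _ (ltW rr).
  by rewrite hs// mem_head.
set Q := \prod_(y <- s) _ in pE.
have sQ : size Q = (size s).+1 by rewrite size_prod_XsubC.
exists q', (q.[x] *: Q + u); split.
- rewrite big_cons -/Q {1}pE {1}qE -mul_polyC; ring.
- apply: leq_trans (size_polyD _ _) _; rewrite geq_max (leq_trans us)//= andbT.
  by apply: leq_trans (size_scale_leq _ _) _; rewrite sQ.
- apply: le_trans qn; rewrite /= exprSr -mulrA ler_wpM2l//.
    by rewrite exprn_ge0// subr_ge0 ltW.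
  by apply: le_trans qn' _; rewrite gerBl coef_norm_ge0.
Qed.

End CoefNorm.

Section Interpolation.
Variables (R : realType) (I : finType) (S : {set I}) (x : I -> R[i]).
Hypothesis xinj : {in S &, injective x}.

Lemma lagrange (p : {poly R[i]}) (z : R[i]) : (size p <= #|S|)%N ->
  p.[z] = \sum_(i in S) p.[x i] *
    \prod_(j in S | j != i) ((z - x j) / (x i - x j)).
Proof.
move=> ps.
pose L := \sum_(i in S) (p.[x i] *
    \prod_(j in S | j != i) (x i - x j)^-1) *: \prod_(j in S | j != i) ('X - (x j)%:P).
have LE y : L.[y] = \sum_(i in S) p.[x i] *
    \prod_(j in S | j != i) ((y - x j) / (x i - x j)).
  rewrite horner_sum; apply: eq_bigr => i _.
  rewrite hornerZ horner_prod -mulrA; congr (_ * _).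
  rewrite big_split/= mulrC; congr (_ * _); apply: eq_bigr => j _.
  by rewrite hornerD hornerX hornerN hornerC.
rewrite -LE; congr (_.[z]); apply/eqP; rewrite -subr_eq0; apply/eqP.
apply: (@roots_geq_poly_eq0 _ _ [seq x i | i <- enum S]).
- apply/allP => _ /mapP[i + ->]; rewrite mem_enum => iS.
  rewrite /root hornerD hornerN LE (bigD1 i)//= [X in - (_ + X)]big1 ?addr0.
    rewrite big1 ?mulr1 ?subrr// => j /andP[jS ji].
    rewrite divff// subr_eq0; apply: contra ji => /eqP e.
    by apply/eqP; apply: xinj.
  move=> k /andP[kS ki]; rewrite (bigD1 i)/=; last by rewrite iS eq_sym.
  by rewrite subrr mul0r mul0r mulr0.
- rewrite map_inj_in_uniq ?enum_uniq// => i j.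
  by rewrite !mem_enum; exact: xinj.
- rewrite size_map -cardE.
  apply: leq_trans (size_polyD _ _) _; rewrite geq_max ps size_polyN/=.
  apply: leq_trans (size_sum _ _ _) _; apply/bigmax_leqP => i iS.
  apply: leq_trans (size_scale_leq _ _) _.
  rewrite -big_filter size_prod_XsubC size_filter -sum1_count.
  rewrite -sum1_card (bigD1 i iS)/= add1n ltnS.
  by apply: eq_leq; apply: eq_bigl => j; rewrite andbC.
Qed.

(** Interpolation at [d] nodes of a polynomial that is bounded on a large disc:
    the remainder decays like [4 ^- d] whatever the degree of the polynomial,
    because of the decay of its successive quotients by the [X - x i]. *)
Lemma interpolation_bound (p : {poly R[i]}) (z : R[i]) (r rho eta Delta : R) :
  0 <= r -> 0 < rho -> 10 * r <= rho -> 2 * r <= 1 ->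
  {in S, forall i, normc (x i) <= r} -> normc z <= r ->
  coef_norm rho p <= 1 ->
  {in S, forall i, normc p.[x i] <= eta} -> 0 < Delta ->
  {in S, forall i, Delta <= \prod_(j in S | j != i) normc (x i - x j)} ->
  normc p.[z] <= #|S|%:R * (eta / Delta) + 4^-1 ^+ #|S|.
Proof.
move=> r0 rho0 rrho r1 xr zr pn pe D0 De.
have rr : r < rho by lra.
have xs y : y \in [seq x i | i <- enum S] -> normc y <= r.
  by move=> /mapP[i + ->]; rewrite mem_enum; exact: xr.
have [q [u [pE us qn]]] := @coef_norm_div_seq R r rho p _ r0 rr xs.
have sS : size [seq x i | i <- enum S] = #|S| by rewrite size_map -cardE.
rewrite sS in us qn.
rewrite big_map big_enum/= in pE.
have ux : {in S, forall i, u.[x i] = p.[x i]}.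
  move=> i iS; rewrite pE hornerD hornerM horner_prod (bigD1 i)//=.
  by rewrite hornerXsubC subrr mul0r mulr0 add0r.
rewrite pE hornerD addrC; apply: le_trans (le_normcD _ _) _; apply: lerD.
  rewrite (lagrange z us); apply: le_trans (normc_sum _ _ _) _.
  rewrite mulr_natl -sumr_const; apply: ler_sum => i iS.
  rewrite normcM ux//; apply: ler_pM; rewrite ?normc_ge0 ?pe//.
  rewrite big_split/= normcM -[leRHS]mul1r; apply: ler_pM.
  - exact: normc_ge0.
  - exact: normc_ge0.
  - rewrite normc_prod; apply: Num.Theory.prodr_ile1 => j /andP[jS _].
    rewrite normc_ge0/=; apply: le_trans r1.
    apply: le_trans (le_normcD _ _) _; rewrite normcN.
    by have := xr j jS; lra.
  - rewrite normc_prod.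
    under eq_bigr do rewrite normcV.
    rewrite prodfV lef_pV2 ?posrE//; first exact: De.
    exact: lt_le_trans D0 (De i iS).
rewrite hornerM normcM horner_prod normc_prod.
have zq : normc q.[z] <= coef_norm rho q by apply: horner_le_coef_norm; lra.
have cq := coef_norm_ge0 q (ltW rho0).
apply: (@le_trans _ _ (coef_norm rho q * (4^-1 * (rho - r)) ^+ #|S|)).
  apply: ler_pM => //; first exact: normc_ge0.
    by apply: prodr_ge0 => i _; exact: normc_ge0.
  rewrite -prodr_const; apply: ler_prod => i iS.
  rewrite normc_ge0/= hornerXsubC; apply: le_trans (le_normcD _ _) _.
  by rewrite normcN; have := xr i iS; lra.
rewrite exprMn mulrCA ger_pMr ?exprn_gt0//; first by rewrite mulrC; exact: le_trans pn.
Qed.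

End Interpolation.

(** * Small sets *)

Section SmallSets.
Variable R : realType.
Implicit Types (B : set R) (tau sigma : R).

(** Smallness in outer measure, so that it applies to sets not yet known to be
    measurable. *)
Definition small B tau : Prop := exists B' : set R,
  [/\ measurable B', B `&` `[0, 1[%classic `<=` B' &
      (circle_measure R B' <= tau%:E)%E].

Lemma small_sub B1 B2 tau1 tau2 : B1 `&` `[0, 1[ `<=` B2 -> tau2 <= tau1 ->
  small B2 tau2 -> small B1 tau1.
Proof.
move=> BB tt [B' [mB B2B' h]]; exists B'; split=> //.
  by move=> x [Bx x01]; apply: B2B'; split=> //; exact: BB.
by apply: le_trans h _; rewrite lee_fin.
Qed.

Lemma small_measure B tau : measurable B -> small B tau ->
  (circle_measure R B <= tau%:E)%E.
Proof.
move=> mB [B' [mB' BB' h]]; apply: le_trans h.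
rewrite /circle_measure /= /mrestr; apply: le_measure; rewrite ?inE.
- by apply: measurableI => //; exact: measurable_itv.
- by apply: measurableI => //; exact: measurable_itv.
- by move=> x Bx; split; [exact: BB'|case: Bx].
Qed.

Lemma small_union B1 B2 tau1 tau2 : small B1 tau1 -> small B2 tau2 ->
  small (B1 `|` B2) (tau1 + tau2).
Proof.
move=> [C1 [m1 h1 l1]] [C2 [m2 h2 l2]]; exists (C1 `|` C2); split.
- exact: measurableU.
- by move=> x [[Bx|Bx] x01]; [left; exact: h1|right; exact: h2].
- have /le_trans := measureU2 (circle_measure R) m1 m2.
  by apply; rewrite EFinD; exact: leeD.
Qed.

Lemma small_bigcup (n : nat) (B : nat -> set R) tau :
  (forall i, (i < n)%N -> small (B i) tau) ->
  small [set x | exists2 i, (i < n)%N & B i x] (n%:R * tau).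
Proof.
elim: n => [|n IH] h.
  exists set0; split; first exact: measurable0.
    by move=> x [[]].
  by rewrite mul0r measure0.
rewrite -natr1 mulrDl mul1r.
apply: small_sub (lexx _) (small_union (IH _) (h n _)) => //.
  move=> x [[k +] Bx] _; rewrite ltnS leq_eqVlt => /orP[/eqP e|lt].
    by right; rewrite -e.
  by left; exists k.
by move=> i lt; apply: h; exact: ltnW.
Qed.

Lemma small_ball (c : R) sigma : 0 <= sigma ->
  small [set x | `|x - c| < sigma] (2 * sigma).
Proof.
move=> s0; have mb : measurable (ball c sigma : set R).
  by rewrite ball_itv; exact: measurable_itv.
exists (ball c sigma); split=> //.
- by move=> x [/= h _]; rewrite /ball/= distrC.
- apply: (@le_trans _ _ (lebesgue_measure (ball c sigma))); last first.
    by rewrite lebesgue_measure_ball// mulr_natl.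
  rewrite /circle_measure /= /mrestr; apply: le_measure; rewrite ?inE.
  + apply: measurableI; [exact: mb|exact: measurable_itv].
  + exact: mb.
  + by move=> x [].
Qed.

(** A maximal [sigma]-separated subset of [B] with fewer than [P] points provides
    the centres of intervals of length [2 * sigma] that cover [B]. *)
Lemma separated_or_small B sigma (P : nat) : 0 <= sigma ->
  (exists b : nat -> R, (forall i, (i < P)%N -> B (b i)) /\
     forall i j, (i < P)%N -> (j < P)%N -> i != j -> sigma <= `|b i - b j|)
  \/ small B (2 * sigma * P%:R).
Proof.
move=> s0; elim: P => [|P [[b [bB bs]]|IH]].
- by left; exists (fun=> 0).
- have [[x Bx xs]|nx] := pselect (exists2 x, B x &
    forall i, (i < P)%N -> sigma <= `|x - b i|).
    left; exists (fun i => if i == P then x else b i); split.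
      move=> i iP; case: eqVneq => // ne; apply: bB.
      by rewrite ltn_neqAle ne -ltnS.
    move=> i j; rewrite !ltnS (leq_eqVlt i) (leq_eqVlt j).
    case: eqVneq => [->|ne] /=; case: (eqVneq j P) => [->|ne'] //=.
    + by move=> _ jP _; exact: xs.
    + by move=> iP _ _; rewrite distrC; exact: xs.
    + exact: bs.
  right; apply: small_sub (small_bigcup (n := P)
      (B := fun i => [set x | `|x - b i| < sigma]) (fun i _ => small_ball (b i) s0)).
    move=> x [Bx _]; apply: contrapT => nB; apply: nx; exists x => // i iP.
    by rewrite leNgt; apply/negP => h; apply: nB; exists i.
  by rewrite mulrC ler_wpM2l ?mulr_ge0// ler_nat.
- by right; apply: small_sub IH => [x []//|]; rewrite ler_wpM2l ?mulr_ge0// ler_nat.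
Qed.

End SmallSets.

(** * Clusters of points and their translates *)

Section ClusterSeparation.
Variable R : realType.

(** Near [x], the function [F] of a real variable is a uniform limit of
    polynomials that are bounded on a complex disc and bounded below at the
    point [z] of this disc: a substitute for the analytic continuation of [F]
    to a neighbourhood of the circle. *)
Definition poly_approx (rho K : R) (z : R[i]) (eps : R) (F : R -> R[i]) (x : R)
    : Prop :=
  forall eta, 0 < eta -> exists p : {poly R[i]},
    [/\ coef_norm rho p <= K,
        forall t, `|t| <= rho -> normc (F (x + t) - p.[t%:C]) <= eta &
        eps <= normc p.[z]].

Lemma prod_dist_nat (h : nat -> R) (N k : nat) : (k <= N)%N ->
  (forall m, 0 <= h m <= 1) ->
  h 0%N * (\prod_(m < N) h m.+1) ^+ 2 <=
  \prod_(l < N.+1) h ((k - l) + (l - k))%N.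
Proof.
move=> kN h01.
have h0 m : 0 <= h m by case/andP: (h01 m).
have part n : (n <= N)%N -> \prod_(m < N) h m.+1 <= \prod_(m < n) h m.+1.
  move=> nN; rewrite -(subnKC nN) big_split_ord/= ler_piMr ?prodr_ge0//.
  by apply: Num.Theory.prodr_ile1.
have -> : \prod_(l < N.+1) h (k - l + (l - k))%N =
    \prod_(m < k) h m.+1 * (h 0%N * \prod_(m < N - k) h m.+1).
  have -> : N.+1 = (k + (N - k).+1)%N by lia.
  rewrite big_split_ord/= big_ord_recl/=; congr (_ * (_ * _)).
  - rewrite (reindex_inj rev_ord_inj)/=; apply: eq_bigr => i _.
    by congr h; have := ltn_ord i; lia.
  - by congr h; lia.
  - by apply: eq_bigr => i _; congr h; rewrite /bump/=; lia.
rewrite expr2 mulrCA ler_pM ?part ?prodr_ge0 ?mulr_ge0 ?prodr_ge0//.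
by rewrite ler_wpM2l// part// leq_subr.
Qed.

Lemma circle_dist01 (x : R) : 0 <= circle_dist x <= 2^-1.
Proof.
rewrite normr_ge0/= ler_norml; have /andP[h1 h2] := nearest_itv x.
by rewrite h1 ltW.
Qed.

Lemma circle_dist_ge_prod (omega E : R) (N m : nat) : (0 < m <= N)%N ->
  E <= \prod_(i < N) circle_dist (i.+1%:R * omega) ->
  E <= circle_dist (m%:R * omega).
Proof.
case: m => // m mN /le_trans; apply.
rewrite (bigD1 (Ordinal mN))//= ler_piMr//; first by case/andP: (circle_dist01 (m.+1%:R * omega)).
apply: Num.Theory.prodr_ile1 => i _; have /andP[-> h] := circle_dist01 (i.+1%:R * omega).
by rewrite /=; lra.
Qed.

(** The [N + 1] translates of the cluster [b] by multiples of [omega] are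
    disjoint, because the cluster is shorter than the distances between the
    translates. *)
Lemma cluster_separation (omega E sigma : R) (N P : nat) (b : nat -> R)
    (m : nat -> int) (K : {set 'I_N.+1}) :
  0 <= E -> 0 < sigma <= 1 ->
  E <= \prod_(i < N) circle_dist (i.+1%:R * omega) ->
  (forall i j, (i < P)%N -> (j < P)%N -> i != j -> sigma <= `|b i - b j|) ->
  (forall i j, (i < P)%N -> (j < P)%N -> `|b i - b j| <= E / 2) ->
  forall u : 'I_P * 'I_N.+1,
  (sigma * (2^-1 ^+ N * E) ^+ 2) ^+ P <=
  \prod_(v : 'I_P * 'I_N.+1 | (v.2 \in K) && (v != u))
    `|(b u.1 + u.2%:R * omega - (m u.2)%:~R)
      - (b v.1 + v.2%:R * omega - (m v.2)%:~R)|.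
Proof.
move=> E0 /andP[s0 s1] EN bsep bE [i k].
pose h (n : nat) : R :=
  if n is n'.+1 then circle_dist (n'.+1%:R * omega) / 2 else sigma.
have h01 n : 0 <= h n <= 1.
  case: n => [|n] /=; first by rewrite ltW.
  by have /andP[h1 h2] := circle_dist01 (n.+1%:R * omega); apply/andP; split; lra.
have hprod : sigma * (2^-1 ^+ N * E) ^+ 2 <=
    \prod_(l < N.+1) h ((k - l) + (l - k))%N.
  apply: le_trans (prod_dist_nat _ h01); last by rewrite -ltnS.
  apply: ler_wpM2l; first exact: ltW.
  rewrite lerXn2r ?nnegrE ?mulr_ge0 ?exprn_ge0 ?prodr_ge0//.
    by move=> l _; case/andP: (h01 l.+1).
  rewrite /h big_split/= prodr_const card_ord mulrC.
  by rewrite ler_wpM2r// exprn_ge0.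
apply: (@le_trans _ _ (\prod_(v : 'I_P * 'I_N.+1) h ((k - v.2) + (v.2 - k))%N)).
  rewrite -(pair_bigA _ (fun (j : 'I_P) (l : 'I_N.+1) => h ((k - l) + (l - k))%N))/=.
  rewrite prodr_const card_ord lerXn2r ?nnegrE//.
    by rewrite mulr_ge0 ?sqr_ge0// ltW.
  by apply: prodr_ge0 => l _; case/andP: (h01 (k - l + (l - k))%N).
rewrite (bigID (fun v : 'I_P * 'I_N.+1 => (v.2 \in K) && (v != (i, k))))/=.
rewrite -[leRHS]mulr1; apply: ler_pM.
- by apply: prodr_ge0 => v _; case/andP: (h01 (k - v.2 + (v.2 - k))%N).
- by apply: prodr_ge0 => v _; case/andP: (h01 (k - v.2 + (v.2 - k))%N).
- apply: ler_prod => -[j l] /andP[_ ne] /=.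
  case/andP: (h01 (k - l + (l - k))%N) => -> _ /=.
  have [e|kl] := eqVneq k l.
    rewrite e subnn /=; rewrite e in ne.
    have -> : b i + l%:R * omega - (m l)%:~R - (b j + l%:R * omega - (m l)%:~R)
      = b i - b j by ring.
    apply: bsep => //; apply: contra ne => /eqP/val_inj ->.
    by rewrite eqxx.
  set n := (k - l + (l - k))%N.
  have n0 : (0 < n <= N)%N.
    have := ltn_ord k; have := ltn_ord l; move: kl; rewrite -val_eqE /n /=.
    by move=> *; apply/andP; split; lia.
  have dn := circle_dist_ge_prod n0 EN.
  have -> : h n = circle_dist (n%:R * omega) / 2.
    by case/andP: n0; case: (n).
  have bij : `|b i - b j| <= E / 2 by exact: bE.
  suff : circle_dist (n%:R * omega) <=
     `|(b i + k%:R * omega - (m k)%:~R - (b j + l%:R * omega - (m l)%:~R)) - (b i - b j)|.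
    by have := ler_normB (b i + k%:R * omega - (m k)%:~R
        - (b j + l%:R * omega - (m l)%:~R)) (b i - b j); lra.
  have [lt|lt|e] := ltngtP k l; last by move: kl; rewrite -val_eqE/= e eqxx.
  + have -> : n = (l - k)%N by rewrite /n; lia.
    apply: le_trans (circle_dist_le _ (m l - m k)) _.
    rewrite le_eqVlt -normrN; apply/orP; left; apply/eqP; congr `|_|.
    by rewrite natrB ?(ltnW lt)// intrB; ring.
  + have -> : n = (k - l)%N by rewrite /n; lia.
    apply: le_trans (circle_dist_le _ (m k - m l)) _.
    rewrite le_eqVlt; apply/orP; left; apply/eqP; congr `|_|.
    by rewrite natrB ?(ltnW lt)// intrB; ring.
- by apply: Num.Theory.prodr_ile1 => v _; exact: h01.
Qed.

Lemma periodic1_int (T : Type) (F : R -> T) : periodic1 F ->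
  forall (x : R) (m : int), F (x - m%:~R) = F x.
Proof.
move=> Fp x m.
have Fn (n : nat) y : F (y + n%:R) = F y.
  by elim: n => [|n IH]; rewrite ?addr0// -natr1 addrA Fp.
case: m => n; first by rewrite -[in RHS](subrK n%:R x) Fn.
by rewrite NegzE intrN opprK Fn.
Qed.

Lemma pigeonhole (N W : nat) (f : 'I_N -> 'I_W) : (0 < W)%N ->
  exists w, (N <= W * #|[set k | f k == w]%SET|)%N.
Proof.
move=> W0; apply: contrapT => nex.
have lt w : (W * #|[set k | f k == w]%SET| < N)%N.
  by rewrite ltnNge; apply/negP => h; apply: nex; exists w.
have e : (\sum_(w < W) #|[set k | f k == w]%SET|)%N = N.
  rewrite -[RHS]card_ord -sum1_card (partition_big f xpredT)//=.
  by apply: eq_bigr => w _; rewrite -sum1_card; apply: eq_bigl => k; rewrite inE.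
have : (W * N < W * N)%N; last by rewrite ltnn.
rewrite -{1}e big_distrr/=.
apply: (@leq_trans (\sum_(w < W) N)%N); last by rewrite sum_nat_const card_ord mulnC.
have : (\sum_(w < W) (W * #|[set k | f k == w]%SET|).+1 <= \sum_(w < W) N)%N.
  by apply: leq_sum => w _; exact: lt.
apply: leq_trans; under [X in (_ <= X)%N]eq_bigr do rewrite -addn1.
by rewrite big_split/= sum_nat_const card_ord muln1 -addn1 leq_add2l.
Qed.

End ClusterSeparation.

(** * Recurrence to small values of an analytic function *)

Section SmallRecurrence.
Variable R : realType.

(** If [F] is small at all translates of a cluster of [P] points, interpolate
    it at those translates that fall into a common window of length [1/W]; there
    are [d] of them. *)
Lemma cluster_bound (A rho E sigma eta eps omega : R) (W N P : nat) (z : R[i])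
    (F : R -> R[i]) (b : nat -> R) :
  1 <= A -> A^-1 <= rho <= 1 -> normc z <= rho / 10 -> 20 * A <= W%:R ->
  0 < eta -> 0 < E -> 0 < sigma <= 1 ->
  E <= \prod_(i < N) circle_dist (i.+1%:R * omega) ->
  (0 < P)%N ->
  (forall i j, (i < P)%N -> (j < P)%N -> i != j -> sigma <= `|b i - b j|) ->
  (forall i j, (i < P)%N -> (j < P)%N -> `|b i - b j| <= E / 2) ->
  (forall i j, (i < P)%N -> (j < P)%N -> `|b i - b j| <= W%:R^-1) ->
  periodic1 F -> (forall x, poly_approx rho 1 z eps F x) ->
  (forall i k, (i < P)%N -> (k <= N)%N -> normc (F (b i + k%:R * omega)) <= eta) ->
  exists d : nat, [/\ (P * N.+1 <= W * d)%N, (d <= P * N.+1)%N &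
    eps <= d%:R * (2 * eta / (sigma * (2^-1 ^+ N * E) ^+ 2) ^+ P) + 4^-1 ^+ d].
Proof.
move=> A1 /andP[rA r1] zr WA eta0 E0 s01 EN P0 bsep bE bW Fp Fa Fsmall.
have W0' : 0 < W%:R :> R by apply: lt_le_trans WA; rewrite mulr_gt0// (lt_le_trans _ A1).
have W0 : (0 < W)%N by rewrite -(ltr0n R).
have rho0 : 0 < rho by apply: lt_le_trans rA; rewrite invr_gt0 (lt_le_trans _ A1).
have Wrho : W%:R^-1 <= rho / 20.
  have A0 : 0 < A by apply: lt_le_trans A1.
  apply: (@le_trans _ _ (20 * A)^-1); first by rewrite lef_pV2 ?posrE ?mulr_gt0.
  by rewrite invfM mulrC ler_pM2r.
pose m (k : nat) : int := Num.floor (b 0%N + k%:R * omega).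
pose fr (k : nat) : R := b 0%N + k%:R * omega - (m k)%:~R.
have fr01 k : 0 <= fr k < 1.
  have /andP[h1 h2] := floor_itv (b 0%N + k%:R * omega).
  rewrite intrD in h2; rewrite /fr /m; apply/andP; split; lra.
have tW k : (Num.truncn (W%:R * fr k) < W)%N.
  have /andP[h1 h2] := fr01 k; rewrite truncn_lt_nat ?mulr_ge0//.
  by rewrite gtr_pMr.
pose f (k : 'I_N.+1) : 'I_W := Ordinal (tW k).
have [w Kw] := pigeonhole f W0.
set K := [set k | f k == w]%SET in Kw.
pose x0 : R := w%:R / W%:R.
have frK k : k \in K -> 0 <= fr k - x0 < W%:R^-1.
  rewrite inE /x0 => /eqP <- /=.
  have /andP[h1 h2] := fr01 k.
  have /andP[h3 h4] := @truncn_itv R (W%:R * fr k) (mulr_ge0 (ltW W0') h1).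
  rewrite subr_ge0 ler_pdivrMr// [fr k * _]mulrC h3/= ltrBlDr.
  by rewrite -{1}[W%:R^-1]mul1r -mulrDl ltr_pdivlMr// mulrC addrC natr1.
pose S := [set v : 'I_P * 'I_N.+1 | v.2 \in K]%SET.
pose xr (v : 'I_P * 'I_N.+1) : R := b v.1 + v.2%:R * omega - (m v.2)%:~R - x0.
have xrS v : v \in S -> `|xr v| <= rho / 10.
  rewrite [v \in S]inE => /frK /andP[h1 h2].
  have -> : xr v = (b v.1 - b 0%N) + (fr v.2 - x0) by rewrite /xr /fr; ring.
  apply: le_trans (ler_normD _ _) _.
  have := bW v.1 0%N (ltn_ord _) P0; rewrite (ger0_norm h1); lra.
have cardS : #|S| = (P * #|K|)%N.
  have -> : S = finset.setX [set: 'I_P]%SET K by apply/setP => -[i k]; rewrite !inE.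
  by rewrite cardsX cardsT card_ord.
have KN : (#|K| <= N.+1)%N by rewrite -[leqRHS]card_ord max_card.
exists #|S|; split.
- by rewrite cardS mulnCA leq_mul2l Kw orbT.
- by rewrite cardS leq_mul2l KN orbT.
have [p [pn pF pz]] := Fa x0 eta eta0.
apply: le_trans pz _.
set Delta := (_ ^+ P).
have D0 : 0 < Delta.
  by rewrite exprn_gt0// mulr_gt0 ?exprn_gt0 ?mulr_gt0 ?exprn_gt0 ?invr_gt0//; case/andP: s01.
pose x v : R[i] := (xr v)%:C.
have De : {in S, forall u, Delta <= \prod_(v in S | v != u) normc (x u - x v)}.
  move=> u uS; apply: le_trans (cluster_separation m K (ltW E0) s01 EN bsep bE u) _.
  rewrite le_eqVlt; apply/orP; left; apply/eqP; apply: eq_big.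
    by move=> v; rewrite [v \in S]inE.
  by move=> v _; rewrite /x -rmorphB normc_real; congr `|_|; rewrite /xr; ring.
apply: (@interpolation_bound R _ S x _ p z (rho / 10) rho) => //.
- move=> u v uS vS xe; apply/eqP; apply: contraT => ne.
  have := De u uS; rewrite (bigD1 v); last by rewrite /= vS eq_sym.
  by rewrite xe subrr normc0 /= mul0r leNgt D0.
- by rewrite divr_ge0// ltW.
- by rewrite mulrC divfK.
- lra.
- by move=> v vS; rewrite /x normc_real; exact: xrS.
- move=> v vS; rewrite -[p.[_]](subrK (F (x0 + xr v))).
  apply: le_trans (le_normcD _ _) _; rewrite normcB.
  have h1 : normc (F (x0 + xr v) - p.[x v]) <= eta.
    by apply: pF; apply: le_trans (xrS v vS) _; lra.
  have h2 : normc (F (x0 + xr v)) <= eta.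
    have -> : x0 + xr v = b v.1 + v.2%:R * omega - (m v.2)%:~R.
      by rewrite /xr; ring.
    by rewrite periodic1_int//; apply: Fsmall => //; rewrite -ltnS.
  lra.
Qed.

Lemma expR_ge_id (x : R) : x <= expR x.
Proof. by have := expR_ge1Dx x; lra. Qed.

(** The left-hand side collects the losses in [cluster_bound]: the number of
    nodes, the separation inside the clusters and the separation between their
    translates; [x] stands for [n], and [A2 * x] bounds [P * N] and the number
    of nodes. *)
Lemma decay_beats_losses (A A2 Q delta x : R) : 1 <= A -> 2 <= A2 -> 1 <= Q ->
  1 <= x -> 2 * (A + 4 + 6 * A2) * Q <= delta ->
  expR (A2 * x) * (2 * expR (- delta * x) *
    (expR (x + Q * (A2 * x) + delta * x / 2) *
     expR (2 * (A2 * x) + 2 * Q * (A2 * x)))) <= expR (- ((A + 1) * x)) / 2.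
Proof.
move=> A1 A22 Q1 x1 Qd.
have four : 4 <= expR 2 :> R.
  have := expR_ge1Dx (1 : R); have -> : (2 : R) = 1 + 1 by lra.
  by rewrite expRD => ?; nra.
have hd : A + 4 + 3 * A2 + 3 * (Q * A2) <= delta / 2.
  apply: (@le_trans _ _ ((A + 4 + 6 * A2) * Q)); last by lra.
  have : 0 <= (A + 4 + 3 * A2) * (Q - 1) by rewrite mulr_ge0//; lra.
  lra.
have hdn : (A + 4 + 3 * A2 + 3 * (Q * A2)) * x <= delta / 2 * x.
  by rewrite ler_pM2r//; lra.
rewrite ler_pdivlMr//.
apply: (@le_trans _ _ (expR 2 * (expR (A2 * x) * (expR (- delta * x) *
  (expR (x + Q * (A2 * x) + delta * x / 2) *
   expR (2 * (A2 * x) + 2 * Q * (A2 * x))))))).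
  set X := expR (x + _ + _) * _; set Y := expR (A2 * _).
  set Z := expR (- delta * _).
  have -> : Y * (2 * Z * X) * 2 = 4 * (Y * (Z * X)) by ring.
  by rewrite ler_wpM2r// !mulr_ge0// expR_ge0.
rewrite -!expRD ler_expR; lra.
Qed.

(** The points [x] at which [F] is small along [N] steps of the orbit form an
    exponentially small set. Otherwise this set contains [P] separated points
    in some interval shorter than the distances between the first [N] points of
    the orbit of [0], with [P N] comparable to [n], and interpolation at the
    translates of these points shows that [F] is too small at [z]. The point
    is that the constants [C] and [c] do not depend on the ratio [kappa] of [N]
    to [n], which only restricts [n]. *)
Lemma small_recurrence (A : R) : 1 <= A ->
  exists C c : R, [/\ 1 <= C, 0 < c & forall kappa : R, 0 < kappa ->
  exists n1 : nat, forall (n N : nat) (Q rho delta omega : R) (z : R[i])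
      (F : R -> R[i]),
    (n1 <= n)%N -> kappa * n%:R <= N%:R -> (N <= n)%N -> 1 <= Q ->
    (forall N, expR (- Q * N%:R) <= \prod_(i < N) circle_dist (i.+1%:R * omega)) ->
    A^-1 <= rho <= 1 -> normc z <= rho / 10 ->
    periodic1 F -> (forall x, poly_approx rho 1 z (expR (- A * n%:R)) F x) ->
    C * Q <= delta ->
    small [set x | forall k, (k <= N)%N ->
             normc (F (x + k%:R * omega)) <= expR (- delta * n%:R)]
          (expR (- c * delta * N%:R))].
Proof.
move=> A1.
(* Windows of length [1/W], so that the nodes and [z] lie in the disc of radius
   [rho / 10]. *)
pose W := (Num.truncn (20 * A)).+1.
have WA : 20 * A <= W%:R by apply/ltW/truncnS_gt.
have W0 : 0 < W%:R :> R by rewrite ltr0n.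
pose A2 : R := W%:R * (A + 1) + 2.
have A20 : 2 <= A2 by rewrite lerDr mulr_ge0//; lra.
pose c := (2 * A2)^-1.
have c0 : 0 < c by rewrite invr_gt0; lra.
have cA2 : c * A2 = 2^-1 by rewrite /c invfM -mulrA mulVf ?mulr1//; lra.
exists (2 * (A + 4 + 6 * A2)), c; split=> //; first by lra.
move=> kappa k0.
(* An upper bound of the size of the clusters, independent of [n]. *)
pose Pm := (Num.truncn (A2 / kappa)).+1.
pose n1 := ((6 * Pm * W) ^ Pm + 1)%N.
exists n1 => n N Q rho delta omega z F n1n kN Nn Q1 EN rA zr Fp Fa Qd.
have n0 : (0 < n)%N by apply: leq_trans n1n; rewrite /n1 addn1.
have n0' : 1 <= n%:R :> R by rewrite ler1n.
have Nn' : N%:R <= n%:R :> R by rewrite ler_nat.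
have N0' : 0 <= N%:R :> R by [].
set B := [set x | _].
(* The size of the clusters makes the number of nodes at least [(A + 1) n], so
   that the interpolation error [4 ^- d] is below the lower bound at [z]. *)
pose P := (Num.truncn (W%:R * (A + 1) * n%:R / N.+1%:R)).+1.
have N1 : 0 < N.+1%:R :> R by rewrite ltr0n.
have WAn0 : 0 <= W%:R * (A + 1) * n%:R / N.+1%:R.
  by rewrite divr_ge0// !mulr_ge0//; lra.
have P1 : W%:R * (A + 1) * n%:R <= P%:R * N.+1%:R.
  by rewrite -ler_pdivrMr//; apply/ltW/truncnS_gt.
have P2 : P%:R * N.+1%:R <= A2 * n%:R.
  have /andP[h _] := truncn_itv WAn0.
  have : P%:R * N.+1%:R <= (W%:R * (A + 1) * n%:R / N.+1%:R + 1) * N.+1%:R.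
    by rewrite ler_pM2r// /P -[in leLHS]natr1 lerD2r.
  rewrite mulrDl divfK ?gt_eqF// mul1r => /le_trans; apply.
  by rewrite /A2 -[N.+1%:R]natr1; lra.
have Ppos : (0 < P)%N by [].
have PR : 1 <= P%:R :> R by rewrite ler1n.
have PPm : (P <= Pm)%N.
  rewrite -(ler_nat R) /Pm; apply: le_trans (ltW (truncnS_gt _)).
  rewrite ler_pdivlMr//.
  have : 0 < n%:R :> R by lra.
  move=> npos; rewrite -(ler_pM2r npos); apply: le_trans P2.
  rewrite -mulrA ler_wpM2l//; apply: le_trans kN _.
  by rewrite ler_nat.
have PN : P%:R * N%:R <= A2 * n%:R.
  by apply: le_trans P2; rewrite ler_wpM2l// ler_nat.
have d0 : 0 < delta by apply: lt_le_trans Qd; rewrite !mulr_gt0//; lra.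
pose E := expR (- Q * N%:R).
have E0 : 0 < E by exact: expR_gt0.
have E1 : E <= 1 by rewrite -expR0 ler_expR mulNr oppr_le0 mulr_ge0//; lra.
(* Intervals of length [1/L] are shorter than half of the distances between
   the first [N] points of the orbit of [0]. *)
pose L := (Num.truncn (2 * W%:R / E)).+1.
have L0 : 0 < L%:R :> R by rewrite ltr0n.
have WE : 1 <= W%:R / E by rewrite ler_pdivlMr// mul1r (le_trans E1)// ler1n.
have L1 : 2 * W%:R / E <= L%:R by apply/ltW/truncnS_gt.
have L2 : L%:R <= 3 * W%:R / E.
  have : 0 <= 2 * W%:R / E by rewrite -mulrA mulr_ge0//; lra.
  by move=> /truncn_itv /andP[+ _]; rewrite /L -natr1 -!mulrA; lra.
have LV : L%:R^-1 <= E / 2 /\ L%:R^-1 <= W%:R^-1 :> R.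
  have h1 : L%:R^-1 <= (2 * W%:R / E)^-1.
    by rewrite lef_pV2 ?posrE// divr_gt0// mulr_gt0.
  have W1 : 1 <= W%:R :> R by rewrite ler1n.
  have h2 : (2 * W%:R / E)^-1 = E / 2 * W%:R^-1.
    by rewrite invfM invrK invfM; ring.
  have V0 : 0 < W%:R^-1 :> R by rewrite invr_gt0.
  have V1 : W%:R^-1 <= 1 :> R by rewrite invf_le1.
  rewrite h2 in h1; split; apply: le_trans h1 _; clear -E0 E1 V0 V1 W1; nra.
set tau := expR (- c * delta * N%:R).
have tau0 : 0 < tau by exact: expR_gt0.
have tau1 : tau <= 1.
  by rewrite -expR0 ler_expR !mulNr oppr_le0 !mulr_ge0// ltW.
pose sigma := tau / (2 * P%:R * L%:R).
have PL0 : 0 < 2 * P%:R * L%:R :> R by rewrite !mulr_gt0//; lra.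
have s0 : 0 < sigma by rewrite divr_gt0.
have L1' : 1 <= L%:R :> R by rewrite ler1n.
have s1 : sigma <= 1.
  rewrite ler_pdivrMr// mul1r (le_trans tau1)//; clear -PR L1'; nra.
pose I_ (j : nat) := [set x : R | B x /\ j%:R <= L%:R * x < j%:R + 1].
have [[j [b [bB bsep]]]|nex] := pselect (exists j, exists b : nat -> R,
  (forall i, (i < P)%N -> I_ j (b i)) /\
  forall i i', (i < P)%N -> (i' < P)%N -> i != i' -> sigma <= `|b i - b i'|);
  last first.
  apply: small_sub (small_bigcup (n := L) (B := I_) (tau := 2 * sigma * P%:R) _).
  - move=> x [Bx]; rewrite /= in_itv/= => /andP[x0 x1].
    have Lx : 0 <= L%:R * x by rewrite mulr_ge0.
    exists (Num.truncn (L%:R * x)).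
      by rewrite truncn_lt_nat// gtr_pMr.
    by split=> //; rewrite natr1; exact: truncn_itv.
  - rewrite le_eqVlt; apply/orP; left; apply/eqP; rewrite /sigma.
    field; apply/andP; split; rewrite gt_eqF//; lra.
  - move=> j _; have [[b hb]|//] := separated_or_small (I_ j) P (ltW s0).
    by exfalso; apply: nex; exists j, b.
exfalso.
have bL i i' : (i < P)%N -> (i' < P)%N -> `|b i - b i'| <= L%:R^-1.
  move=> iP i'P; have [_ /andP[h1 h2]] := bB i iP.
  have [_ /andP[h3 h4]] := bB i' i'P.
  rewrite -[leRHS]mul1r ler_pdivlMr// -[L%:R in leLHS]gtr0_norm// -normrM mulrC.
  by rewrite mulrBr ler_norml; clear -h1 h2 h3 h4; apply/andP; split; lra.
have [LE LW] := LV.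
have [d [d1 d2]] := @cluster_bound A rho E sigma (expR (- delta * n%:R))
  (expR (- A * n%:R)) omega W N P z F b A1 rA zr WA (expR_gt0 _) E0
  (introT andP (conj s0 s1)) (EN N) Ppos bsep
  (fun i i' h h' => le_trans (bL i i' h h') LE)
  (fun i i' h h' => le_trans (bL i i' h h') LW) Fp Fa
  (fun i k h h' => (bB i h).1 k h').
have dn : (A + 1) * n%:R <= d%:R.
  rewrite -(ler_pM2l W0) mulrA; apply: le_trans P1 _.
  by rewrite -!natrM ler_nat.
have dA2 : d%:R <= A2 * n%:R by apply: le_trans P2; rewrite -natrM ler_nat.
have e4 : 4^-1 <= expR (-1) :> R.
  by rewrite expRN lef_pV2 ?posrE ?expR_gt0// expR1_le4.
have rem : 4^-1 ^+ d <= expR (- ((A + 1) * n%:R)).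
  apply: (@le_trans _ _ (expR (-1) ^+ d)).
    by rewrite lerXn2r ?nnegrE ?expR_ge0.
  by rewrite -expRM_natl ler_expR mulrN1 lerN2.
have half : expR (- n%:R) <= 2^-1 :> R.
  have h2 : 2 <= expR n%:R :> R.
    by apply: le_trans (expR_ge1Dx n%:R); clear -n0'; lra.
  by rewrite expRN lef_pV2 ?posrE ?expR_gt0.
have sP : sigma^-1 ^+ P <= expR (n%:R + Q * (A2 * n%:R) + delta * n%:R / 2).
  have -> : sigma^-1 = 2 * P%:R * L%:R * tau^-1 by rewrite /sigma invf_div.
  apply: (@le_trans _ _ ((6 * P%:R * W%:R * (E^-1 * tau^-1)) ^+ P)).
    rewrite lerXn2r ?nnegrE ?mulr_ge0 ?invr_ge0 ?(ltW E0) ?(ltW tau0)//.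
    rewrite mulrA ler_wpM2r ?invr_ge0 ?(ltW tau0)//.
    have -> : 6 * P%:R * W%:R / E = 2 * P%:R * (3 * W%:R / E) by ring.
    by rewrite ler_wpM2l// mulr_ge0.
  rewrite exprMn -addrA expRD; apply: ler_pM.
  - by rewrite exprn_ge0// !mulr_ge0.
  - by rewrite exprn_ge0// mulr_ge0// invr_ge0 ltW.
  - apply: (@le_trans _ _ n%:R); last exact: expR_ge_id.
    rewrite -!natrM -natrX ler_nat.
    apply: leq_trans n1n; rewrite /n1 addn1 leqW//.
    apply: (@leq_trans ((6 * Pm * W) ^ P)); last by rewrite leq_pexp2l// !muln_gt0.
    by rewrite leq_exp2r// !leq_mul2r leq_mul2l PPm orbT.
  - rewrite /E /tau -!expRN -expRD -expRM_natl ler_expR.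
    have h1 : Q * (P%:R * N%:R) <= Q * (A2 * n%:R) by rewrite ler_wpM2l// (le_trans ler01).
    have h2 : c * delta * (P%:R * N%:R) <= c * delta * (A2 * n%:R).
      by rewrite ler_wpM2l// mulr_ge0// ltW.
    have h3 : c * delta * (A2 * n%:R) = delta * n%:R / 2.
      transitivity (c * A2 * (delta * n%:R)); first by ring.
      by rewrite cA2 mulrC.
    by clear -h1 h2 h3; lra.
have EP : ((2^-1 ^+ N * E) ^- 2) ^+ P <= expR (2 * (A2 * n%:R) + 2 * Q * (A2 * n%:R)).
  have e2 : 2^-1 ^+ N * E >= expR (- (1 + Q) * N%:R).
    have -> : - (1 + Q) * N%:R = N%:R * -1 + - Q * N%:R by ring.
    rewrite expRD /E ler_wpM2r ?expR_ge0//.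
    rewrite expRM_natl lerXn2r ?nnegrE ?expR_ge0//.
    rewrite expRN lef_pV2 ?posrE ?expR_gt0//.
    by apply: le_trans (expR_ge1Dx _); clear; lra.
  apply: (@le_trans _ _ ((expR (- (1 + Q) * N%:R) ^- 2) ^+ P)).
    have p0 : 0 < 2^-1 ^+ N * E by rewrite mulr_gt0 ?exprn_gt0 ?invr_gt0.
    rewrite lerXn2r ?nnegrE ?invr_ge0 ?exprn_ge0 ?expR_ge0 ?(ltW p0)//.
    rewrite lef_pV2 ?posrE ?exprn_gt0 ?expR_gt0//.
    by rewrite lerXn2r ?nnegrE ?expR_ge0 ?(ltW p0).
  rewrite -expRM_natl -expRN -expRM_natl ler_expR.
  have : (1 + Q) * (P%:R * N%:R) <= (1 + Q) * (A2 * n%:R).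
    by rewrite ler_wpM2l// addr_ge0// (le_trans ler01).
  by clear -PN; lra.
have key : d%:R * (2 * expR (- delta * n%:R) /
    (sigma * (2^-1 ^+ N * E) ^+ 2) ^+ P) <= expR (- ((A + 1) * n%:R)) / 2.
  have -> : 2 * expR (- delta * n%:R) / (sigma * (2^-1 ^+ N * E) ^+ 2) ^+ P =
     2 * expR (- delta * n%:R) * (sigma^-1 ^+ P * ((2^-1 ^+ N * E) ^- 2) ^+ P).
    by rewrite exprMn invfM !exprVn.
  apply: (@le_trans _ _ (expR (A2 * n%:R) * (2 * expR (- delta * n%:R) *
    (expR (n%:R + Q * (A2 * n%:R) + delta * n%:R / 2) *
     expR (2 * (A2 * n%:R) + 2 * Q * (A2 * n%:R)))))).
    have dd : d%:R <= expR (A2 * n%:R).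
      exact: le_trans dA2 (expR_ge_id _).
    apply: ler_pM => //.
      rewrite !mulr_ge0 ?expR_ge0 ?exprn_ge0 ?invr_ge0 ?exprn_ge0//; first exact: ltW.
      by rewrite mulr_ge0 ?exprn_ge0 ?(ltW E0).
    rewrite ler_wpM2l ?mulr_ge0 ?expR_ge0//; apply: ler_pM => //.
      by rewrite exprn_ge0// invr_ge0 ltW.
    by rewrite exprn_ge0// invr_ge0 exprn_ge0// mulr_ge0 ?exprn_ge0 ?(ltW E0).
  exact: decay_beats_losses.
move=> hd; have : expR (- A * n%:R) <= expR (- ((A + 1) * n%:R)) * (3 / 2).
  by clear -hd key rem; lra.
rewrite mulrDl mul1r opprD expRD mulNr -mulrA -[leLHS]mulr1 ler_pM2l ?expR_gt0//.
by clear -half; lra.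
Qed.

End SmallRecurrence.

(** * Power series near a point of the real line *)

Section Analytic.
Variable R : realType.

(** Convergence is stated with the real modulus, which covers real and complex
    analytic functions alike. *)
Definition power_series_at (f : R -> R[i]) (s : R) : Prop :=
  exists (c : nat -> R[i]) (r : R), 0 < r /\
    forall t : R, `|t| < r -> forall e : R, 0 < e -> exists N, forall d,
      (N <= d)%N -> normc (\sum_(k < d) c k * t%:C ^+ k - f (s + t)) < e.

Lemma analytic_complex_series (f : R -> R[i]) :
  analytic (real_complex R) f -> forall s, power_series_at f s.
Proof.
move=> fa s; have [c [r [r0 h]]] := fa s.
exists c, r; split=> // t tr e e0.
have := h (s + t); rewrite addrC addKr => /(_ tr) /cvgrPdist_lt/(_ e%:C).
rewrite ltcR => /(_ e0) [N _ hN]; exists N => d Nd.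
have := hN d Nd; rewrite /series/= big_mkord distrC.
by rewrite normr_normc ltcR.
Qed.

Lemma analytic_real_series (f : R -> R) :
  analytic (@idfun R) f -> forall s, power_series_at (fun x => (f x)%:C) s.
Proof.
move=> fa s; have [c [r [r0 h]]] := fa s.
exists (fun k => (c k)%:C), r; split=> // t tr e e0.
have := h (s + t); rewrite addrC addKr => /(_ tr) /cvgrPdist_lt/(_ e e0).
move=> [N _ hN]; exists N => d Nd.
have := hN d Nd; rewrite /series/= big_mkord distrC.
rewrite -normc_real rmorphB rmorph_sum/=.
by under eq_bigr do rewrite rmorphM rmorphXn.
Qed.

Lemma power_series_shift (f : R -> R[i]) (E : R[i]) s :
  power_series_at f s -> power_series_at (fun x => f x - E) s.
Proof.
move=> [c [r [r0 h]]]; exists (fun k => if k == 0%N then c 0%N - E else c k), r.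
split=> // t tr e e0; have [N hN] := h t tr e e0.
exists N.+1 => -[//|d] Nd; have := hN d.+1 (ltnW Nd).
rewrite !big_ord_recl/= !expr0 !mulr1.
suff -> : c 0%N + \sum_(i < d) c (bump 0 i) * t%:C ^+ bump 0 i - f (s + t) =
  c 0%N - E + \sum_(i < d) c (bump 0 i) * t%:C ^+ bump 0 i - (f (s + t) - E) by [].
by ring.
Qed.

Lemma geometric_tail (n d : nat) : \sum_(n <= k < n + d) 2^-1 ^+ k <= 2 * 2^-1 ^+ n :> R.
Proof.
suff -> : \sum_(n <= k < n + d) 2^-1 ^+ k = 2 * 2^-1 ^+ n - 2 * 2^-1 ^+ (n + d) :> R.
  by rewrite gerBl mulr_ge0// exprn_ge0.
elim: d => [|d IH]; first by rewrite addn0 big_geq// subrr.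
rewrite addnS big_nat_recr ?leq_addr//= IH exprS; lra.
Qed.

Lemma small_geometric (K e : R) : 0 < e ->
  exists d : nat, forall d', (d <= d')%N -> K * 2^-1 ^+ d' <= e.
Proof.
move=> e0; exists (Num.truncn (K / e)).+1 => d dd.
rewrite exprVn ler_pdivrMr ?exprn_gt0// mulrC -ler_pdivrMr//.
apply: le_trans (ltW (truncnS_gt _)) _.
by rewrite -natrX ler_nat (leq_trans dd)// ltnW// ltn_expl.
Qed.

Lemma power_series_tail (f : R -> R[i]) s : power_series_at f s ->
  exists (c : nat -> R[i]) (rho M : R), [/\ 0 < rho, 0 <= M,
    forall k, normc (c k) * rho ^+ k <= M &
    forall t d, `|t| <= rho / 2 ->
      normc (f (s + t) - \sum_(k < d) c k * t%:C ^+ k) <= 2 * M * 2^-1 ^+ d].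
Proof.
move=> [c [r [r0 h]]].
have r2 : 0 < r / 2 by rewrite divr_gt0.
have r20 := ltW r2.
have r2r : `|r / 2| < r by rewrite gtr0_norm//; lra.
have [N hN] := h _ r2r 1 ltr01.
pose M := 2 + \sum_(k < N) normc (c k) * (r / 2) ^+ k.
have sum0 (n : nat) : 0 <= \sum_(k < n) normc (c k) * (r / 2) ^+ k.
  by apply: sumr_ge0 => k _; rewrite mulr_ge0 ?normc_ge0 ?exprn_ge0.
have M0 : 0 <= M by rewrite addr_ge0.
have cM k : normc (c k) * (r / 2) ^+ k <= M.
  have [kN|Nk] := ltnP k N.
    rewrite /M (bigD1 (Ordinal kN))//=.
    have : 0 <= \sum_(i < N | i != Ordinal kN) normc (c i) * (r / 2) ^+ i.
      by apply: sumr_ge0 => i _; rewrite mulr_ge0 ?normc_ge0 ?exprn_ge0.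
    lra.
  have h1 := hN k Nk; have h2 := hN k.+1 (leqW Nk).
  rewrite big_ord_recr/= in h2.
  have -> : normc (c k) * (r / 2) ^+ k = normc (c k * (r / 2)%:C ^+ k).
    by rewrite normcM normcX normc_real ger0_norm.
  set S := \sum_(_ < _) _ in h1 h2; set u := c k * _ in h2 *.
  have -> : u = (S + u - f (s + r / 2)) - (S - f (s + r / 2)) by ring.
  apply: le_trans (le_normcD _ _) _; rewrite normcN.
  by have := sum0 N; rewrite /M; lra.
exists c, (r / 2), M; split=> // t d tr.
have part n : normc (\sum_(d <= k < d + n) c k * t%:C ^+ k) <= 2 * M * 2^-1 ^+ d.
  apply: le_trans (normc_sum _ _ _) _.
  rewrite mulrAC mulrC; apply: le_trans (ler_wpM2l M0 (geometric_tail d n)).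
  rewrite mulr_sumr; apply: ler_sum => k _.
  rewrite normcM normcX normc_real.
  apply: (@le_trans _ _ (normc (c k) * (r / 2 / 2) ^+ k)).
    by rewrite ler_wpM2l ?normc_ge0// lerXn2r ?nnegrE//; lra.
  by rewrite exprMn mulrA ler_wpM2r// exprn_ge0.
apply/ler_addgt0Pr => e e0.
have tr' : `|t| < r by lra.
have [N' hN'] := h t tr' e e0.
have := hN' (d + N')%N (leq_addl _ _).
rewrite -(big_mkord xpredT (fun k => c k * t%:C ^+ k)).
rewrite (big_cat_nat (n := d)) ?leq_addr//= big_mkord => hh.
set S := \sum_(_ < _) _ in hh *; set T := \sum_(_ <= _ < _) _ in hh.
have -> : f (s + t) - S = T + - (S + T - f (s + t)) by ring.
apply: le_trans (le_normcD _ _) _; rewrite normcN.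
by rewrite lerD ?part// ltW.
Qed.

(** Near a point where [g] does not vanish to infinite order, the partial sums
    [c_l X^l + ...] are dominated by their first nonzero term. *)
Lemma leading_term_bound (g : R -> R[i]) s : power_series_at g s ->
  (\forall x \near s, g x = 0) \/
  exists (l : nat) (h M e : R) (p : nat -> {poly R[i]}),
    [/\ 0 < h, 0 < e, forall d, coef_norm h (p d) <= M,
      forall t d, `|t| <= h ->
         normc (g (s + t) - (p d).[t%:C]) <= M * 2^-1 ^+ d &
      forall w d, normc w <= h -> (l < d)%N -> normc w ^+ l * e <= normc (p d).[w]].
Proof.
move=> /power_series_tail[c [rho [M [rho0 M0 cM gt]]]].
have rho2 : 0 < rho / 2 by rewrite divr_gt0.
have [call|] := pselect (forall k, c k = 0).
  left; near=> x.
  have xs : `|x - s| <= rho / 2.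
    near: x; exists (rho / 2) => //= y /=; rewrite distrC; exact: ltW.
  apply/eqP; rewrite -normc_eq0 eq_le normc_ge0 andbT; apply/ler_addgt0Pr => e e0.
  rewrite add0r.
  have [d hd] := small_geometric (2 * M) e0.
  have := gt _ d xs; rewrite big1 ?subr0 ?[s + _]addrC ?subrK.
    by move=> /le_trans; apply; exact: hd.
  by move=> k _; rewrite call mul0r.
move=> nall; right.
have [l cl lmin] : exists2 l, c l != 0 & forall k, (k < l)%N -> c k = 0.
  have ex : exists k, c k != 0.
    apply: contrapT => H; apply: nall => k; apply/eqP.
    by apply: contraT => ck; exfalso; apply: H; exists k.
  exists (ex_minn ex); case: ex_minnP => // m cm mmin k km.
  by apply/eqP; apply: contraT => /mmin; rewrite leqNgt km.
have cl0 : 0 < normc (c l) by rewrite lt_neqAle normc_ge0 andbT eq_sym normc_eq0.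
pose h := Num.min (rho / 2) (normc (c l) * rho ^+ l.+1 / (4 * (M + 1))).
have h0 : 0 < h.
  by rewrite lt_min rho2/= divr_gt0 ?mulr_gt0 ?exprn_gt0//; lra.
have hrho : h <= rho / 2 by rewrite ge_min lexx.
have cM' k : normc (c k) <= M / rho ^+ k by rewrite ler_pdivlMr ?exprn_gt0.
exists l, h, (2 * M), (normc (c l) / 2), (fun d => \poly_(k < d) c k).
have hornerE d w : (\poly_(k < d) c k).[w] = \sum_(k < d) c k * w ^+ k.
  by rewrite horner_poly.
split=> //; first by rewrite divr_gt0.
- move=> d; rewrite (@coef_normE _ d) ?size_poly//.
  apply: (@le_trans _ _ (\sum_(k < d) M * 2^-1 ^+ k)).
    apply: ler_sum => k _; rewrite coef_poly ltn_ord.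
    apply: (@le_trans _ _ (normc (c k) * (rho / 2) ^+ k)).
      by rewrite ler_wpM2l ?normc_ge0// lerXn2r ?nnegrE// ltW.
    by rewrite exprMn mulrA ler_wpM2r// exprn_ge0.
  rewrite -mulr_sumr mulrC ler_wpM2r//.
  have := geometric_tail 0 d; rewrite add0n big_mkord expr0 mulr1.
  by [].
- move=> t d th; rewrite hornerE; apply: gt; exact: le_trans hrho.
- move=> w d wh ld; rewrite hornerE.
  rewrite -(subnKC ld) addSnnS big_split_ord/= big1 ?add0r; last first.
    by move=> k _; rewrite lmin// mul0r.
  rewrite big_ord_recl/= addn0.
  set q := rho^-1 * normc w.
  have w0 := normc_ge0 w.
  have q0 : 0 <= q by rewrite mulr_ge0// invr_ge0 ltW.
  have q2 : q <= 2^-1.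
    by rewrite /q mulrC ler_pdivrMr//; have := le_trans wh hrho; lra.
  have wl0 : 0 <= normc w ^+ l by rewrite exprn_ge0.
  suff tail : normc (\sum_(i < d - l.+1) c (l + bump 0 i)%N * w ^+ (l + bump 0 i))
      <= normc w ^+ l * (normc (c l) / 2).
    have := normcB_lower (c l * w ^+ l)
      (\sum_(i < d - l.+1) c (l + bump 0 i)%N * w ^+ (l + bump 0 i)).
    rewrite normcM normcX; lra.
  apply: le_trans (normc_sum _ _ _) _.
  apply: (@le_trans _ _ (\sum_(i < d - l.+1) normc w ^+ l * (M / rho ^+ l * q * 2^-1 ^+ i))).
    apply: ler_sum => i _; rewrite normcM normcX exprD mulrCA ler_wpM2l//.
    rewrite /bump/= add1n.
    apply: (@le_trans _ _ (M / rho ^+ (l + i.+1) * normc w ^+ i.+1)).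
      by rewrite ler_wpM2r ?exprn_ge0.
    have -> : M / rho ^+ (l + i.+1) * normc w ^+ i.+1 = M / rho ^+ l * q * q ^+ i.
      rewrite -[RHS]mulrA -exprS /q exprMn exprD invfM exprVn; ring.
    rewrite ler_wpM2l ?mulr_ge0 ?invr_ge0 ?exprn_ge0 ?(ltW rho0)//.
    by rewrite lerXn2r ?nnegrE.
  rewrite -mulr_sumr ler_wpM2l// -mulr_sumr.
  have g2 : \sum_(i < d - l.+1) 2^-1 ^+ i <= 2 :> R.
    by have := geometric_tail 0 (d - l.+1); rewrite add0n big_mkord expr0 mulr1.
  apply: (@le_trans _ _ (M / rho ^+ l * q * 2)).
    by rewrite ler_wpM2l// !mulr_ge0 ?invr_ge0 ?exprn_ge0 ?(ltW rho0).
  have wh' : normc w <= normc (c l) * rho ^+ l.+1 / (4 * (M + 1)).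
    by apply: le_trans wh _; rewrite ge_min lexx orbT.
  move: wh'; rewrite ler_pdivlMr ?mulr_gt0//; last by lra.
  move=> wh'.
  have rl : 0 < rho ^+ l.+1 by rewrite exprn_gt0.
  have -> : M / rho ^+ l * q * 2 = (2 * M * normc w) / rho ^+ l.+1.
    rewrite /q exprS invfM; ring.
  rewrite ler_pdivrMr//; nra.
Unshelve. all: by end_near.
Qed.

End Analytic.

(** * Uniform approximations along the real line *)

Section AnalyticCircle.
Variable R : realType.

Lemma zero_or_isolated (g : R -> R[i]) s : power_series_at g s ->
  (\forall x \near s, g x = 0) \/ (\forall x \near s, x != s -> g x != 0).
Proof.
move=> /leading_term_bound[|[l [h [M [e [p [h0 e0 _ gp pl]]]]]]]; first by left.
right; near=> x => xs; apply/eqP => gx0.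
have xh : `|x - s| <= h.
  by near: x; exists h => //= y /=; rewrite distrC; exact: ltW.
have xs0 : 0 < `|x - s| by rewrite normr_gt0 subr_eq0.
have eps0 : 0 < `|x - s| ^+ l * e / 2 by rewrite divr_gt0// mulr_gt0// exprn_gt0.
have [d hd] := small_geometric M eps0.
have := gp (x - s) (d + l.+1)%N xh.
rewrite [s + _]addrC subrK gx0 sub0r normcN.
have := pl (x - s)%:C (d + l.+1)%N; rewrite normc_real => /(_ xh).
have := hd (d + l.+1)%N (leq_addr _ _).
by rewrite ltn_addl// => h1 /(_ isT) h2 h3; lra.
Unshelve. all: by end_near.
Qed.

(** The set of points around which [g] vanishes is open and closed. *)
Lemma analytic_identity (g : R -> R[i]) : (forall s, power_series_at g s) ->
  (exists s : R, \forall x \near s, g x = 0) -> forall x, g x = 0.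
Proof.
move=> ga [s0 gs0].
pose U := [set s : R | \forall x \near s, g x = 0].
have oU : open U by exact: open_interior.
have cU : closed U.
  rewrite -openC openE => s nUs.
  have [//|iso] := zero_or_isolated (ga s).
  rewrite /interior; near=> x => Ux.
  have [xs|xs] := eqVneq x s; first by apply: nUs; rewrite -xs.
  have gx0 : g x = 0 by exact: (@nbhs_singleton R x _ Ux).
  suff : g x != 0 by rewrite gx0 eqxx.
  by move: xs; near: x.
have UT : U = setT.
  have cT : connected [set: R] by apply/connected_intervalP.
  apply: cT; first by exists s0.
  - by exists U => //; rewrite setTI.
  - by exists U => //; rewrite setTI.
by move=> x; have Ux : U x by [rewrite UT]; exact: (@nbhs_singleton R x _ Ux).
Unshelve. all: by end_near.
Qed.

(** A form of non-degeneracy of [g] near [x] which gets weaker as [m] grows, so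
    that compactness makes it uniform in [x]. *)
Definition approx_level (g : R -> R[i]) (m : nat) (x : R) : Prop :=
  (0 < m)%N /\ forall y : R, 0 < y <= m%:R^-1 ->
  poly_approx m%:R^-1 m%:R (0 +i* y) (y ^+ m / m%:R) g x.

Lemma poly_approx_periodic (g : R -> R[i]) rho K z eps : periodic1 g ->
  (forall x, 0 <= x <= 1 -> poly_approx rho K z eps g x) ->
  forall x, poly_approx rho K z eps g x.
Proof.
move=> gp h x eta eta0.
have /andP[f1 f2] := floor_itv x; rewrite intrD in f2.
have x01 : 0 <= x - (Num.floor x)%:~R <= 1 by apply/andP; split; lra.
have [p [p1 p2 p3]] := h _ x01 eta eta0.
exists p; split=> // t tr; rewrite -(periodic1_int gp _ (Num.floor x)).
have -> : x + t - (Num.floor x)%:~R = x - (Num.floor x)%:~R + t by ring.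
exact: p2.
Qed.

Lemma poly_approx_le (g : R -> R[i]) rho rho' K K' z eps eps' x :
  0 <= rho' <= rho -> K <= K' -> eps' <= eps ->
  poly_approx rho K z eps g x -> poly_approx rho' K' z eps' g x.
Proof.
move=> rr KK ee h eta eta0; have [p [p1 p2 p3]] := h eta eta0.
exists p; split.
- by apply: le_trans (coef_norm_mono _ rr) (le_trans p1 KK).
- by move=> t tr; apply: p2; apply: le_trans tr _; case/andP: rr.
- exact: le_trans p3.
Qed.

Lemma approx_level_near (g : R -> R[i]) s : power_series_at g s ->
  ~ (\forall x \near s, g x = 0) ->
  \forall x \near s & m \near \oo, approx_level g m x.
Proof.
move=> /leading_term_bound[//|[l [h [M [e [p [h0 e0 pM gp pl]]]]]]] _.
pose m0 := maxn (maxn l.+1 (Num.truncn (2 / h)).+1)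
                (maxn (Num.truncn M).+1 (Num.truncn e^-1).+1).
have m00 : (0 < m0)%N by rewrite !leq_max.
have m0R : 0 < m0%:R :> R by rewrite ltr0n.
exists ([set x | `|x - s| < m0%:R^-1], [set m | (m0 <= m)%N]); first split=> /=.
- exists m0%:R^-1 => /=; first by rewrite invr_gt0.
  by move=> y /=; rewrite distrC.
- exact: nbhs_infty_ge.
move=> [x m] /= [xs mm0]; split; first exact: leq_trans mm0.
move=> y /andP[y0 ym] eta eta0.
have mR : 0 < m%:R :> R by rewrite ltr0n (leq_trans m00).
have mm : m%:R^-1 <= m0%:R^-1 :> R by rewrite lef_pV2 ?posrE// ler_nat.
have h2 : m0%:R^-1 <= h / 2.
  rewrite -[h / 2]invrK lef_pV2 ?posrE ?invr_gt0 ?divr_gt0// invf_div.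
  apply: le_trans (ltW (truncnS_gt _)) _; rewrite ler_nat /m0.
  by rewrite !leq_max leqnn orbT.
have MM : M <= m%:R.
  apply: le_trans (ltW (truncnS_gt _)) _; rewrite ler_nat (leq_trans _ mm0)//.
  by rewrite /m0 !leq_max leqnn !orbT.
have me : m%:R^-1 <= e.
  apply: le_trans mm _; rewrite -[e]invrK lef_pV2 ?posrE ?invr_gt0//.
  apply: le_trans (ltW (truncnS_gt _)) _; rewrite ler_nat.
  by rewrite /m0 !leq_max leqnn !orbT.
have lm : (l <= m)%N.
  by apply: leq_trans mm0; rewrite /m0 !leq_max leqnSn.
have [d hd] := small_geometric M eta0.
pose D := (d + l.+1)%N.
have Dd : (d <= D)%N by rewrite leq_addr.
have Dl : (l < D)%N by rewrite ltn_addl.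
exists (p D \Po ('X + (x - s)%:C%:P)); split.
- apply: le_trans (coef_norm_shift _ _ _) _; first by rewrite invr_ge0 ltW.
  apply: le_trans MM; apply: le_trans (pM D); apply: coef_norm_mono.
  apply/andP; split; first by rewrite addr_ge0 ?normc_ge0// invr_ge0 ltW.
  by rewrite normc_real; lra.
- move=> t tm; rewrite horner_comp hornerD hornerX hornerC -rmorphD.
  have -> : x + t = s + (t + (x - s)) by ring.
  apply: le_trans (gp _ _ _) (hd _ Dd).
  by apply: le_trans (ler_normD _ _) _; lra.
- rewrite horner_comp hornerD hornerX hornerC.
  pose w : R[i] := (0 +i* y) + (x - s)%:C; rewrite -/w.
  have wy : y <= normc w.
    rewrite /w /normc /= add0r addr0 -{1}(ger0_norm (ltW y0)) -sqrtr_sqr.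
    by rewrite ler_wsqrtr// lerDr sqr_ge0.
  have wh : normc w <= h.
    rewrite /w; apply: le_trans (le_normcD _ _) _; rewrite normc_real.
    have -> : normc (0 +i* y) = y.
      by rewrite /normc/= expr0n add0r sqrtr_sqr gtr0_norm.
    lra.
  apply: le_trans (pl w D wh Dl).
  have y1 : y <= 1 by apply: le_trans ym _; rewrite invf_le1// ler1n (leq_trans m00).
  apply: ler_pM; rewrite ?invr_ge0 ?exprn_ge0 ?(ltW y0) ?(ltW mR)//.
  apply: (@le_trans _ _ (y ^+ l)).
    by rewrite ler_wiXn2l// ltW// y0.
  by rewrite lerXn2r ?nnegrE ?(ltW y0)// (le_trans (ltW y0)).
Qed.

Lemma approx_level_eventually (g : R -> R[i]) :
  (forall s, power_series_at g s) -> (exists x, g x != 0) ->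
  \forall m \near \oo, forall x, 0 <= x <= 1 -> approx_level g m x.
Proof.
move=> ga [x1 gx1].
have nz (s : R) : ~ (\forall x \near s, g x = 0).
  move=> h; move: gx1; rewrite (@analytic_identity g ga _ x1) ?eqxx//.
  by exists s.
have cpt := @segment_compact R 0 1.
have FF : Filter (nbhs (\oo : set_system nat)) by exact: _.
have H := (compact_near_coveringP _).1 cpt nat _ (fun m x => approx_level g m x)
  FF (fun x _ => approx_level_near (ga x) (@nz x)).
by apply: (@filterS _ _ FF) H => m h x x01; apply: h; rewrite /= in_itv.
Qed.

(** [f] is bounded below at the point [x + z] for all real [x], and [u] is
    approximated on the same discs. A single [C] bounds all constants, so that
    compactness in a parameter of [f] yields a common [C], although [rho] and
    [z] depend on the parameter. *)
Definition uniform_approx (C : R) (f u : R -> R[i]) : Prop :=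
  exists rho z, [/\ C^-1 <= rho <= 1, normc z <= rho / 10,
    forall x, poly_approx rho C z C^-1 f x &
    forall x, poly_approx rho C z 0 u x].

(** The zeros of [v - E0] near the real line are on the real line, provided
    that the strip around it is thin enough; the lower bound obtained at a
    height [y] in this strip persists for [E] near [E0]. *)
Lemma uniform_approx_near (a : R -> R[i]) (v : R -> R) (E0 : R) :
  periodic1 v -> periodic1 a ->
  (forall s, power_series_at a s) -> (exists x, a x != 0) ->
  (forall s, power_series_at (fun x => (v x)%:C) s) ->
  (exists x, v x != E0) ->
  \forall E \near E0 & C \near +oo,
    uniform_approx C (fun x => (v x - E)%:C) a.
Proof.
move=> vp ap aa anz va [x1 vx1].
have ga s : power_series_at (fun x => (v x - E0)%:C) s.
  have := power_series_shift E0%:C (va s).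
  by under [X in power_series_at X]funext do rewrite -rmorphB.
have gnz : exists x, (v x - E0)%:C != 0.
  by exists x1; rewrite -normc_eq0 normc_real normr_eq0 subr_eq0.
have [m [[gm am] m1]] : exists m, ((forall x, 0 <= x <= 1 ->
    approx_level (fun x => (v x - E0)%:C) m x) /\
    (forall x, 0 <= x <= 1 -> approx_level a m x)) /\ (0 < m)%N.
  have : \forall m \near \oo, ((forall x, 0 <= x <= 1 ->
    approx_level (fun x => (v x - E0)%:C) m x) /\
    (forall x, 0 <= x <= 1 -> approx_level a m x)) /\ (0 < m)%N.
    near=> m; split; last by near: m; exact: nbhs_infty_gt.
    by split; near: m; exact: approx_level_eventually.
  by move=> [m _ /(_ m (leqnn m)) ?]; exists m.
have mR : 0 < m%:R :> R by rewrite ltr0n.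
pose y : R := m%:R^-1 / 10.
have y0 : 0 < y by rewrite divr_gt0 ?invr_gt0.
have ym : 0 < y <= m%:R^-1.
  have : 0 < m%:R^-1 :> R by rewrite invr_gt0.
  by rewrite y0/= /y; lra.
pose e := y ^+ m / m%:R.
have e0 : 0 < e by rewrite divr_gt0// exprn_gt0.
exists ([set E | `|E - E0| < e / 2], [set C | m%:R + e <= C /\ 2 / e <= C]);
  first split=> /=.
- exists (e / 2) => /=; first by rewrite divr_gt0.
  by move=> E /=; rewrite distrC.
- near=> C; split; near: C; apply: nbhs_pinfty_ge; exact: num_real.
move=> [E C] /= [EE [C1 C2]].
have C0 : 0 < C by lra.
have Ce : C^-1 <= e / 2.
  have e2 : 0 < 2 / e by rewrite divr_gt0.
  by rewrite -[e / 2]invf_div lef_pV2.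
exists m%:R^-1, (0 +i* y); split.
- rewrite lef_pV2 ?posrE// invf_le1// ler1n m1 andbT; lra.
- by rewrite /normc/= expr0n add0r sqrtr_sqr gtr0_norm.
- apply: poly_approx_periodic.
    by move=> x; rewrite vp.
  move=> x x01 eta eta0.
  have [_ h] := gm x x01; have [p [p1 p2 p3]] := h y ym eta eta0.
  exists (p + (E0 - E)%:C%:P); split.
  + apply: le_trans (coef_normD _ _ _) _; first by rewrite invr_ge0 ltW.
    by rewrite coef_normC normc_real distrC; lra.
  + move=> t tm; rewrite hornerD hornerC opprD addrA.
    have -> : (v (x + t) - E)%:C - p.[t%:C] - (E0 - E)%:C =
      (v (x + t) - E0)%:C - p.[t%:C].
      by rewrite !rmorphB/=; ring.
    exact: p2.
  + rewrite hornerD hornerC; have := normcB_lower p.[0 +i* y] (E0 - E)%:C.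
    rewrite normc_real distrC -/e in p3 *; lra.
- apply: poly_approx_periodic => // x x01.
  have [_ h] := am x x01.
  apply: poly_approx_le (h y ym) => //.
  + by rewrite lexx invr_ge0 ltW.
  + lra.
  + exact: ltW.
Unshelve. all: by end_near.
Qed.

Lemma uniform_approx_energy (a : R -> R[i]) (v : R -> R) (K : R) :
  periodic1 v -> periodic1 a ->
  (forall s, power_series_at a s) -> (exists x, a x != 0) ->
  (forall s, power_series_at (fun x => (v x)%:C) s) ->
  (forall E, exists x, v x != E) ->
  \forall C \near +oo, forall E, `|E| <= K ->
    uniform_approx C (fun x => (v x - E)%:C) a.
Proof.
move=> vp ap aa anz va vnc.
have FF : Filter (nbhs (pinfty_nbhs R)) by exact: _.
have H := (compact_near_coveringP _).1 (@segment_compact R (- K) K) R _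
  (fun C E => uniform_approx C (fun x => (v x - E)%:C) a) FF
  (fun E _ => uniform_approx_near vp ap aa anz va (vnc E)).
by apply: (@filterS _ _ FF) H => C h E EK; apply: h; rewrite /= in_itv /= -ler_norml.
Qed.

Lemma uniform_approx_self (a : R -> R[i]) : periodic1 a ->
  (forall s, power_series_at a s) -> (exists x, a x != 0) ->
  \forall C \near +oo, uniform_approx C a a.
Proof.
move=> ap aa anz.
have [m [am m1]] : exists m, (forall x, 0 <= x <= 1 -> approx_level a m x) /\ (0 < m)%N.
  have : \forall m \near \oo,
    (forall x, 0 <= x <= 1 -> approx_level a m x) /\ (0 < m)%N.
    near=> m; split; last by near: m; exact: nbhs_infty_gt.
    by near: m; exact: approx_level_eventually.
  by move=> [m _ /(_ m (leqnn m)) ?]; exists m.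
have mR : 0 < m%:R :> R by rewrite ltr0n.
pose y : R := m%:R^-1 / 10.
have y0 : 0 < y by rewrite divr_gt0 ?invr_gt0.
have ym : 0 < y <= m%:R^-1.
  have : 0 < m%:R^-1 :> R by rewrite invr_gt0.
  by rewrite y0/= /y; lra.
pose e := y ^+ m / m%:R.
have e0 : 0 < e by rewrite divr_gt0// exprn_gt0.
near=> C.
have C1 : m%:R <= C by near: C; apply: nbhs_pinfty_ge; exact: num_real.
have C2 : e^-1 <= C by near: C; apply: nbhs_pinfty_ge; exact: num_real.
have C0 : 0 < C by lra.
have Ce : C^-1 <= e by rewrite -[e]invrK lef_pV2 ?posrE ?invr_gt0//.
have mm : 0 <= (m%:R^-1 : R) <= m%:R^-1 by rewrite lexx invr_ge0 ltW.
exists m%:R^-1, (0 +i* y); split.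
- by rewrite lef_pV2 ?posrE// C1 invf_le1// ler1n m1.
- by rewrite /normc/= expr0n add0r sqrtr_sqr gtr0_norm.
- apply: poly_approx_periodic => // x x01; have [_ h] := am x x01.
  exact: poly_approx_le mm C1 Ce (h y ym).
- apply: poly_approx_periodic => // x x01; have [_ h] := am x x01.
  exact: poly_approx_le mm C1 (ltW e0) (h y ym).
Unshelve. all: by end_near.
Qed.

End AnalyticCircle.

(** * Products and transfer matrices on a complex disc *)

Section PolyApproxAlgebra.
Variable R : realType.
Implicit Types (F G : R -> R[i]) (p q : {poly R[i]}).

Definition near_poly (rho eta : R) F (x : R) p : Prop :=
  forall t : R, `|t| <= rho -> normc (F (x + t) - p.[t%:C]) <= eta.

Lemma near_polyM rho eta K L F G x p q : 0 <= eta <= 1 -> 0 <= rho ->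
  coef_norm rho p <= K -> coef_norm rho q <= L ->
  near_poly rho eta F x p -> near_poly rho eta G x q ->
  near_poly rho ((K + L + 1) * eta) (fun y => F y * G y) x (p * q).
Proof.
move=> /andP[e0 e1] r0 pK qL hp hq t tr; rewrite hornerM.
have := hp t tr; have := hq t tr.
have tn : normc (t%:C : R[i]) <= rho by rewrite normc_real.
have pt := le_trans (horner_le_coef_norm p tn) pK.
have qt := le_trans (horner_le_coef_norm q tn) qL.
set a := p.[_] in pt *; set b := q.[_] in qt *.
set f := F _; set g := G _ => hg hf.
have -> : f * g - a * b = (f - a) * (g - b) + (a * (g - b) + b * (f - a)) by ring.
apply: le_trans (le_normcD _ _) _.
have h := le_normcD (a * (g - b)) (b * (f - a)); rewrite !normcM in h *.
have n1 := normc_ge0 (f - a); have n2 := normc_ge0 (g - b).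
have n3 := normc_ge0 a; have n4 := normc_ge0 b.
have h1 : normc (f - a) * normc (g - b) <= eta.
  by apply: (@le_trans _ _ (eta * 1)); [apply: ler_pM => //; lra|rewrite mulr1].
have h2 : normc a * normc (g - b) <= K * eta by exact: ler_pM.
have h3 : normc b * normc (f - a) <= L * eta by exact: ler_pM.
lra.
Qed.

Lemma near_polyB rho eta eta' F G x p q :
  near_poly rho eta F x p -> near_poly rho eta' G x q ->
  near_poly rho (eta + eta') (fun y => F y - G y) x (p - q).
Proof.
move=> hp hq t tr; rewrite hornerD hornerN.
have -> : F (x + t) - G (x + t) - (p.[t%:C] - q.[t%:C]) =
  (F (x + t) - p.[t%:C]) - (G (x + t) - q.[t%:C]) by ring.
apply: le_trans (le_normcD _ _) _; rewrite normcN.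
by apply: lerD; [exact: hp|exact: hq].
Qed.

Lemma near_poly_le rho eta eta' F x p : eta <= eta' ->
  near_poly rho eta F x p -> near_poly rho eta' F x p.
Proof. by move=> ee h t tr; apply: le_trans ee; exact: h. Qed.

Lemma near_poly_conj rho eta F x p : near_poly rho eta F x p ->
  near_poly rho eta (fun y => conjc (F y)) x (map_poly conjc p).
Proof.
move=> h t tr; have -> : t%:C = conjc (t%:C : R[i]) by rewrite /= oppr0.
by rewrite horner_map/= -rmorphB/= normc_conj; exact: h.
Qed.

Lemma poly_approx_shift rho K z eps F x s :
  poly_approx rho K z eps F (x + s) ->
  poly_approx rho K z eps (fun y => F (y + s)) x.
Proof.
move=> h eta eta0; have [p [p1 p2 p3]] := h eta eta0.
exists p; split=> // t tr.
have -> : x + t + s = x + s + t by ring.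
exact: p2.
Qed.

Lemma poly_approxZ rho K z eps F x c :
  poly_approx rho K z eps F x ->
  poly_approx rho (normc c * K) z (normc c * eps) (fun y => c * F y) x.
Proof.
move=> h eta eta0; have c0 := normc_ge0 c.
have e'0 : 0 < eta / (normc c + 1) by rewrite divr_gt0//; lra.
have [p [p1 p2 p3]] := h _ e'0; exists (c *: p); split.
- by rewrite coef_normZ ler_wpM2l.
- move=> t tr; rewrite hornerZ -mulrBr normcM.
  apply: (@le_trans _ _ (normc c * (eta / (normc c + 1)))).
    by rewrite ler_wpM2l// p2.
  by rewrite mulrA ler_pdivrMr; nra.
- by rewrite hornerZ normcM ler_wpM2l.
Qed.

Lemma poly_approxM rho z eps eps' F G x : 0 <= rho -> 0 <= eps -> 0 <= eps' ->
  poly_approx rho 1 z eps F x -> poly_approx rho 1 z eps' G x ->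
  poly_approx rho 1 z (eps * eps') (fun y => F y * G y) x.
Proof.
move=> r0 e0 e'0 hF hG eta eta0.
pose eta' := Num.min 1 (eta / 3).
have h0 : 0 < eta' by rewrite lt_min ltr01 divr_gt0.
have h1 : 0 <= eta' <= 1 by rewrite (ltW h0) ge_min lexx.
have h3 : eta' <= eta / 3 by rewrite ge_min lexx orbT.
have [p [p1 p2 p3]] := hF _ h0; have [q [q1 q2 q3]] := hG _ h0.
exists (p * q); split.
- apply: le_trans (coef_normM _ _ r0) _.
  by rewrite -[leRHS]mulr1 ler_pM ?coef_norm_ge0.
- apply: near_poly_le (near_polyM h1 r0 p1 q1 p2 q2); lra.
- by rewrite hornerM normcM; exact: ler_pM.
Qed.

Lemma poly_approx_prod rho z eps (F : nat -> R -> R[i]) x n :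
  0 <= rho -> 0 <= eps ->
  (forall k, poly_approx rho 1 z eps (F k) x) ->
  poly_approx rho 1 z (eps ^+ n) (fun y => \prod_(k < n) F k y) x.
Proof.
move=> r0 e0 h; elim: n => [|n IH].
  move=> eta eta0; exists 1; rewrite -polyC1 coef_normC normc1 expr0; split=> //.
    by move=> t tr; rewrite big_ord0 hornerC subrr normc0 ltW.
  by rewrite hornerC normc1.
have -> : (fun y => \prod_(k < n.+1) F k y) =
    (fun y => \prod_(k < n) F k y * F n y).
  by apply/funext => y; rewrite big_ord_recr.
by rewrite exprSr; exact: poly_approxM (exprn_ge0 n e0) e0 IH (h n).
Qed.

Lemma poly_approx_bound rho K z eps F x : 0 <= rho ->
  poly_approx rho K z eps F x -> normc (F x) <= K.
Proof.
move=> r0 h; apply/ler_addgt0Pr => e e0.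
have [p [p1 p2 _]] := h e e0.
have := p2 0; rewrite normr0 => /(_ r0); rewrite addr0 => h1.
have n0 : normc (0%:C : R[i]) <= rho by rewrite normc_real normr0.
have := horner_le_coef_norm p n0.
rewrite -[F x](subrK p.[0%:C]); have := le_normcD (F x - p.[0%:C]) p.[0%:C].
lra.
Qed.

(** First column of the [n]-step transfer matrix with entries
    [w, - conj a, a, 0], see [transfer_column] below. *)
Fixpoint column (w a : R -> R[i]) (omega : R) (n : nat) (x : R)
    : R[i] * R[i] :=
  if n is n'.+1 then
    let: (f, g) := column w a omega n' x in
    (w (x + n%:R * omega) * f - conjc (a (x + n%:R * omega)) * g,
     a (x + n.+1%:R * omega) * f)
  else (1, 0).

(** Where [|w| >= 2 T] with [T >= |a|], the cone [|g| <= |f|] is invariant and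
    [|f|] grows at each step by a factor at least [T]. *)
Lemma column_approx (w a : R -> R[i]) (omega rho B T : R) (z : R[i]) (x : R) :
  0 <= rho <= 1 -> normc z <= rho -> 1 <= B -> 0 <= T ->
  (forall x, poly_approx rho B z (2 * T) w x) ->
  (forall x, forall eta, 0 < eta -> exists q, [/\ coef_norm rho q <= B,
     near_poly rho eta a x q & coef_norm rho q <= T]) ->
  forall n eta, 0 < eta -> exists p q,
    [/\ coef_norm rho p <= (2 * B) ^+ n, coef_norm rho q <= (2 * B) ^+ n,
       near_poly rho eta (fun y => (column w a omega n y).1) x p,
       near_poly rho eta (fun y => (column w a omega n y).2) x q &
       normc q.[z] <= normc p.[z] /\ T ^+ n <= normc p.[z]].
Proof.
move=> /andP[r0 r1] zr B1 T0 hw ha; elim=> [|n IH] eta eta0.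
  exists 1, 0; rewrite -polyC1 coef_normC normc1 coef_norm0 expr0.
  split=> //.
  - by move=> t tr /=; rewrite hornerC subrr normc0 ltW.
  - by move=> t tr /=; rewrite horner0 subrr normc0 ltW.
  - by rewrite horner0 hornerC normc0 normc1.
set K := (2 * B) ^+ n in IH.
have K0 : 0 <= K by rewrite exprn_ge0//; lra.
pose eta' := Num.min 1 (eta / (2 * (B + K + 1))).
have d0 : 0 < 2 * (B + K + 1) by lra.
have h0 : 0 < eta' by rewrite lt_min ltr01 divr_gt0.
have h1 : 0 <= eta' <= 1 by rewrite (ltW h0) ge_min lexx.
have h2 : 2 * (B + K + 1) * eta' <= eta.
  by rewrite mulrC -ler_pdivlMr// ge_min lexx orbT.
have [p [q [pK qK pF qG [qp pT]]]] := IH eta' h0.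
have [pw [pw1 pw2 pw3]] := poly_approx_shift (hw (x + n.+1%:R * omega)) h0.
have [pa [pa1 pa2 pa3]] := ha (x + n.+1%:R * omega) eta' h0.
have [pb [pb1 pb2 pb3]] := ha (x + n.+2%:R * omega) eta' h0.
have sh s (pp : {poly R[i]}) : near_poly rho eta' a (x + s) pp ->
    near_poly rho eta' (fun y => a (y + s)) x pp.
  by move=> h t tr; have -> : x + t + s = x + s + t by [ring]; exact: h.
have rr : coef_norm rho (map_poly conjc pa) <= B by rewrite coef_norm_conj.
have BK : 0 <= B * K by rewrite mulr_ge0//; lra.
exists (pw * p - map_poly conjc pa * q), (pb * p); split.
- apply: le_trans (coef_normD _ _ r0) _.
  rewrite -[- _]scaleN1r coef_normZ normcN normc1 mul1r.
  rewrite exprS -/K.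
  have c1 : coef_norm rho (pw * p) <= B * K.
    by apply: le_trans (coef_normM _ _ r0) _; rewrite ler_pM ?coef_norm_ge0.
  have c2 : coef_norm rho (map_poly conjc pa * q) <= B * K.
    by apply: le_trans (coef_normM _ _ r0) _; rewrite ler_pM ?coef_norm_ge0.
  lra.
- apply: (@le_trans _ _ (B * K)); last by rewrite exprS -/K; lra.
  by apply: le_trans (coef_normM _ _ r0) _; rewrite ler_pM ?coef_norm_ge0.
- have m1 := @near_polyM rho eta' B K (fun y => w (y + n.+1%:R * omega)) _ x pw p
    h1 r0 pw1 pK pw2 pF.
  have m2 := near_polyM h1 r0 rr qK (near_poly_conj (sh _ _ pa2)) qG.
  have m3 := near_polyB m1 m2.
  have m4 : near_poly rho eta (fun y => w (y + n.+1%:R * omega) *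
      (column w a omega n y).1 - conjc (a (y + n.+1%:R * omega)) *
      (column w a omega n y).2) x (pw * p - map_poly conjc pa * q).
    by apply: near_poly_le m3; lra.
  by move=> t tr; have := m4 t tr; rewrite /=; case: (column _ _ _ _ _).
- have m1 := near_polyM h1 r0 pb1 pK (sh _ _ pb2) pF.
  have m4 : near_poly rho eta (fun y => a (y + n.+2%:R * omega) *
      (column w a omega n y).1) x (pb * p).
    by apply: near_poly_le m1; nra.
  by move=> t tr; have := m4 t tr; rewrite /=; case: (column _ _ _ _ _).
- have z1 : normc (map_poly conjc pa).[z] <= T.
    by apply: le_trans (horner_le_coef_norm _ zr) _; rewrite coef_norm_conj.
  have z2 : normc pb.[z] <= T by apply: le_trans (horner_le_coef_norm _ zr) pb3.
  have p0 := normc_ge0 p.[z]; have q0 := normc_ge0 q.[z].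
  have low : T * normc p.[z] <= normc (pw * p - map_poly conjc pa * q).[z].
    rewrite hornerD hornerN !hornerM.
    have := normcB_lower (pw.[z] * p.[z]) (- ((map_poly conjc pa).[z] * q.[z])).
    rewrite normcN !normcM.
    have g1 : 2 * T * normc p.[z] <= normc pw.[z] * normc p.[z] by rewrite ler_wpM2r.
    have g2 : normc (map_poly conjc pa).[z] * normc q.[z] <= T * normc p.[z].
      by apply: ler_pM => //; exact: normc_ge0.
    lra.
  split.
    apply: le_trans low; rewrite hornerM normcM ler_wpM2r//.
  by rewrite exprS; apply: le_trans low; rewrite ler_wpM2l.
Qed.

End PolyApproxAlgebra.

(** * Transfer matrices and their norms *)

Section Matrices.
Variable R : realType.
Local Notation C := R[i].

Lemma sum_I2 (V : nmodType) (F : 'I_2 -> V) : \sum_i F i = F 0 + F 1.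
Proof.
by rewrite !big_ord_recl big_ord0 addr0; congr (_ + F _); apply: val_inj.
Qed.

Lemma mx2_ext (A B : 'M[C]_2) : A 0 0 = B 0 0 -> A 0 1 = B 0 1 ->
  A 1 0 = B 1 0 -> A 1 1 = B 1 1 -> A = B.
Proof.
move=> h1 h2 h3 h4; apply/matrixP => i j.
have I2 (k : 'I_2) : k = 0 \/ k = 1.
  by case: k => [[|[|//]] k]; [left|right]; apply: val_inj.
by case: (I2 i) => ->; case: (I2 j) => ->.
Qed.

(** Submultiplicative, and equivalent to [opnorm] up to a factor that becomes
    negligible after division by [n] of the logarithms. *)
Definition entry_norm m (A : 'M[C]_m) : R := \sum_i \sum_j normc (A i j).

Lemma entry_norm_ge0 m (A : 'M[C]_m) : 0 <= entry_norm A.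
Proof. by apply: sumr_ge0 => i _; apply: sumr_ge0 => j _; exact: normc_ge0. Qed.

Lemma le_entry_norm m (A : 'M[C]_m) i j : normc (A i j) <= entry_norm A.
Proof.
have s0 k : 0 <= \sum_l normc (A k l).
  by apply: sumr_ge0 => l _; exact: normc_ge0.
rewrite /entry_norm (bigD1 i)//= (bigD1 j)//= -addrA lerDl addr_ge0//.
  by apply: sumr_ge0 => l _; exact: normc_ge0.
exact: sumr_ge0.
Qed.

Lemma entry_normM m (A B : 'M[C]_m) :
  entry_norm (A *m B) <= entry_norm A * entry_norm B.
Proof.
rewrite /entry_norm mulr_suml; apply: ler_sum => i _.
apply: (@le_trans _ _ (\sum_j \sum_k normc (A i k) * normc (B k j))).
  apply: ler_sum => j _; rewrite mxE; apply: le_trans (normc_sum _ _ _) _.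
  by apply: ler_sum => k _; rewrite normcM.
rewrite exchange_big mulr_suml/=; apply: ler_sum => k _.
rewrite -mulr_sumr ler_wpM2l ?normc_ge0//.
rewrite [leRHS](bigD1 k)//= lerDl.
apply: sumr_ge0 => l _; apply: sumr_ge0 => j _.
exact: normc_ge0.
Qed.

Lemma entry_norm2E (A : 'M[C]_2) : entry_norm A =
  normc (A 0 0) + normc (A 0 1) + (normc (A 1 0) + normc (A 1 1)).
Proof. by rewrite /entry_norm !sum_I2. Qed.

Definition det2 (A : 'M[C]_2) : C := A 0 0 * A 1 1 - A 0 1 * A 1 0.

Definition adj2 (A : 'M[C]_2) : 'M[C]_2 := \matrix_(i, j)
  if i == 0 then if j == 0 then A 1 1 else - A 0 1
  else if j == 0 then - A 1 0 else A 0 0.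

Lemma det2M (A B : 'M[C]_2) : det2 (A *m B) = det2 A * det2 B.
Proof. by rewrite /det2 !mxE !sum_I2; ring. Qed.

Lemma mulmx_adj2 (A : 'M[C]_2) : A *m adj2 A = (det2 A)%:M.
Proof.
by apply: mx2_ext; rewrite !mxE !sum_I2 !mxE /= /det2 ?mulr1n ?mulr0n; ring.
Qed.

Lemma entry_norm_adj2 (A : 'M[C]_2) : entry_norm (adj2 A) = entry_norm A.
Proof. by rewrite !entry_norm2E !mxE/= !normcN; ring. Qed.

Lemma entry_normZ m (c : C) (A : 'M[C]_m) :
  entry_norm (c *: A) = normc c * entry_norm A.
Proof.
rewrite /entry_norm mulr_sumr; apply: eq_bigr => i _.
by rewrite mulr_sumr; apply: eq_bigr => j _; rewrite mxE normcM.
Qed.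

Lemma det2_le_entry_norm (A : 'M[C]_2) : normc (det2 A) <= entry_norm A ^+ 2.
Proof.
apply: le_trans (le_normcD _ _) _; rewrite normcN !normcM entry_norm2E expr2.
have := normc_ge0 (A 0 0); have := normc_ge0 (A 0 1).
have := normc_ge0 (A 1 0); have := normc_ge0 (A 1 1); nra.
Qed.

Lemma vnorm_ge0 m (w : 'cV[C]_m) : 0 <= vnorm w.
Proof. exact: sqrtr_ge0. Qed.

Lemma le_vnorm m (w : 'cV[C]_m) i : normc (w i 0) <= vnorm w.
Proof.
rewrite -[leLHS](ger0_norm (normc_ge0 _)) -sqrtr_sqr ler_wsqrtr//.
by rewrite (bigD1 i)//= lerDl; apply: sumr_ge0 => j _; rewrite sqr_ge0.
Qed.

Lemma vnorm_le_sum m (w : 'cV[C]_m) : vnorm w <= \sum_i normc (w i 0).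
Proof.
have s0 : 0 <= \sum_i normc (w i 0) by apply: sumr_ge0 => i _; exact: normc_ge0.
rewrite -[leRHS](ger0_norm s0) -sqrtr_sqr ler_wsqrtr// expr2 mulr_sumr.
apply: ler_sum => i _; rewrite expr2 ler_wpM2r ?normc_ge0//.
by rewrite (bigD1 i)//= lerDl; apply: sumr_ge0 => j _; exact: normc_ge0.
Qed.

Lemma vnorm_mulmx m (A : 'M[C]_m) (w : 'cV[C]_m) :
  vnorm (A *m w) <= entry_norm A * vnorm w.
Proof.
apply: le_trans (vnorm_le_sum _) _; rewrite /entry_norm mulr_suml.
apply: ler_sum => i _; rewrite mxE mulr_suml; apply: le_trans (normc_sum _ _ _) _.
by apply: ler_sum => j _; rewrite normcM ler_wpM2l ?normc_ge0// le_vnorm.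
Qed.

Lemma vnormZ m (c : C) (w : 'cV[C]_m) : vnorm (c *: w) = normc c * vnorm w.
Proof.
rewrite -[normc c](ger0_norm (normc_ge0 c)) -sqrtr_sqr /vnorm -sqrtrM ?sqr_ge0//.
congr Num.sqrt; rewrite mulr_sumr; apply: eq_bigr => i _.
by rewrite mxE normcM exprMn.
Qed.

Lemma vnorm0 m : vnorm (0 : 'cV[C]_m) = 0.
Proof. by rewrite -(scale0r 0) vnormZ normc0 mul0r. Qed.

Lemma vnormD (u w : 'cV[C]_2) : vnorm (u + w) <= vnorm u + vnorm w.
Proof.
have vn2 (y : 'cV[C]_2) : vnorm y ^+ 2 = normc (y 0 0) ^+ 2 + normc (y 1 0) ^+ 2.
  by rewrite sqr_sqrtr ?sum_I2// addr_ge0 ?sqr_ge0.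
have := vn2 u; have := vn2 w; have := vnorm_ge0 u; have := vnorm_ge0 w.
set U := vnorm u; set W := vnorm w => W0 U0 hW hU.
rewrite -[leRHS](ger0_norm (addr_ge0 U0 W0)) -sqrtr_sqr ler_wsqrtr// sum_I2 !mxE.
have := le_normcD (u 0 0) (w 0 0); have := le_normcD (u 1 0) (w 1 0).
have := normc_ge0 (u 0 0 + w 0 0); have := normc_ge0 (u 1 0 + w 1 0).
have := normc_ge0 (u 0 0); have := normc_ge0 (w 0 0).
have := normc_ge0 (u 1 0); have := normc_ge0 (w 1 0).
move: hU hW; set a := normc (u 0 0); set b := normc (u 1 0).
set c := normc (w 0 0); set d := normc (w 1 0).
set e := normc (_ + _); set f := normc (_ + _) => hU hW d0 b0 c0 a0 f0 e0 fl el.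
have cs : a * c + b * d <= U * W.
  rewrite -[leLHS]ger0_norm; last by rewrite addr_ge0// mulr_ge0.
  rewrite -[leRHS]ger0_norm; last by rewrite mulr_ge0.
  rewrite -!sqrtr_sqr ler_wsqrtr// exprMn hU hW.
  have := sqr_ge0 (a * d - b * c); nra.
have e2 : e ^+ 2 <= (b + d) ^+ 2 by rewrite lerXn2r ?nnegrE ?addr_ge0.
have f2 : f ^+ 2 <= (a + c) ^+ 2 by rewrite lerXn2r ?nnegrE ?addr_ge0.
nra.
Qed.

Lemma opnorm_has_sup m (A : 'M[C]_m) :
  has_sup [set vnorm (A *m w) | w in [set w | vnorm w <= 1]].
Proof.
split; first by exists (vnorm (A *m 0)); exists 0 => //=; rewrite vnorm0.
exists (entry_norm A) => _ [w /= w1 <-]; apply: le_trans (vnorm_mulmx _ _) _.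
by rewrite ler_piMr// entry_norm_ge0.
Qed.

Lemma opnorm_ub m (A : 'M[C]_m) w : vnorm w <= 1 -> vnorm (A *m w) <= opnorm A.
Proof.
move=> w1; apply: (sup_upper_bound (opnorm_has_sup A)).
by apply: imageP.
Qed.

Lemma opnorm_le m (A : 'M[C]_m) (c : R) :
  (forall w, vnorm w <= 1 -> vnorm (A *m w) <= c) -> opnorm A <= c.
Proof.
move=> h; apply: ge_sup; first by case: (opnorm_has_sup A).
by move=> _ [w w1 <-]; exact: h.
Qed.

Lemma opnorm_le_entry_norm m (A : 'M[C]_m) : opnorm A <= entry_norm A.
Proof.
apply: opnorm_le => w w1; apply: le_trans (vnorm_mulmx _ _) _.
by rewrite ler_piMr// entry_norm_ge0.
Qed.

Lemma opnorm_ge0 m (A : 'M[C]_m) : 0 <= opnorm A.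
Proof.
apply: le_trans (opnorm_ub A (w := 0) _); first exact: vnorm_ge0.
by rewrite vnorm0.
Qed.

Lemma entry_le_opnorm m (A : 'M[C]_m) i j : normc (A i j) <= opnorm A.
Proof.
apply: le_trans (opnorm_ub A (w := delta_mx j 0) _).
  apply: le_trans (le_vnorm _ i); rewrite mxE (bigD1 j)//= big1 ?addr0.
    by rewrite mxE !eqxx mulr1.
  by move=> k kj; rewrite mxE (negbTE kj) mulr0.
rewrite /vnorm (bigD1 j)//= big1 ?addr0.
  by rewrite mxE !eqxx normc1 expr1n sqrtr1.
by move=> k kj; rewrite mxE (negbTE kj) normc0 expr0n.
Qed.

Lemma entry_norm_le_opnorm (A : 'M[C]_2) : entry_norm A <= 4 * opnorm A.
Proof.
rewrite entry_norm2E.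
have := entry_le_opnorm A 0 0; have := entry_le_opnorm A 0 1.
have := entry_le_opnorm A 1 0; have := entry_le_opnorm A 1 1; lra.
Qed.

Lemma opnormZ_le m (c : C) (A : 'M[C]_m) : opnorm (c *: A) <= normc c * opnorm A.
Proof.
apply: opnorm_le => w w1; rewrite -scalemxAl vnormZ ler_wpM2l ?normc_ge0//.
exact: opnorm_ub.
Qed.

Lemma opnormZ m (c : C) (A : 'M[C]_m) : opnorm (c *: A) = normc c * opnorm A.
Proof.
apply/eqP; rewrite eq_le opnormZ_le/=.
have [->|c0] := eqVneq c 0; first by rewrite normc0 mul0r opnorm_ge0.
have c0' : 0 < normc c by rewrite lt_neqAle normc_ge0 andbT eq_sym normc_eq0.
have := opnormZ_le c^-1 (c *: A).
by rewrite scalerA mulVf// scale1r normcV ler_pdivlMl.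
Qed.

Lemma opnorm_dist (A B : 'M[C]_2) : opnorm A <= opnorm B + entry_norm (A - B).
Proof.
apply: opnorm_le => w w1; rewrite -{1}[A](subrK B) addrC mulmxDl.
apply: le_trans (vnormD _ _) _; apply: lerD; first exact: opnorm_ub.
apply: le_trans (vnorm_mulmx _ _) _.
by rewrite ler_piMr// entry_norm_ge0.
Qed.

End Matrices.

Section Transfer.
Variables (R : realType) (w a : R -> R[i]) (omega : R).

Definition transfer_step (x : R) : 'M[R[i]]_2 := \matrix_(i, j)
  if i == 0 then if j == 0 then w x else - conjc (a x)
  else if j == 0 then a (x + omega) else 0.

Fixpoint transfer (n : nat) (x : R) : 'M[R[i]]_2 :=
  if n is n'.+1 then transfer_step (x + n%:R * omega) *m transfer n' x
  else 1%:M.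

Lemma shiftS n x : x + n%:R * omega + omega = x + n.+1%:R * omega.
Proof. by rewrite -natr1; ring. Qed.

Lemma transfer_column n x :
  transfer n x 0 0 = (column w a omega n x).1 /\
  transfer n x 1 0 = (column w a omega n x).2.
Proof.
elim: n => [|n [IH1 IH2]]; first by split; rewrite mxE.
rewrite [transfer _ _]/= [column _ _ _ _ _]/=.
move: IH1 IH2; case: (column _ _ _ _ _) => f g /= h1 h2.
by split; rewrite !mxE !sum_I2 !mxE/= h1 h2 ?shiftS; ring.
Qed.

Lemma transferD n k x :
  transfer (n + k) x = transfer n (x + k%:R * omega) *m transfer k x.
Proof.
elim: n => [|n IH]; first by rewrite /= mul1mx.
rewrite addSn /= IH mulmxA; congr (transfer_step _ *m _ *m _).
by rewrite -addSn natrD; ring.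
Qed.

Lemma det2_transfer n x : det2 (transfer n x) =
  \prod_(k < n) (conjc (a (x + k.+1%:R * omega)) * a (x + k.+2%:R * omega)).
Proof.
elim: n => [|n IH].
  by rewrite big_ord0 /det2 !mxE/= mulr1 mulr0 subr0.
rewrite big_ord_recr/= -IH det2M mulrC; congr (_ * _).
by rewrite /det2 !mxE/= shiftS mulr0 sub0r mulNr opprK.
Qed.

(** From [A_n (x + k omega) A_k (x) = A_k (x + n omega) A_n (x)]: the base point
    of [A_n] can be moved at the cost of two factors [A_k] and of the inverse of
    a determinant. *)
Lemma transfer_conj n k x :
  normc (det2 (transfer k x)) * entry_norm (transfer n (x + k%:R * omega)) <=
  entry_norm (transfer k (x + n%:R * omega)) * entry_norm (transfer n x)
    * entry_norm (transfer k x).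
Proof.
rewrite -entry_normZ -(entry_norm_adj2 (transfer k x)).
have -> : det2 (transfer k x) *: transfer n (x + k%:R * omega) =
    transfer k (x + n%:R * omega) *m transfer n x *m adj2 (transfer k x).
  rewrite -transferD addnC transferD -mulmxA mulmx_adj2.
  by rewrite -mul_mx_scalar.
apply: le_trans (entry_normM _ _) _; rewrite ler_wpM2r ?entry_norm_ge0//.
exact: entry_normM.
Qed.

Lemma entry_norm_transfer (S : R) n x : 0 <= S ->
  (forall y, normc (w y) + normc (a y) + normc (a (y + omega)) <= S) ->
  entry_norm (transfer n x) <= 2 * S ^+ n.
Proof.
have n01 : (0 == 1 :> 'I_2) = false by [].
have n10 : (1 == 0 :> 'I_2) = false by [].
move=> S0 hS; elim: n => [|n IH] /=.
  rewrite entry_norm2E !mxE !eqxx n01 n10 !mulr1n !mulr0n normc0 normc1 expr0.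
  lra.
apply: le_trans (entry_normM _ _) _; rewrite exprS mulrCA.
apply: ler_pM; rewrite ?entry_norm_ge0//.
rewrite entry_norm2E !mxE !eqxx n10 normcN normc_conj normc0 addr0.
exact: hS.
Qed.

End Transfer.

Section JacobiTransfer.
Variables (R : realType) (v : R -> R) (a : R -> R[i]) (la lv E omega : R).
Hypothesis la0 : 0 < la.

Definition jacobi_w (x : R) : R[i] := ((lv * v x - E) / la)%:C.

Lemma jacobi_mxE x : jacobi_mx v a la lv E omega x =
  (a (x + omega))^-1 *: transfer_step jacobi_w a omega x.
Proof.
have laC : la%:C != 0 :> R[i] by rewrite -normc_eq0 normc_real normr_eq0 gt_eqF.
have lE : (lv * v x - E)%:C = la%:C * jacobi_w x.
  by rewrite /jacobi_w -rmorphM/= mulrCA divff ?mulr1// gt_eqF.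
apply: mx2_ext; rewrite !mxE/= invfM.
- by rewrite lE mulrACA mulVf// mul1r.
- rewrite !mulrN mulrACA mulVf// mul1r; congr (- _).
- by rewrite mulrACA mulVf// mul1r.
- by rewrite !mulr0.
Qed.

Lemma jacobi_mxnE n x : jacobi_mxn v a la lv n E omega x =
  (\prod_(k < n) a (x + k.+2%:R * omega))^-1 *: transfer jacobi_w a omega n x.
Proof.
elim: n => [|n IH].
  by rewrite /jacobi_mxn big_nil big_ord0 invr1 scale1r.
have -> : jacobi_mxn v a la lv n.+1 E omega x =
    jacobi_mx v a la lv E omega (x + n.+1%:R * omega) *m
    jacobi_mxn v a la lv n E omega x.
  have -> : jacobi_mxn v a la lv n.+1 E omega x =
    \prod_(k <- n.+1 :: rev (iota 1 n)) jacobi_mx v a la lv E omega (x + k%:R * omega).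
    rewrite /jacobi_mxn; congr (\big[_/_]_(k <- _) _).
    by rewrite -[X in iota 1 X]addn1 iotaD rev_cat/= add1n.
  by rewrite big_cons.
rewrite IH jacobi_mxE -scalemxAl -scalemxAr scalerA big_ord_recr/= invfM.
by rewrite mulrC shiftS.
Qed.

Lemma jacobi_uE n x : jacobi_u v a la lv n E omega x =
  n%:R^-1 * ln ((\prod_(k < n) normc (a (x + k.+2%:R * omega)))^-1 *
     opnorm (transfer jacobi_w a omega n x)).
Proof. by rewrite /jacobi_u jacobi_mxnE opnormZ normcV normc_prod. Qed.

End JacobiTransfer.

(** * Denominators of the cocycle *)

Section Tails.
Variable R : realType.

Definition regular_rotation (Q omega : R) : Prop := forall N,
  expR (- Q * N%:R) <= \prod_(i < N) circle_dist (i.+1%:R * omega).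

Lemma inv_pow_ge_expR (A B : R) n : 0 < B -> B <= expR A ->
  expR (- A * n%:R) <= B^-1 ^+ n.
Proof.
move=> B0 BA; rewrite mulrC expRM_natl lerXn2r ?nnegrE ?expR_ge0 ?invr_ge0 ?(ltW B0)//.
by rewrite expRN lef_pV2 ?posrE ?expR_gt0.
Qed.

(** For the product over [2 n + 2] steps of the orbit, started at most [n]
    steps before [x], the recurrence bound applies to [x] itself, since the
    factors are at most [1]. *)
Lemma cocycle_denominator_tail (a : R -> R[i]) (C : R) :
  periodic1 a -> 1 <= C -> uniform_approx C a a ->
  exists (T c : R) (n1 : nat), [/\ 1 <= T, 0 < c & forall n Q omega t,
    (n1 <= n)%N -> 1 <= Q -> regular_rotation Q omega -> T * Q <= t ->
    small [set x | \prod_(k < n.+2) (normc (a (x + k%:R * omega)) / C)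
                     < expR (- t * n%:R)]
          (expR (- c * t * n%:R))].
Proof.
move=> ap C1 [rho [z [rC zr aa _]]].
have C0 : 0 < C by lra.
have r01 : 0 <= rho by case/andP: rC => h _; apply: le_trans h; rewrite invr_ge0 ltW.
have A1 : 1 <= 2 * C by lra.
have [C' [c' [C'1 c'0 H]]] := small_recurrence A1.
have k0 : 0 < 3^-1 :> R by [].
have [n1 Hn] := H _ k0.
exists (3 * C'), (c' / 3), (n1 + 2)%N; split; [lra|by rewrite divr_gt0|].
move=> n Q omega t n1n Q1 reg tQ.
have n2 : (2 <= n)%N := leq_trans (leq_addl n1 2) n1n.
have n1n' : (n1 <= n)%N := leq_trans (leq_addr 2 n1) n1n.
pose M := (2 * n + 2)%N.
pose b x := (C^-1)%:C * a x.
have nb x : normc (b x) = normc (a x) / C.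
  by rewrite normcM normc_real gtr0_norm ?invr_gt0// mulrC.
have b1 x : 0 <= normc (a x) / C <= 1.
  rewrite divr_ge0 ?normc_ge0 ?(ltW C0)//= ler_pdivrMr// mul1r.
  exact: poly_approx_bound (aa x).
pose F x := \prod_(j < M) b (x + (j%:R - n%:R) * omega).
have Fp : periodic1 F.
  move=> x; apply: eq_bigr => j _; rewrite /b; congr (_ * _).
  by rewrite -[RHS]ap; congr a; ring.
have Fa x : poly_approx rho 1 z (expR (- (2 * C) * M%:R)) F x.
  have e1 : expR (- (2 * C) * M%:R) <= (C^-1 * C^-1) ^+ M.
    rewrite -invfM; apply: inv_pow_ge_expR; first by rewrite mulr_gt0.
    rewrite mulr_natl mulr2n expRD; have := expR_ge_id C.
    by move=> h; apply: ler_pM => //; exact: ltW.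
  have r1 : 0 <= rho <= rho by rewrite r01 lexx.
  apply: (poly_approx_le r1 (lexx 1) e1).
  apply: (poly_approx_prod (F := fun j y => b (y + (j%:R - n%:R) * omega))) => //.
    by rewrite mulr_ge0// invr_ge0 ltW.
  move=> j; apply: (poly_approx_shift (F := b)).
  have := @poly_approxZ R rho C z C^-1 a (x + (j%:R - n%:R) * omega) (C^-1)%:C (aa _).
  by rewrite normc_real gtr0_norm ?invr_gt0// mulVf ?gt_eqF.
have MR : M%:R <= 3 * n%:R :> R by rewrite -natrM ler_nat /M; clear -n2; lia.
have h1 : (n1 <= M)%N by rewrite /M; clear -n1n'; lia.
have h2 : 3^-1 * M%:R <= n%:R :> R by rewrite mulrC ler_pdivrMr// mulrC.
have h3 : (n <= M)%N by rewrite /M; clear; lia.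
have h4 : C' * Q <= t / 3 by rewrite ler_pdivlMr//; lra.
have h5 : (2 * C)^-1 <= rho <= 1.
  case/andP: rC => h ->; rewrite andbT; apply: le_trans h.
  by rewrite lef_pV2 ?posrE ?mulr_gt0//; lra.
apply: small_sub (Hn M n Q rho (t / 3) omega z F h1 h2 h3 Q1 reg h5 zr Fp Fa h4).
- move=> x [/= hx _] k kn.
  apply: (@le_trans _ _ (expR (- t * n%:R))); last first.
    rewrite ler_expR !mulNr lerN2.
    have t0 : 0 <= t by apply: le_trans tQ; rewrite !mulr_ge0//; lra.
    by rewrite mulrAC ler_pdivrMr// -mulrA ler_wpM2l// mulrC.
  apply: le_trans (ltW hx); rewrite /F normc_prod.
  have -> : M = ((n - k) + (n.+2 + k))%N by rewrite /M; clear -kn; lia.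
  rewrite !big_split_ord/=.
  have p01 (m : nat) (G : nat -> R) : 0 <= \prod_(i < m) normc (b (G i)) <= 1.
    rewrite prodr_ge0//=; last by move=> *; exact: normc_ge0.
    by apply: Num.Theory.prodr_ile1 => i _; rewrite nb.
  set P1 := \prod_(i < n - k) _; set P2 := \prod_(i < n.+2) _ ; set P3 := \prod_(i < k) _.
  have -> : \prod_(k0 < n.+2) (normc (a (x + k0%:R * omega)) / C) = P2.
    apply: eq_bigr => i _; rewrite -nb; congr (normc (b _)).
    by rewrite !natrD natrB//; ring.
  have /andP[? ?] : 0 <= P1 <= 1 by exact: (p01 _ (fun i => x + k%:R * omega + (i%:R - n%:R) * omega)).
  have /andP[? ?] : 0 <= P2 <= 1.
    exact: (p01 _ (fun i => x + k%:R * omega + ((n - k + i)%:R - n%:R) * omega)).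
  have /andP[? ?] : 0 <= P3 <= 1.
    exact: (p01 _ (fun i => x + k%:R * omega + ((n - k + (n.+2 + i))%:R - n%:R) * omega)).
  have : P2 * P3 <= P2 by rewrite ler_piMr.
  have : P1 * (P2 * P3) <= P2 * P3 by rewrite ler_piMl// mulr_ge0.
  lra.
- by rewrite ler_expR le_eqVlt; apply/orP; left; apply/eqP; ring.
Qed.

End Tails.

(** * Reduction to bounds on the transfer matrices *)

Section Cases.
Variable R : realType.

Lemma prod_window (b : nat -> R) (i r N : nat) : (forall k, 0 <= b k <= 1) ->
  (i + r <= N)%N -> \prod_(k < N) b k <= \prod_(k < r) b (i + k)%N.
Proof.
move=> b01 irN; rewrite -(subnKC irN) !big_split_ord/=.
have p0 m (G : nat -> nat) : 0 <= \prod_(k < m) b (G k).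
  by apply: prodr_ge0 => k _; case/andP: (b01 (G k)).
have p1 m (G : nat -> nat) : \prod_(k < m) b (G k) <= 1.
  by apply: Num.Theory.prodr_ile1.
have h1 := p0 i id; have h2 := p1 i id.
have h3 := p0 r (addn i); have h5 := p0 (N - (i + r))%N (addn (i + r)).
have h6 := p1 (N - (i + r))%N (addn (i + r)).
set X := \prod_(k < i) _ in h1 h2 *; set Y := \prod_(k < r) _ in h3 *.
set Z := \prod_(k < N - (i + r)) _ in h5 h6 *.
by apply: (@le_trans _ _ (X * Y)); [rewrite ler_piMr ?mulr_ge0|rewrite ler_piMl].
Qed.

Lemma le_expR_natM (n : nat) (x y : R) : 0 <= x -> x <= expR y ->
  x ^+ n <= expR (n%:R * y).
Proof.
by move=> x0 xy; rewrite expRM_natl lerXn2r ?nnegrE ?expR_ge0.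
Qed.

Lemma expR_ge4 (x : R) : 2 <= x -> 4 <= expR x.
Proof.
move=> x2; apply: (@le_trans _ _ (expR 2)); last by rewrite ler_expR.
have := expR_ge1Dx (1 : R); have -> : (2 : R) = 1 + 1 by lra.
by rewrite expRD => ?; nra.
Qed.

Section JacobiBound.
Variables (v : R -> R) (a : R -> R[i]) (la lv E omega C : R).
Hypotheses (la0 : 0 < la) (C1 : 1 <= C) (aC : forall y, normc (a y) <= C).

Let b01 y : 0 <= normc (a y) / C <= 1.
Proof.
have C0 : 0 < C by apply: lt_le_trans C1.
by rewrite divr_ge0 ?normc_ge0 ?(ltW C0)//= ler_pdivrMr// mul1r aC.
Qed.

(** The product over [n + 2] points bounds below both the denominators here and
    the determinants in [det_lower], which involve shifted ranges of indices. *)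
Lemma jacobi_u_bound (m s t : R) (n : nat) (x : R) : (0 < n)%N ->
  expR (- t * n%:R) <= \prod_(k < n.+2) (normc (a (x + k%:R * omega)) / C) ->
  expR (n%:R * (m - s)) <= opnorm (transfer (jacobi_w v la lv E) a omega n x) ->
  opnorm (transfer (jacobi_w v la lv E) a omega n x) <= expR (n%:R * (m + s)) ->
  `|jacobi_u v a la lv n E omega x - m| <= s + t + C.
Proof.
move=> n0 hP hl hu; rewrite jacobi_uE//.
have n0' : 0 < n%:R :> R by rewrite ltr0n.
have C0 : 0 < C by apply: lt_le_trans C1.
set O := opnorm _ in hl hu *; set P := \prod_(k < n) _.
have O0 : 0 < O by apply: lt_le_trans hl; exact: expR_gt0.
have PC : P / C ^+ n = \prod_(k < n) (normc (a (x + k.+2%:R * omega)) / C).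
  by rewrite big_split/= prodr_const card_ord exprVn.
have P1 : expR (- t * n%:R) <= P / C ^+ n.
  apply: (le_trans hP); rewrite PC.
  by apply: (prod_window (b := fun k => normc (a (x + k%:R * omega)) / C) (i := 2)).
have P2 : P / C ^+ n <= 1 by rewrite PC; apply: Num.Theory.prodr_ile1.
have Cn0 : 0 < C ^+ n by rewrite exprn_gt0.
have P0 : 0 < P.
  have := lt_le_trans (expR_gt0 (- t * n%:R)) P1.
  by rewrite pmulr_lgt0// invr_gt0.
have lnC : 0 <= ln C <= C.
  by rewrite ln_ge0//= -[leRHS]expRK ler_ln ?posrE ?expR_gt0// expR_ge_id.
have lnP : ln P = ln (P / C ^+ n) + n%:R * ln C.
  by rewrite -{1}(divfK (lt0r_neq0 Cn0) P) lnM ?posrE ?divr_gt0// lnXn// mulr_natl.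
have l1 : - t * n%:R <= ln (P / C ^+ n).
  by rewrite -[leLHS]expRK ler_ln ?posrE ?expR_gt0 ?divr_gt0.
have l2 : ln (P / C ^+ n) <= 0 by rewrite -ln1 ler_ln ?posrE ?divr_gt0.
have l3 : n%:R * (m - s) <= ln O by rewrite -[leLHS]expRK ler_ln ?posrE ?expR_gt0.
have l4 : ln O <= n%:R * (m + s) by rewrite -[leRHS]expRK ler_ln ?posrE ?expR_gt0.
rewrite lnM ?posrE ?invr_gt0// lnV ?posrE// lnP.
have nC : n%:R * ln C <= n%:R * C by rewrite ler_pM2l//; case/andP: lnC.
have nC0 : 0 <= n%:R * ln C by rewrite mulr_ge0//; case/andP: lnC.
have -> : forall X, n%:R^-1 * X - m = n%:R^-1 * (X - n%:R * m).
  by move=> X; rewrite mulrBr mulrA mulVf ?mul1r// gt_eqF.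
rewrite normrM gtr0_norm ?invr_gt0// ler_pdivrMl// ler_norml.
move: l1 l2 l3 l4 nC nC0; rewrite !mulrDr !mulrN mulNr [t * _]mulrC.
move: (n%:R * ln C) (n%:R * C) (n%:R * m) (n%:R * s) (n%:R * t) (ln O) (ln _).
by move=> *; apply/andP; split; lra.
Qed.

Lemma jacobi_opnorm_upper (S : R) n x : 0 < S -> (0 < n)%N ->
  (forall y, normc (jacobi_w v la lv E y) + 2 * C <= S) ->
  opnorm (transfer (jacobi_w v la lv E) a omega n x) <= (2 * S) ^+ n.
Proof.
move=> S0 n0 hS; apply: le_trans (opnorm_le_entry_norm _) _.
apply: le_trans (entry_norm_transfer n x (ltW S0) _) _.
  by move=> y; have := hS y; have := aC y; have := aC (y + omega); lra.
rewrite exprMn ler_wpM2r ?exprn_ge0 ?(ltW S0)//.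
by rewrite -[leLHS]expr1 ler_weXn2l// ler1n.
Qed.

Lemma det_lower (t : R) (n k : nat) (x : R) : (k <= n)%N ->
  expR (- t * n%:R) <= \prod_(j < n.+2) (normc (a (x + j%:R * omega)) / C) ->
  expR (- t * n%:R) ^+ 2 <=
    normc (det2 (transfer (jacobi_w v la lv E) a omega k x)).
Proof.
move=> kn hP; rewrite det2_transfer normc_prod.
under eq_bigr do rewrite normcM normc_conj.
rewrite big_split/= expr2.
have b01' j := b01 (x + j%:R * omega).
have C0 : 0 < C by apply: lt_le_trans C1.
have W i : (i <= 2)%N -> expR (- t * n%:R) <=
    \prod_(j < k) normc (a (x + (i + j)%:R * omega)).
  move=> i2; apply: (le_trans hP).
  have h : (i + k <= n.+2)%N by rewrite -addn2 addnC leq_add.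
  apply: le_trans (prod_window b01' h) _; apply: ler_prod => j _.
  rewrite divr_ge0 ?normc_ge0 ?(ltW C0)//= ler_pdivrMr// ler_peMr ?normc_ge0//.
by apply: ler_pM; rewrite ?expR_ge0//; [exact: (W 1%N)|exact: (W 2%N)].
Qed.

End JacobiBound.

End Cases.

(** * Nonconstant potentials *)

Section HyperbolicCase.
Variable R : realType.

(** The main case: [v - E'] is bounded below on some horizontal line, where the
    transfer matrices are then uniformly hyperbolic for large [Lam]; this makes
    the top left entry of the transfer matrices nearly as large as possible
    there, hence, by [small_recurrence], large at some point among the next [N]
    points of the orbit of most [x]. Moving from that point back to [x] costs
    at most a factor [4 (3 Lam C) ^ (2 N)] and a determinant, and [N] is taken to
    be a fraction of order [1 / ln Lam] of [n] to compensate for the former. *)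
Lemma tail_hyperbolic (v : R -> R) (a : R -> R[i]) (C : R) :
  periodic1 v -> periodic1 a -> 1 <= C -> uniform_approx C a a ->
  (forall y, normc (a y) <= C) ->
  exists T : R, 1 <= T /\ forall Lam : R, 2 * C ^+ 2 <= Lam ->
  exists (c : R) (n1 : nat), 0 < c /\
  forall (la lv E' : R), 0 < la -> 0 < lv -> lv / la = Lam ->
  uniform_approx C (fun x => (v x - E')%:C) a ->
  forall n Q omega t, (n1 <= n)%N -> 1 <= Q -> regular_rotation Q omega ->
  T * Q <= t ->
  small [set x | (7 * C + 9) * t <
           `|jacobi_u v a la lv n (lv * E') omega x - ln Lam|]
        (2 * expR (- c * t * n%:R)).
Proof.
move=> vp ap C1 aa aC.
have [Ta [ca [na [Ta1 ca0 Ha]]]] := cocycle_denominator_tail ap C1 aa.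
have A1 : 1 <= 4 * C ^+ 2 by nra.
have [T0 [c0 [T01 c00 H0]]] := small_recurrence A1.
exists (Num.max Ta T0); split; first by rewrite le_max Ta1.
move=> Lam LamC.
have C0 : 0 < C by lra.
have C40 : 0 < 4 * C ^+ 2 by lra.
have AC : (4 * C ^+ 2)^-1 <= C^-1 by rewrite lef_pV2 ?posrE; nra.
have Lam2 : 2 <= Lam by nra.
have Lam0 : 0 < Lam by lra.
pose B := Lam * C.
have CB : C <= B by rewrite /B ler_peMl; lra.
have B1 : 1 <= B by lra.
have B20 : 0 < 2 * B by lra.
pose T := Lam / (2 * C).
have TC : C <= T by rewrite /T ler_pdivlMr; nra.
have Tpos : 0 <= T by lra.
have T2 : Lam / C = 2 * T by rewrite /T; field; lra.
have TB : T = (4 * C ^+ 2)^-1 * (2 * B) by rewrite /T /B; field; lra.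
have LamB : Lam <= 2 * B by rewrite /B; nra.
pose S := 3 * (Lam * C).
have S6 : 6 <= S by rewrite /S; nra.
have S0 : 0 < S by lra.
have S1 : 1 <= S by lra.
have lnS1 : 1 <= ln S.
  rewrite -[leLHS]expRK ler_ln ?posrE ?expR_gt0//.
  by apply: le_trans (expR1_le4 R) _; lra.
have lnS0 : 0 <= ln S by lra.
(* Chosen so that [S ^ N <= exp (n / 2)] when [N <= kap * n]. *)
pose kap := (2 * ln S)^-1.
have kapS y : kap * y * ln S = y / 2.
  by rewrite /kap; field; apply/eqP; lra.
have kap0 : 0 < kap by rewrite invr_gt0; lra.
have kap1 : kap <= 1 by rewrite invf_le1; lra.
have k20 : 0 < kap / 2 by rewrite divr_gt0.
have [n0 Hn] := H0 _ k20.
pose c := Num.min ca (c0 * (kap / 2)).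
have cpos : 0 < c by rewrite lt_min ca0 mulr_gt0.
exists c, (na + n0 + (Num.truncn (2 / kap)).+1)%N; split=> //.
move=> la lv E' la0 lv0 lvla [rho [z [rC zr va ua]]] n Q omega t n1n Q1 reg TQ.
have [nan n0n nk] : [/\ (na <= n)%N, (n0 <= n)%N & (Num.truncn (2 / kap) < n)%N].
  by clear -n1n; split; lia.
have npos : (0 < n)%N by apply: leq_trans nk.
have nR : 1 <= n%:R :> R by rewrite ler1n.
have TaQ : Ta * Q <= t.
  by apply: le_trans TQ; rewrite ler_wpM2r ?le_max ?lexx// (le_trans ler01).
have T0Q : T0 * Q <= t.
  by apply: le_trans TQ; rewrite ler_wpM2r ?le_max ?lexx ?orbT// (le_trans ler01).
have t1 : 1 <= t.
  by apply: le_trans TaQ; rewrite -[leLHS]mulr1; apply: ler_pM.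
pose N := Num.truncn (kap * n%:R).
have kn0 : 0 <= kap * n%:R by rewrite mulr_ge0// ltW.
have N1 : N%:R <= kap * n%:R by case/andP: (truncn_itv kn0).
have N2 : kap / 2 * n%:R <= N%:R.
  have /andP[_ h] := truncn_itv kn0.
  have h2 : 2 <= kap * n%:R.
    rewrite mulrC -ler_pdivrMr//; apply: le_trans (ltW (truncnS_gt _)) _.
    by rewrite ler_nat.
  have : kap * n%:R < N%:R + 1 by rewrite natr1.
  lra.
have Nn : (N <= n)%N.
  by rewrite -(ler_nat R); apply: le_trans N1 _; rewrite ler_piMl.
set w := jacobi_w v la lv (lv * E').
have wE y : w y = Lam%:C * (v y - E')%:C.
  rewrite /w /jacobi_w -rmorphM/=; congr (_%:C).
  by rewrite -lvla mulrAC; congr (_ / _); ring.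
have [r0 r1] : 0 <= rho /\ rho <= 1.
  by case/andP: rC => h ?; split=> //; apply: le_trans h; rewrite invr_ge0 ltW.
have LamR : normc (Lam%:C : R[i]) = Lam by rewrite normc_real gtr0_norm.
have Fw x : poly_approx rho B z (2 * T) w x.
  have := poly_approxZ Lam%:C (va x); rewrite LamR -/B.
  rewrite T2.
  by rewrite (_ : (fun y => Lam%:C * (v y - E')%:C) = w)//; apply/funext.
have Fa x eta : 0 < eta -> exists q, [/\ coef_norm rho q <= B,
     near_poly rho eta a x q & coef_norm rho q <= T].
  move=> e0; have [q [q1 q2 _]] := ua x eta e0; exists q; split=> //.
    exact: le_trans CB.
  exact: le_trans TC.
have zr' : normc z <= rho by apply: le_trans zr _; rewrite ler_pdivrMr// ler_peMr// ler1n.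
pose F x := ((2 * B) ^- n)%:C * (column w a omega n x).1.
have Bn0 : 0 < (2 * B) ^+ n by rewrite exprn_gt0.
have Fn x : normc (F x) = normc (column w a omega n x).1 / (2 * B) ^+ n.
  by rewrite normcM normc_real gtr0_norm ?invr_gt0// mulrC.
have Fp : periodic1 F.
  move=> x; rewrite /F; congr (_ * _.1).
  elim: n {n1n nan n0n nk npos nR N kn0 N1 N2 Nn F Bn0 Fn} => //= n ->.
  have sh f k : periodic1 f -> f (x + 1 + k%:R * omega) = f (x + k%:R * omega) :> R[i].
    by move=> fp; rewrite -[RHS]fp; congr f; ring.
  have wp : periodic1 w by move=> y; rewrite !wE vp.
  by rewrite !sh.
have Fapp x : poly_approx rho 1 z (expR (- (4 * C ^+ 2) * n%:R)) F x.
  move=> eta eta0.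
  have r01 : 0 <= rho <= 1 by rewrite r0.
  have e0 : 0 < (2 * B) ^+ n * eta by rewrite mulr_gt0.
  have [p [q [p1 _ p3 _ [_ p5]]]] :=
    column_approx omega x r01 zr' B1 Tpos Fw Fa n e0.
  exists (((2 * B) ^- n)%:C *: p); split.
  - by rewrite coef_normZ normc_real gtr0_norm ?invr_gt0// mulrC ler_pdivrMr// mul1r.
  - move=> s sr; rewrite hornerZ -mulrBr normcM normc_real gtr0_norm ?invr_gt0//.
    by rewrite mulrC ler_pdivrMr// mulrC; exact: p3.
  - rewrite hornerZ normcM normc_real gtr0_norm ?invr_gt0//.
    rewrite [leRHS]mulrC ler_pdivlMr//; apply: le_trans p5.
    rewrite [in leRHS]TB [leRHS]exprMn ler_wpM2r ?(ltW Bn0)//; apply: inv_pow_ge_expR; last exact: expR_ge_id.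
    exact: C40.
have rA : (4 * C ^+ 2)^-1 <= rho <= 1.
  case/andP: rC => h ->; rewrite andbT; apply: le_trans h.
  exact: AC.
have sU := Hn n N Q rho t omega z F n0n N2 Nn Q1 reg rA zr Fp Fapp T0Q.
have sA := Ha n Q omega t nan Q1 reg TaQ.
have t0 : 0 < t := lt_le_trans ltr01 t1.
apply: small_sub (small_union sA sU).
  move=> x [/= hx _]; apply: contrapT => /not_orP[] /= /negP; rewrite -leNgt => hA hU.
  have [k kN hk] : exists2 k, (k <= N)%N &
      expR (- t * n%:R) < normc (F (x + k%:R * omega)).
    apply: contrapT => nex; apply: hU => k kN; rewrite leNgt; apply/negP => lt.
    by apply: nex; exists k.
  move: hx; apply/negP; rewrite -leNgt.
  apply: (@le_trans _ _ ((6 * C + 3 * t + 5) + t + C)); last first.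
    by clear -C1 t1; nra.
  have wS y : normc (w y) + 2 * C <= S.
    have -> : normc (w y) = Lam * normc (v y - E')%:C by rewrite wE normcM LamR.
    have := ler_wpM2l (ltW Lam0) (poly_approx_bound r0 (va y)).
    by move: C0 Lam2; rewrite /S; clear; set p := normc _; nra.
  apply: jacobi_u_bound => //; last first.
    apply: le_trans (@jacobi_opnorm_upper R v a la lv (lv * E') omega C aC S n x S0 npos wS) _.
    apply: le_expR_natM; first by rewrite mulr_ge0// ltW.
    rewrite expRD lnK ?posrE//.
    have -> : 2 * S = Lam * (6 * C) by rewrite /S; ring.
    rewrite ler_wpM2l ?(ltW Lam0)//; apply: le_trans (expR_ge_id _) _.
    by rewrite ler_expR -addrA lerDl addr_ge0 ?mulr_ge0 ?(ltW t0).
  set e0 := entry_norm (transfer w a omega n x).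
  have e0h : e0 <= 4 * opnorm (transfer w a omega n x) by exact: entry_norm_le_opnorm.
  suff h : 4 * expR (n%:R * (ln Lam - (6 * C + 3 * t + 5))) <= e0.
    by rewrite -(ler_pM2l (_ : 0 < 4 :> R))// (le_trans h).
  have := transfer_conj w a omega n k x; rewrite -/e0.
  have kn : (k <= n)%N := leq_trans kN Nn.
  have dl := @det_lower R v a la lv (lv * E') omega C C1 aC t n k x kn hA.
  rewrite -/w in dl.
  have el : expR (- t * n%:R) * (2 * B) ^+ n <=
      entry_norm (transfer w a omega n (x + k%:R * omega)).
    apply: le_trans (le_entry_norm _ 0 0).
    have [-> _] := transfer_column w a omega n (x + k%:R * omega).
    by move: hk; rewrite Fn ltr_pdivlMr// => /ltW.
  have up y : entry_norm (transfer w a omega k y) <= 2 * expR (n%:R / 2).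
    apply: le_trans (entry_norm_transfer k y (ltW S0) _) _.
      move=> y'; apply: le_trans (wS y'); rewrite -addrA lerD2l mulr_natl mulr2n.
      exact: lerD.
    rewrite ler_pM2l//; apply: (@le_trans _ _ (S ^+ N)).
      by rewrite ler_weXn2l.
    rewrite -{1}[S]lnK ?posrE// -expRM_natl ler_expR.
    apply: (@le_trans _ _ (kap * n%:R * ln S)); first by rewrite ler_wpM2r.
    by rewrite kapS.
  move=> hc.
  have en0 : 0 <= e0 by exact: entry_norm_ge0.
  have X1 : expR (- t * n%:R) ^+ 2 * (expR (- t * n%:R) * (2 * B) ^+ n) <=
      4 * expR n%:R * e0.
    apply: (@le_trans _ _ (2 * expR (n%:R / 2) * e0 * (2 * expR (n%:R / 2)))).
      apply: le_trans (le_trans hc _).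
        by apply: ler_pM; rewrite ?exprn_ge0 ?mulr_ge0 ?expR_ge0 ?(ltW Bn0).
      apply: ler_pM; rewrite ?mulr_ge0 ?entry_norm_ge0//.
      by apply: ler_pM; rewrite ?entry_norm_ge0.
    have -> : expR n%:R = expR (n%:R / 2) * expR (n%:R / 2) :> R.
      by rewrite -expRD -splitr.
    rewrite le_eqVlt; apply/orP; left; apply/eqP; ring.
  have X2 : expR (n%:R * ln Lam) <= (2 * B) ^+ n.
    by rewrite expRM_natl lnK ?posrE// lerXn2r ?nnegrE ?(ltW Lam0) ?(ltW B20).
  have X3 : expR (- t * n%:R) ^+ 2 * (expR (- t * n%:R) * expR (n%:R * ln Lam))
      <= 4 * expR n%:R * e0.
    by apply: le_trans X1; rewrite ler_wpM2l ?exprn_ge0 ?expR_ge0// ler_wpM2l ?expR_ge0.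
  have e4 : 4 <= expR (2 * n%:R) :> R by apply: expR_ge4; rewrite ler_peMr.
  have X4 : 4 * expR (n%:R * (ln Lam - (6 * C + 3 * t + 5))) * (4 * expR n%:R) <=
     expR (- t * n%:R) ^+ 2 * (expR (- t * n%:R) * expR (n%:R * ln Lam)).
    apply: (@le_trans _ _ (expR (2 * n%:R) * expR (n%:R * (ln Lam - (6 * C + 3 * t + 5)))
       * (expR (2 * n%:R) * expR n%:R))).
      by apply: ler_pM; rewrite ?mulr_ge0 ?expR_ge0// ler_wpM2r ?expR_ge0.
    rewrite -expRM_natl -!expRD ler_expR.
    have : 0 <= n%:R * (6 * C) by rewrite !mulr_ge0// ltW.
    by move: nR; clear; set x := n%:R; move=> *; lra.
  rewrite -(ler_pM2r (mulr_gt0 (_ : 0 < 4) (expR_gt0 n%:R)))//.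
  by apply: le_trans X4 _; rewrite [e0 * _]mulrC.
rewrite mulr_natl mulr2n; apply: lerD; rewrite ler_expR !mulNr lerN2.
  by rewrite -!mulrA ler_wpM2r ?mulr_ge0 ?(ltW t0)// ge_min lexx.
apply: (@le_trans _ _ (c0 * t * (kap / 2 * n%:R))).
  have -> : c0 * t * (kap / 2 * n%:R) = c0 * (kap / 2) * (t * n%:R) by ring.
  by rewrite -mulrA ler_wpM2r ?mulr_ge0 ?(ltW t0)// ge_min lexx orbT.
by rewrite ler_wpM2l// mulr_ge0// ltW.
Qed.

End HyperbolicCase.

(** * Constant potentials, and the tails in general *)

Section ConstantCase.
Local Arguments normc : simpl never.
Variable R : realType.

Lemma column_cone (w a : R -> R[i]) (omega T : R) n x : 0 <= T ->
  (forall y, 2 * T <= normc (w y)) -> (forall y, normc (a y) <= T) ->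
  normc (column w a omega n x).2 <= normc (column w a omega n x).1 /\
  T ^+ n <= normc (column w a omega n x).1.
Proof.
move=> T0 hw ha; elim: n => [|n] /=; first by rewrite normc0 normc1 expr0.
case: (column _ _ _ _ _) => f g /= [gf fT].
have low : T * normc f <= normc (w (x + n.+1%:R * omega) * f -
    conjc (a (x + n.+1%:R * omega)) * g).
  have := normcB_lower (w (x + n.+1%:R * omega) * f)
    (- (conjc (a (x + n.+1%:R * omega)) * g)).
  rewrite normcN !normcM normc_conj.
  have := ler_wpM2r (normc_ge0 f) (hw (x + n.+1%:R * omega)).
  have := ler_pM (normc_ge0 _) (normc_ge0 g) (ha (x + n.+1%:R * omega)) gf.
  lra.
split; apply: le_trans low; first by rewrite normcM ler_wpM2r ?normc_ge0.
by rewrite exprS ler_wpM2l.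
Qed.

(** A constant potential only shifts the energy: the matrices are uniformly
    hyperbolic, or their norms are bounded above independently of the couplings
    and below by their determinants. *)
Lemma tail_constant (a : R -> R[i]) (C : R) :
  periodic1 a -> 1 <= C -> uniform_approx C a a ->
  (forall y, normc (a y) <= C) ->
  exists (T c : R) (n1 : nat), [/\ 1 <= T, 0 < c &
  forall (v : R -> R) (v0 la lv E : R), (forall x, v x = v0) -> 0 < la ->
  exists m, forall n Q omega t, (n1 <= n)%N -> 1 <= Q ->
  regular_rotation Q omega -> T * Q <= t ->
  small [set x | (9 * C + 9) * t < `|jacobi_u v a la lv n E omega x - m|]
        (expR (- c * t * n%:R))].
Proof.
move=> ap C1 aa aC.
have [T [c [n1 [T1 c0 H]]]] := cocycle_denominator_tail ap C1 aa.
exists T, c, n1.+1; split=> // v v0 la lv E vE la0.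
pose tau := (lv * v0 - E) / la.
have wE y : jacobi_w v la lv E y = tau%:C by rewrite /jacobi_w vE.
have wN y : normc (jacobi_w v la lv E y) = `|tau| by rewrite wE normc_real.
have reduce m s n Q omega t : (n1.+1 <= n)%N -> 1 <= Q ->
    regular_rotation Q omega -> T * Q <= t ->
    s + t + C <= (9 * C + 9) * t ->
    (forall x, expR (- t * n%:R) <=
       \prod_(k < n.+2) (normc (a (x + k%:R * omega)) / C) ->
      expR (n%:R * (m - s)) <= opnorm (transfer (jacobi_w v la lv E) a omega n x) /\
      opnorm (transfer (jacobi_w v la lv E) a omega n x) <= expR (n%:R * (m + s))) ->
    small [set x | (9 * C + 9) * t < `|jacobi_u v a la lv n E omega x - m|]
        (expR (- c * t * n%:R)).
  move=> n1n Q1 reg TQ sD hx.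
  apply: small_sub (H n Q omega t (ltnW n1n) Q1 reg TQ); last exact: lexx.
  move=> x [/= hD _]; rewrite ltNge; apply/negP => hP.
  have [h1 h2] := hx x hP.
  move: hD; apply/negP; rewrite -leNgt; apply: le_trans sD.
  by apply: jacobi_u_bound => //; apply: leq_trans n1n.
have t1 Q t : 1 <= Q -> T * Q <= t -> 1 <= t.
  by move=> Q1; apply: le_trans; rewrite -[leLHS]mulr1; apply: ler_pM => //; lra.
have [big|small_tau] := lerP (2 * C) `|tau|.
- exists (ln `|tau|) => n Q omega t n1n Q1 reg TQ.
  have t1' := t1 Q t Q1 TQ.
  have n0 : (0 < n)%N by apply: leq_trans n1n.
  have tau0 : 0 < `|tau| by lra.
  apply: (reduce _ 2 n Q omega t) => //; first by nra.
  have e2 : 4 <= expR 2 :> R by exact: expR_ge4.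
  have e2' : expR (-2) <= 2^-1 :> R.
    by rewrite expRN lef_pV2 ?posrE ?expR_gt0//; lra.
  move=> x _; split.
    apply: le_trans (entry_le_opnorm _ 0 0).
    have [-> _] := transfer_column (jacobi_w v la lv E) a omega n x.
    have [|||_ h] := @column_cone (jacobi_w v la lv E) a omega (`|tau| / 2) n x.
    + lra.
    + by move=> y; rewrite wN; lra.
    + by move=> y; apply: le_trans (aC y) _; lra.
    apply: le_trans h; rewrite expRM_natl lerXn2r ?nnegrE ?expR_ge0 ?divr_ge0//.
    by rewrite expRD lnK ?posrE// ler_wpM2l.
  have S0 : 0 < 2 * `|tau| by lra.
  apply: le_trans (@jacobi_opnorm_upper R v a la lv E omega C aC (2 * `|tau|) n x S0 n0 _) _.
    by move=> y; rewrite wN; lra.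
  apply: le_expR_natM; first by lra.
  rewrite expRD lnK ?posrE//; nra.
- exists 0 => n Q omega t n1n Q1 reg TQ.
  have t1' := t1 Q t Q1 TQ.
  have n0 : (0 < n)%N by apply: leq_trans n1n.
  apply: (reduce _ (8 * C + t + 2) n Q omega t) => //; first by nra.
  move=> x hP; split.
    have dl := @det_lower R v a la lv E omega C C1 aC t n n x (leqnn n) hP.
    have e1 := entry_norm_le_opnorm (transfer (jacobi_w v la lv E) a omega n x).
    have e2 : expR (- t * n%:R) <= entry_norm (transfer (jacobi_w v la lv E) a omega n x).
      have := le_trans dl (det2_le_entry_norm _).
      by rewrite ler_pXn2r ?nnegrE ?expR_ge0 ?entry_norm_ge0.
    have nR : 1 <= n%:R :> R by rewrite ler1n.
    have e3 : 4 <= expR (2 * n%:R) :> R by apply: expR_ge4; lra.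
    rewrite -(ler_pM2l (_ : 0 < 4))//; apply: le_trans e1; apply: le_trans e2.
    apply: (@le_trans _ _ (expR (2 * n%:R) * expR (n%:R * (0 - (8 * C + t + 2))))).
      by rewrite ler_wpM2r ?expR_ge0.
    by rewrite -expRD ler_expR; nra.
  have S0 : 0 < 4 * C by lra.
  apply: le_trans (@jacobi_opnorm_upper R v a la lv E omega C aC (4 * C) n x S0 n0 _) _.
    by move=> y; rewrite wN; lra.
  apply: le_expR_natM; first by lra.
  by apply: le_trans (expR_ge_id _) _; rewrite ler_expR; lra.
Qed.

(** The centre [m] is [ln (lv / la)] when [v] is not constant; as [D] and [T]
    depend only on [v] and [a], it absorbs the dependence on the couplings. *)
Theorem deviation_tails (v : R -> R) (a : R -> R[i]) (K : R) :
  periodic1 v -> analytic (@idfun R) v ->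
  periodic1 a -> analytic (real_complex R) a -> (exists x, a x != 0) ->
  exists D T : R, [/\ 1 <= D, 1 <= T & forall la, 0 < la ->
  exists lambda0 : R, forall lv, 0 < lv -> lambda0 < lv ->
  exists (n1 : nat) (c : R), 0 < c /\
  forall E, `|E| <= K * (la + lv) ->
  exists m, forall n Q omega t, (n1 <= n)%N -> 1 <= Q ->
  regular_rotation Q omega -> T * Q <= t ->
  small [set x | D * t < `|jacobi_u v a la lv n E omega x - m|]
        (2 * expR (- c * t * n%:R))].
Proof.
move=> vp /analytic_real_series va ap /analytic_complex_series aa anz.
have aself := uniform_approx_self ap aa anz.
have ubound C : uniform_approx C a a -> 1 <= C -> forall y, normc (a y) <= C.
  move=> [rho [z [/andP[rC _] _ ha _]]] C1 y.
  apply: poly_approx_bound (ha y); apply: le_trans rC.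
  by rewrite invr_ge0; lra.
have [[v0 vE]|vnc] := pselect (exists v0, forall x, v x = v0).
  have [C [C1 Ca]] : exists C, 1 <= C /\ uniform_approx C a a.
    have : \forall C \near +oo, 1 <= C /\ uniform_approx C a a.
      near=> C; split; first by near: C; apply: nbhs_pinfty_ge; exact: num_real.
      by near: C.
    by move=> /filter_ex.
  have [T [c [n1 [T1 c0 H]]]] := tail_constant ap C1 Ca (ubound C Ca C1).
  exists (9 * C + 9), T; split=> //; first by lra.
  move=> la la0; exists 0 => lv lv0 _; exists n1, c; split=> // E _.
  have [m hm] := H v v0 la lv E vE la0.
  exists m => n Q omega t n1n Q1 reg TQ.
  apply: small_sub (hm n Q omega t n1n Q1 reg TQ) => [x []//|].
  by rewrite ler_peMl ?expR_ge0// ler1n.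
have vnc' E : exists x, v x != E.
  apply: contrapT => h; apply: vnc; exists E => x.
  by apply/eqP; apply: contraT => ne; exfalso; apply: h; exists x.
have aen := uniform_approx_energy (2 * `|K|) vp ap aa anz va vnc'.
have [C [C1 [Ca Ce]]] : exists C, 1 <= C /\ uniform_approx C a a /\
    forall E, `|E| <= 2 * `|K| -> uniform_approx C (fun x => (v x - E)%:C) a.
  have : \forall C \near +oo, 1 <= C /\ uniform_approx C a a /\
    forall E, `|E| <= 2 * `|K| -> uniform_approx C (fun x => (v x - E)%:C) a.
    near=> C; split; first by near: C; apply: nbhs_pinfty_ge; exact: num_real.
    by split; near: C.
  by move=> /filter_ex.
have [T [T1 H]] := tail_hyperbolic vp ap C1 Ca (ubound C Ca C1).
exists (7 * C + 9), T; split=> //; first by lra.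
move=> la la0; exists (la * (2 * C ^+ 2)) => lv lv0 lvl.
have LamC : 2 * C ^+ 2 <= lv / la by rewrite ler_pdivlMr// mulrC ltW.
have [c [n1 [c0 Hc]]] := H (lv / la) LamC.
exists n1, c; split=> // E EK; exists (ln (lv / la)).
have E'K : `|E / lv| <= 2 * `|K|.
  rewrite normrM [`|lv^-1|]gtr0_norm ?invr_gt0// ler_pdivrMr//.
  apply: (le_trans EK); apply: (@le_trans _ _ (`|K| * (la + lv))).
    by rewrite ler_wpM2r ?ler_norm// addr_ge0 ?ltW.
  have : la <= lv by apply: le_trans (ltW lvl); rewrite ler_peMr ?(ltW la0)//; nra.
  by have := normr_ge0 K; nra.
move=> n Q omega t n1n Q1 reg TQ.
have := Hc la lv (E / lv) la0 lv0 erefl (Ce _ E'K) n Q omega t n1n Q1 reg TQ.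
by rewrite [lv * (E / lv)]mulrC divfK// gt_eqF.
Unshelve. all: by end_near.
Qed.

End ConstantCase.

(** * Measurability and integration *)

Section Continuity.
Variable R : realType.
Implicit Types (f g : R -> R[i]).

(** Continuity at all points, expressed through the real modulus. *)
Definition ccontinuous f : Prop :=
  forall s e : R, 0 < e -> \forall x \near s, normc (f x - f s) <= e.

Lemma power_series_ccontinuous f :
  (forall s, power_series_at f s) -> ccontinuous f.
Proof.
move=> fa s e e0; have [f0|] := leading_term_bound (fa s).
  have fs : f s = 0 by exact: (@nbhs_singleton R s _ f0).
  by near=> x; rewrite fs (near f0 x)// subrr normc0 ltW.
move=> [_ [h [M [_ [p [h0 _ pM gp _]]]]]].
have e4 : 0 < e / 4 by rewrite divr_gt0.
have [d hd] := small_geometric M e4.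
have n0 : normc (0 : R[i]) <= 0 by rewrite normc0.
have [q [pE qn]] := coef_norm_div (p d) n0 (ltW h0).
have qM : h * coef_norm h q <= M.
  have := coef_norm_ge0 (p d) (lexx 0); have := pM d; rewrite subr0 in qn; lra.
have M0 : 0 <= M by apply: le_trans qM; rewrite mulr_ge0 ?coef_norm_ge0 ?ltW.
near=> x.
have xh : `|x - s| <= h.
  by near: x; exists h => //= y /=; rewrite distrC; exact: ltW.
have xe : `|x - s| <= e * h / (4 * (M + 1)).
  near: x; exists (e * h / (4 * (M + 1))) => /=.
    by rewrite divr_gt0 ?mulr_gt0//; lra.
  by move=> y /=; rewrite distrC; exact: ltW.
have p1 := le_trans (gp (x - s) d xh) (hd d (leqnn d)).
rewrite [s + _]addrC subrK in p1.
have s0 : `|0 : R| <= h by rewrite normr0 ltW.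
have p2 := le_trans (gp 0 d s0) (hd d (leqnn d)); rewrite addr0 in p2.
have p3 : normc ((p d).[(x - s)%:C] - (p d).[0%:C]) <= e / 4.
  have -> : (p d).[(x - s)%:C] - (p d).[0%:C] = q.[(x - s)%:C] * (x - s)%:C.
    rewrite {1}pE hornerD hornerM hornerXsubC hornerC subr0; ring.
  rewrite normcM normc_real.
  have qx : normc q.[(x - s)%:C] <= coef_norm h q.
    by apply: horner_le_coef_norm; rewrite normc_real.
  apply: (@le_trans _ _ (coef_norm h q * (e * h / (4 * (M + 1))))).
    by apply: ler_pM => //; exact: normc_ge0.
  rewrite mulrA ler_pdivrMr; last by lra.
  have : e * (h * coef_norm h q) <= e * M by rewrite ler_pM2l.
  lra.
have -> : f x - f s = (f x - (p d).[(x - s)%:C]) +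
  ((p d).[(x - s)%:C] - (p d).[0%:C]) - (f s - (p d).[0%:C]) by ring.
apply: le_trans (le_normcD _ _) _; rewrite normcN.
have := le_normcD (f x - (p d).[(x - s)%:C]) ((p d).[(x - s)%:C] - (p d).[0%:C]).
lra.
Unshelve. all: by end_near.
Qed.

Lemma ccontinuous_cst (c : R[i]) : ccontinuous (fun=> c).
Proof. by move=> s e e0; near=> x; rewrite subrr normc0 ltW. Unshelve. all: by end_near. Qed.

Lemma ccontinuousD f g : ccontinuous f -> ccontinuous g ->
  ccontinuous (fun x => f x + g x).
Proof.
move=> cf cg s e e0; have e2 : 0 < e / 2 by rewrite divr_gt0.
near=> x; have -> : f x + g x - (f s + g s) = (f x - f s) + (g x - g s) by ring.
apply: le_trans (le_normcD _ _) _.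
have h1 : normc (f x - f s) <= e / 2 by near: x; exact: cf.
have h2 : normc (g x - g s) <= e / 2 by near: x; exact: cg.
lra.
Unshelve. all: by end_near.
Qed.

Lemma ccontinuousM f g : ccontinuous f -> ccontinuous g ->
  ccontinuous (fun x => f x * g x).
Proof.
move=> cf cg s e e0; pose K := normc (f s) + normc (g s) + 1.
have f0 := normc_ge0 (f s); have g0 := normc_ge0 (g s).
have K0 : 0 < K by rewrite /K; lra.
pose e' := Num.min 1 (e / K).
have e'0 : 0 < e' by rewrite lt_min ltr01 divr_gt0.
have e'1 : e' <= 1 by rewrite ge_min lexx.
have e'e : K * e' <= e by rewrite mulrC -ler_pdivlMr// ge_min lexx orbT.
near=> x.
have h1 : normc (f x - f s) <= e' by near: x; exact: cf.
have h2 : normc (g x - g s) <= e' by near: x; exact: cg.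
have -> : f x * g x - f s * g s =
  (f x - f s) * (g x - g s) + (f s * (g x - g s) + g s * (f x - f s)) by ring.
apply: le_trans (le_normcD _ _) _.
have := le_normcD (f s * (g x - g s)) (g s * (f x - f s)); rewrite !normcM.
have n1 := normc_ge0 (f x - f s); have n2 := normc_ge0 (g x - g s).
have h3 : normc (f x - f s) * normc (g x - g s) <= e' * 1.
  by apply: ler_pM => //; exact: le_trans e'1.
have h4 := ler_wpM2l f0 h2; have h5 := ler_wpM2l g0 h1.
rewrite /K in e'e; lra.
Unshelve. all: by end_near.
Qed.

Lemma ccontinuous_conj f : ccontinuous f -> ccontinuous (fun x => conjc (f x)).
Proof.
move=> cf s e e0; apply: filterS (cf s e e0) => x.
by rewrite -rmorphB/= normc_conj.
Qed.

Lemma ccontinuous_shift f (t : R) :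
  ccontinuous f -> ccontinuous (fun x => f (x + t)).
Proof.
move=> cf s e e0; have [d /= d0 hd] := cf (s + t) e e0.
exists d => //= x /= xs; apply: hd => /=.
by have -> : s + t - (x + t) = s - x by ring.
Qed.

Lemma continuous_normc f : ccontinuous f -> continuous (fun x => normc (f x)).
Proof.
move=> cf s; apply/cvgrPdist_le => e e0.
apply: filterS (cf s e e0) => x h; apply: le_trans h.
have := normcB_lower (f x) (- f s); have := normcB_lower (f s) (- f x).
rewrite !normcN [normc (f s - f x)]normcB => h1 h2.
by rewrite ler_norml; apply/andP; split; lra.
Qed.

Lemma continuous_opnorm (M : R -> 'M[R[i]]_2) :
  (forall i j, ccontinuous (fun x => M x i j)) ->
  continuous (fun x => opnorm (M x)).
Proof.
move=> cM s; apply/cvgrPdist_le => e e0.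
have e4 : 0 < e / 4 by rewrite divr_gt0.
near=> x.
have h1 : normc (M x 0 0 - M s 0 0) <= e / 4 by near: x; exact: cM.
have h2 : normc (M x 0 1 - M s 0 1) <= e / 4 by near: x; exact: cM.
have h3 : normc (M x 1 0 - M s 1 0) <= e / 4 by near: x; exact: cM.
have h4 : normc (M x 1 1 - M s 1 1) <= e / 4 by near: x; exact: cM.
have hm : entry_norm (M x - M s) <= e by rewrite entry_norm2E !mxE; lra.
have hm' : entry_norm (M s - M x) <= e.
  apply: le_trans hm; rewrite le_eqVlt -opprB -scaleN1r entry_normZ normcN normc1.
  by rewrite mul1r eqxx.
rewrite ler_distl lerBlDr; apply/andP; split.
  by apply: le_trans (opnorm_dist (M x) (M s)) _; rewrite lerD2l.
by apply: le_trans (opnorm_dist (M s) (M x)) _; rewrite lerD2l.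
Unshelve. all: by end_near.
Qed.

Lemma ccontinuous_transfer (w a : R -> R[i]) omega n :
  ccontinuous w -> ccontinuous a ->
  forall i j, ccontinuous (fun x => transfer w a omega n x i j).
Proof.
move=> cw ca; elim: n => [|n IH] i j /=; first exact: ccontinuous_cst.
have -> : (fun x => (transfer_step w a omega (x + n.+1%:R * omega) *m
    transfer w a omega n x) i j) = (fun x =>
    transfer_step w a omega (x + n.+1%:R * omega) i 0 * transfer w a omega n x 0 j
    + transfer_step w a omega (x + n.+1%:R * omega) i 1 * transfer w a omega n x 1 j).
  by apply/funext => x; rewrite mxE sum_I2.
have cs k l : ccontinuous (fun x => transfer_step w a omega (x + n.+1%:R * omega) k l).
  apply: (ccontinuous_shift (f := fun y => transfer_step w a omega y k l)).
  have -> : (fun y => transfer_step w a omega y k l) = (fun y =>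
     if k == 0 then if l == 0 then w y else - conjc (a y)
     else if l == 0 then a (y + omega) else 0).
    by apply/funext => y; rewrite mxE.
  case: (k == 0); case: (l == 0) => //.
  - have -> : (fun y => - conjc (a y)) = (fun y => -1 * conjc (a y)).
      by apply/funext => y; rewrite mulN1r.
    by apply: ccontinuousM (@ccontinuous_cst (-1)) (ccontinuous_conj ca).
  - exact: ccontinuous_shift.
  - exact: ccontinuous_cst.
by apply: ccontinuousD; apply: ccontinuousM.
Qed.

Lemma ccontinuous_periodic_bounded f : periodic1 f -> ccontinuous f ->
  exists K, forall x, normc (f x) <= K.
Proof.
move=> fp cf.
have FF : Filter (nbhs (pinfty_nbhs R)) by exact: _.
have near_bound (s : R) : \forall x \near s & K \near pinfty_nbhs R, normc (f x) <= K.
  exists ([set x | normc (f x - f s) <= 1], [set K | normc (f s) + 1 <= K]).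
    split=> /=; first exact: cf.
    by apply: nbhs_pinfty_ge; exact: num_real.
  move=> [x K] /= [h1 h2]; apply: le_trans h2; rewrite -[f x](subrK (f s)).
  by apply: le_trans (le_normcD _ _) _; lra.
have H := (compact_near_coveringP _).1 (@segment_compact R 0 1) R _
  (fun K x => normc (f x) <= K) FF (fun s _ => near_bound s).
have [K hK] := filter_ex H.
exists K => x; rewrite -(periodic1_int fp x (Num.floor x)).
apply: hK; rewrite /= in_itv/=.
have /andP[h1 h2] := floor_itv x; rewrite intrD in h2.
by apply/andP; split; lra.
Qed.

End Continuity.

Section Integration.
Variable R : realType.

Lemma measurable_jacobi_u (v : R -> R) (a : R -> R[i]) (la lv E omega : R) n :
  0 < la -> ccontinuous (fun x => (v x)%:C) -> ccontinuous a ->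
  measurable_fun [set: measurableTypeR R] (jacobi_u v a la lv n E omega).
Proof.
move=> la0 cv ca.
have cw : ccontinuous (jacobi_w v la lv E).
  have -> : jacobi_w v la lv E =
      (fun x => (lv / la)%:C * (v x)%:C + (- (E / la))%:C).
    by apply/funext => x; rewrite /jacobi_w -rmorphM -rmorphD/=; congr (_%:C); ring.
  apply: ccontinuousD (@ccontinuous_cst _ _).
  exact: ccontinuousM (@ccontinuous_cst _ _) cv.
pose P x : R := \prod_(k < n) normc (a (x + k.+2%:R * omega)).
pose O x : R := opnorm (transfer (jacobi_w v la lv E) a omega n x).
have uE : jacobi_u v a la lv n E omega = (fun x => n%:R^-1 * ln (P x `^ (-1) * O x)).
  apply/funext => x; rewrite jacobi_uE// powR_inv1//.
  by apply: prodr_ge0 => k _; exact: normc_ge0.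
have mP : measurable_fun [set: measurableTypeR R] P.
  apply: measurable_prod => k _.
  apply: continuous_measurable_fun; apply: continuous_normc.
  exact: (ccontinuous_shift (k.+2%:R * omega) ca).
have mO : measurable_fun [set: measurableTypeR R] O.
  apply: continuous_measurable_fun; apply: continuous_opnorm => i j.
  exact: ccontinuous_transfer.
rewrite uE; apply: measurable_funM => //.
apply: measurableT_comp => //; apply: measurable_funM => //.
exact: (measurableT_comp (measurable_powR _)).
Qed.

Lemma circle_measureT : circle_measure R [set: R] = 1%E.
Proof.
rewrite /circle_measure /= /mrestr setTI lebesgue_measure_itv/= lte_fin ltr01.
by rewrite oppr0 adde0.
Qed.

Lemma measurable_superlevel (f : R -> R) (r : R) :
  measurable_fun [set: measurableTypeR R] f ->
  measurable ([set x | r < `|f x|] : set (measurableTypeR R)).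
Proof.
move=> mf; have -> : [set x | r < `|f x|] = (fun x => `|f x|) @^-1` `]r, +oo[%classic.
  by apply/seteqP; split=> x /=; rewrite in_itv/= andbT.
rewrite -[X in measurable X]setTI.
by apply: measurableT_comp => //; exact: measurable_itv.
Qed.

(** Layer cake: [|f| <= s * #{j | j s < |f|}]. *)
Lemma integral_le_tails (f : R -> R) (s : R) :
  measurable_fun [set: measurableTypeR R] f -> 0 < s ->
  (forall j : nat, (circle_measure R [set x | (j%:R * s < `|f x|)%R] <=
     (2^-1 ^+ j)%:E)%E) ->
  (\int[circle_measure R]_x `|f x|%:E <= (2 * s)%:E)%E.
Proof.
move=> mf s0 hj.
pose A j : set R := [set x | j%:R * s < `|f x|].
have mA j : measurable (A j : set (measurableTypeR R)).
  exact: measurable_superlevel.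
pose h j (x : measurableTypeR R) : \bar R := (s * \1_(A j) x)%:E.
have mh j : measurable_fun [set: measurableTypeR R] (h j).
  by apply/measurable_EFinP; apply: measurable_funM => //; exact: measurable_indic.
have h0 j x : (0 <= h j x)%E by rewrite lee_fin mulr_ge0 ?(ltW s0).
apply: (@le_trans _ _ (\int[circle_measure R]_x (\sum_(0 <= j <oo) h j x))%E).
  apply: ge0_le_integral => //.
  - by apply/measurable_EFinP; exact: measurableT_comp.
  - exact: ge0_emeasurable_sum.
  move=> x _.
  have [J' hJ' Jmin] : exists2 J, `|f x| <= J%:R * s &
      forall j, (j < J)%N -> j%:R * s < `|f x|.
    have ex : exists J : nat, `|f x| <= J%:R * s.
      exists (Num.truncn (`|f x| / s)).+1.
      by rewrite -ler_pdivrMr//; exact/ltW/truncnS_gt.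
    exists (ex_minn ex); case: ex_minnP => // m hm mmin j jm.
    by rewrite ltNge; apply/negP => /mmin; rewrite leqNgt jm.
  apply: le_trans (nneseries_lim_ge J' _); last by move=> j _ _; exact: h0.
  rewrite sumEFin lee_fin big_mkord; apply: (le_trans hJ').
  rewrite -[J' in leLHS]card_ord -sumr_const mulr_suml; apply: ler_sum => j _.
  by rewrite mul1r indicE mem_set ?mulr1//; exact: Jmin.
rewrite integral_nneseries//.
apply: (@le_trans _ _ (\sum_(0 <= j <oo) ((2 * s) / (2 ^ j.+1)%:R)%:E)%E); last first.
  by apply: epsilon_trick0; rewrite mulr_ge0// ltW.
apply: lee_nneseries => [j _ _|j _]; first by apply: integral_ge0 => x _; exact: h0.
rewrite /h; under eq_integral do rewrite EFinM.
rewrite ge0_integralZl_EFin ?(ltW s0)//; last first.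
  by apply/measurable_EFinP; exact: measurable_indic.
rewrite integral_indic// setIT.
apply: (@le_trans _ _ (s%:E * (2^-1 ^+ j)%:E)%E).
  by rewrite lee_pmul2l ?fin_numE ?lte_fin//; exact: hj.
rewrite -EFinM lee_fin expnS natrM natrX exprVn invfM.
by rewrite le_eqVlt; apply/orP; left; apply/eqP; field; rewrite expf_neq0.
Qed.

(** By the layer cake formula, geometric tails around [m] bring the mean close
    to [m]. *)
Lemma mean_near_center (u : R -> R) (m s : R) :
  measurable_fun [set: measurableTypeR R] u -> 0 < s ->
  (forall j : nat, (circle_measure R [set x | (j%:R * s < `|u x - m|)%R] <=
     (2^-1 ^+ j)%:E)%E) ->
  `|(\int[circle_measure R]_x u x) - m| <= 2 * s.
Proof.
move=> mu s0 hj.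
have mf : measurable_fun [set: measurableTypeR R] (fun x => u x - m).
  by apply: measurable_funB.
have h := integral_le_tails mf s0 hj.
have fi : (circle_measure R).-integrable setT (EFin \o (fun x => u x - m)).
  apply/integrableP; split; first exact/measurable_EFinP.
  by apply: le_lt_trans h _; rewrite ltry.
have ci : (circle_measure R).-integrable setT (EFin \o (fun=> m)).
  apply/integrableP; split; first exact/measurable_EFinP.
  rewrite (_ : (fun x => `|(EFin \o (fun=> m)) x|%E) = cst `|m|%:E)//.
  by rewrite integral_cst// circle_measureT mule1 ltry.
have -> : \int[circle_measure R]_x u x =
    \int[circle_measure R]_x (u x - m) + m.
  have := RintegralD measurableT fi ci.
  rewrite Rintegral_cst// circle_measureT mulr1 => <-.
  by apply: eq_Rintegral => x _; rewrite subrK.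
rewrite addrK; apply: le_trans (le_normr_Rintegral measurableT fi) _.
rewrite -lee_fin /Rintegral fineK//.
rewrite ge0_fin_numE; first by apply: le_lt_trans h _; rewrite ltry.
by apply: integral_ge0.
Qed.

End Integration.

(** * The large deviation estimate *)

Section Energy.
Variable R : realType.

Lemma fine_Lnorm_le (f : R -> R) (K : R) : 0 <= K -> (forall x, `|f x| <= K) ->
  fine ('N[circle_measure R]_+oo[EFin \o f])%E <= K.
Proof.
move=> K0 fK; rewrite unlock circle_measureT lte01.
have : (ess_sup (circle_measure R) (abse \o (EFin \o f)) <= K%:E)%E.
  by apply/ess_supP; apply: nearW => x /=; rewrite lee_fin.
by case: (ess_sup _ _) => [r| |].
Qed.

Lemma energy_itv_bound (v : R -> R) (a : R -> R[i]) (la lv Kv Ka E : R) :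
  0 < la -> 0 < lv -> (forall x, `|v x| <= Kv) -> (forall x, normc (a x) <= Ka) ->
  E \in energy_itv v a la lv -> `|E| <= (2 * Ka + Kv) * (la + lv).
Proof.
move=> la0 lv0 hv ha; rewrite inE /energy_itv /= in_itv/= -ler_norml.
move/le_trans; apply; rewrite /energy_radius.
have Kv0 : 0 <= Kv by apply: le_trans (hv 0).
have Ka0 : 0 <= Ka by apply: le_trans (ha 0); exact: normc_ge0.
have h1 := fine_Lnorm_le Kv0 hv.
have ha' x : `|normc (a x)| <= Ka by rewrite ger0_norm ?normc_ge0.
have h2 := fine_Lnorm_le Ka0 ha'.
have h3 := ler_wpM2l (ltW lv0) h1; have h4 := ler_wpM2l (ltW la0) h2.
have : 0 <= la * Kv by rewrite mulr_ge0 ?(ltW la0)//.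
have : 0 <= lv * Ka by rewrite mulr_ge0 ?(ltW lv0)//.
lra.
Qed.

Lemma ln2_ge_half : 2^-1 <= ln 2 :> R.
Proof.
have h : 1 <= ln (2 * 2) :> R.
  rewrite -[leLHS]expRK ler_ln ?posrE ?expR_gt0//.
  by apply: le_trans (expR1_le4 R) _; lra.
by move: h; rewrite lnM ?posrE//; lra.
Qed.

End Energy.

Theorem theorem2 (R : realType) (v : R -> R) (a : R -> R[i])
    (v_per : periodic1 v) (v_an : analytic (@idfun R) v)
    (a_per : periodic1 a) (a_an : analytic (real_complex R) a)
    (a_neq0 : exists x, a x != 0) :
  exists c_va : R, 0 < c_va /\
  forall la : R, 0 < la ->
  exists lambda0 : R,
  forall lv : R, 0 < lv -> lambda0 < lv ->
  exists (n1 : nat) (c1 c2 : R), 0 < c1 /\ 0 < c2 /\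
  forall delta omega E : R,
    0 < delta -> irrational omega -> E \in energy_itv v a la lv ->
    (beta omega < (c_va * Num.min delta `|jacobi_D a la|)%:E)%E ->
  forall n : nat, (n1 <= n)%N ->
    (circle_measure R
       [set x | (delta < `|jacobi_u v a la lv n E omega x
                           - jacobi_L v a la lv n E omega|)%R]
     < (expR (- c1 * delta ^+ 2 * n%:R) + expR (- c2 * delta * n%:R))%:E)%E.
Proof.
have cv := power_series_ccontinuous (analytic_real_series v_an).
have ca := power_series_ccontinuous (analytic_complex_series a_an).
have [Ka hKa] := ccontinuous_periodic_bounded a_per ca.
have [Kv hKv] : exists Kv, forall x, `|v x| <= Kv.
  have vp : periodic1 (fun x => (v x)%:C) by move=> x; rewrite v_per.
  have [K hK] := ccontinuous_periodic_bounded vp cv.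
  by exists K => x; rewrite -normc_real.
have [D [T [D1 T1 H]]] :=
  deviation_tails (2 * Ka + Kv) v_per v_an a_per a_an a_neq0.
have DT : 1 <= D * T by rewrite -[leLHS]mulr1; apply: ler_pM.
(* With [Q = 20 b], the tails hold beyond [s = 20 D T b]; the mean is within
   [2 s] of [m], so that [4 s <= delta], that is [80 D T b <= delta], suffices. *)
exists (80 * (D * T))^-1; split; first by rewrite invr_gt0; lra.
move=> la la0; have [lambda0 Hl] := H la la0.
exists lambda0 => lv lv0 lvl; have [n0 [c [c0 Hc]]] := Hl lv lv0 lvl.
have D0 : 0 < D by lra.
pose c2 := c / (4 * D).
have c20 : 0 < c2 by rewrite divr_gt0//; lra.
exists (n0 + ((Num.truncn (2 / c)).+1 + (Num.truncn c2^-1).+1))%N, 1, c2.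
split; [by []|split=> //] => delta omega E delta0 oirr EE betaE n n1n.
have [n0n nc nc2] : [/\ (n0 <= n)%N, (Num.truncn (2 / c) < n)%N &
    (Num.truncn c2^-1 < n)%N] by clear -n1n; split; lia.
have [b [b2 bc hb]] := beta_cf_q oirr betaE.
have b12 : 2^-1 <= b := le_trans (ln2_ge_half R) b2.
have bdelta : 80 * (D * T) * b <= delta.
  rewrite mulrC -ler_pdivlMr; last by lra.
  apply: (le_trans (ltW bc)); rewrite mulrC ler_wpM2r ?invr_ge0//; first by lra.
  by rewrite ge_min lexx.
have [m Hm] := Hc E (energy_itv_bound la0 lv0 hKv hKa EE).
have Q1 : 1 <= 20 * b by lra.
have reg : regular_rotation (20 * b) omega.
  by move=> N; exact: prod_circle_dist.
have mu := @measurable_jacobi_u R v a la lv E omega n la0 cv ca.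
set u := jacobi_u v a la lv n E omega in mu *.
have tail t : T * (20 * b) <= t ->
    (circle_measure R [set x | (D * t < `|u x - m|)%R]
      <= (2 * expR (- c * t * n%:R))%:E)%E.
  move=> ht; apply: small_measure; last exact: (Hm n _ omega t n0n Q1 reg ht).
  by apply: measurable_superlevel; exact: measurable_funB.
pose t0 := T * (20 * b).
have t01 : 1 <= t0 by rewrite /t0; nra.
have cn : 2 <= c * n%:R.
  rewrite mulrC -ler_pdivrMr//; apply: le_trans (ltW (truncnS_gt _)) _.
  by rewrite ler_nat.
have mean : `|jacobi_L v a la lv n E omega - m| <= 2 * (D * t0).
  apply: mean_near_center => //; first by rewrite mulr_gt0//; lra.
  move=> [|j].
    rewrite expr0; apply: (@le_trans _ _ (circle_measure R setT)).
      apply: le_measure; rewrite ?inE//.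
      by apply: measurable_superlevel; exact: measurable_funB.
    by rewrite circle_measureT.
  have -> : [set x | j.+1%:R * (D * t0) < `|u x - m|] =
      [set x | D * (j.+1%:R * t0) < `|u x - m|].
    by rewrite mulrCA.
  apply: le_trans (tail _ _) _; first by rewrite -/t0 ler_peMl ?ler1n// (le_trans _ t01).
  rewrite lee_fin.
  have e4 : expR (- c * (j.+1%:R * t0) * n%:R) <= 4^-1 ^+ j.+1.
    have -> : - c * (j.+1%:R * t0) * n%:R = j.+1%:R * - (c * n%:R * t0) by ring.
    rewrite expRM_natl lerXn2r ?nnegrE ?expR_ge0//.
    rewrite expRN lef_pV2 ?posrE ?expR_gt0//; apply: expR_ge4.
    by apply: (le_trans cn); rewrite ler_peMr//; lra.
  apply: (@le_trans _ _ (2 * 4^-1 ^+ j.+1)); first by rewrite ler_pM2l.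
  have -> : 4^-1 ^+ j.+1 = 2^-1 ^+ j.+1 * 2^-1 ^+ j.+1 :> R.
    by rewrite -exprMn; congr (_ ^+ _); lra.
  rewrite mulrA ler_piMl ?exprn_ge0// exprS mulrA divff// mul1r.
  by rewrite exprn_ile1//; lra.
have Ddelta : 2 * (D * t0) <= delta / 2 by rewrite /t0; lra.
pose t := delta / (2 * D).
have tt0 : T * (20 * b) <= t.
  by rewrite /t ler_pdivlMr; lra.
have Dt : D * t = delta / 2 by rewrite /t; field; lra.
set L := jacobi_L _ _ _ _ _ _ _ in mean *.
have bound : (circle_measure R [set x | (delta < `|u x - L|)%R]
      <= (2 * expR (- c * t * n%:R))%:E)%E.
  apply: le_trans (tail t tt0); apply: le_measure; rewrite ?inE.
  - by apply: measurable_superlevel; exact: measurable_funB.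
  - by apply: measurable_superlevel; exact: measurable_funB.
  - move=> x /= hx; rewrite Dt.
    have := ler_normB (u x - m) (L - m).
    have -> : u x - m - (L - m) = u x - L by ring.
    lra.
apply: (le_lt_trans bound); rewrite lte_fin.
have delta1 : 1 <= delta.
  by apply: le_trans bdelta; nra.
have c2n : 1 <= c2 * delta * n%:R.
  have h : 1 <= c2 * n%:R.
    rewrite mulrC -ler_pdivrMr// div1r; apply: le_trans (ltW (truncnS_gt _)) _.
    by rewrite ler_nat.
  by rewrite mulrAC; apply: (le_trans h); rewrite ler_peMr//; lra.
have -> : - c * t * n%:R = - c2 * delta * n%:R + - c2 * delta * n%:R.
  by rewrite /t /c2; field; lra.
rewrite expRD; apply: (@le_lt_trans _ _ (expR (- c2 * delta * n%:R))).
  rewrite mulrA ler_piMl ?expR_ge0//.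
  have : 2 <= expR (c2 * delta * n%:R).
    by have := expR_ge1Dx (c2 * delta * n%:R); lra.
  have -> : - c2 * delta * n%:R = - (c2 * delta * n%:R) by ring.
  by rewrite expRN ler_pdivrMr ?expR_gt0// mul1r.
by rewrite ltrDr expR_gt0.
Qed.
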